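(* Let $\ell\in\mathbb{N}$ and $\vec\phi=(\phi_1,\dots,\phi_\ell):[0,\infty)\to\mathbb{R}^\ell$. For each $1\le k\le\ell$ suppose there are a constant $y_0\ge0$ with $\phi_k$ square-integrable on $[0,y_0]$, an increasing sequence $(\lambda_{k,n})_n$ of positive reals tending to infinity, complex numbers $(r_{k,n})_n$, $c_k\in\mathbb{R}$ and $X_0>0$ such that for all $y\ge y_0$, $X\ge X_0$, $$\phi_k(y)=c_k+\Re\Big(\sum_{\lambda_{k,n}\le X}r_{k,n}e^{i\lambda_{k,n}y}\Big)+\mathcal{E}_k(y,X),\qquad\lim_{Y\to\infty}\frac1Y\int_{y_0}^Y|\mathcal{E}_k(y,e^Y)|^2dy=0,$$ and at least one of the following holds (with $\lambda_n=\lambda_{k,n}$, $r_n=r_{k,n}$): (A) for some $\beta>1/2,\gamma\ge0$, $\sum_{T<\lambda_n\le T+1}|r_n|\ll(\log T)^\gamma/T^\beta$; (B) for some $\alpha,\beta>0,\gamma\ge0$ with $\beta\le\min\{1,\alpha\}$, $\alpha^2+\alpha/2<\beta^2+\beta$, $\sum_{S<\lambda_n\le T}|r_n|\ll(T-S)^\alpha(\log T)^\gamma/S^\beta$ for $T>S>0$; (C) $r_n\ll\lambda_n^{-\beta}$ for some $\beta>1/2$ and $\sum_{T<\lambda_n\le T+1}1\ll\log T$; (D) for some $0\le\theta<3-\sqrt3$, $\sum_{T<\lambda_n\le T+1}1\ll\log T$ and $\sum_{\lambda_n\le T}\lambda_n^2|r_n|^2\ll T^\theta$. Then $\vec\phi$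 has a limiting distribution $\mu$. Let $(\lambda_m)_{m\in\mathbb{N}}$ be the increasing enumeration of the set $\bigcup_{k=1}^\ell\bigcup_{n\ge1}\{\lambda_{k,n}\}$, and for $1\le k\le\ell$ put $r_k(\lambda_m)=r_{k,n}$ if $\lambda_m=\lambda_{k,n}$ for some $n$, and $r_k(\lambda_m)=0$ otherwise. Suppose that $\{\lambda_m\}_{m\in\mathbb{N}}$ is linearly independent over $\mathbb{Q}$. Then for every $\vec\xi=(\xi_1,\dots,\xi_\ell)\in\mathbb{R}^\ell$ the Fourier transform $\hat\mu(\vec\xi)=\int_{\mathbb{R}^\ell}e^{-i\sum_{j=1}^\ell\xi_jt_j}d\mu(t_1,\dots,t_\ell)$ exists and $$\hat\mu(\vec\xi)=\exp\Big(-i\sum_{k=1}^\ell c_k\xi_k\Big)\prod_{m=1}^\infty J_0\Big(\Big|\sum_{k=1}^\ell r_k(\lambda_m)\xi_k\Big|\Big),$$ where $J_0(z)=\int_0^1e^{-iz\cos(2\pi t)}dt$.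
   Context: Notation: $f\ll g$ means $|f|\le M|g|$ for some $M>0$ and all sufficiently large values of the variable. A function $\vec\phi:[0,\infty)\to\mathbb{R}^\ell$ has a limiting distribution $\mu$ if $\mu$ is a probability measure on $\mathbb{R}^\ell$ and $\lim_{Y\to\infty}\frac1Y\int_0^Yf(\vec\phi(y))dy=\int f\,d\mu$ for every bounded continuous $f:\mathbb{R}^\ell\to\mathbb{R}$. *)

(* Defs.v *)
From HB Require Import structures.
From mathcomp Require Import all_boot all_order all_algebra.
From mathcomp Require Import all_classical all_reals all_analysis.
From mathcomp Require Import complex.
Import Order.TTheory GRing.Theory Num.Theory.
Import numFieldNormedType.Exports numFieldTopology.Exports.

Set Implicit Arguments.
Unset Strict Implicit.
Unset Printing Implicit Defensive.

Local Open Scope classical_set_scope.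
Local Open Scope ring_scope.
Local Open Scope complex_scope.

Definition cabs (R : realType) (z : R[i]) : R := Normc.normc z.

(* Re ( sum_{lam n <= X} r n e^{i lam n y} ), the real part written out *)
Definition trigsum (R : realType) (lam : nat -> R) (r : nat -> R[i]) (X y : R) : R :=
  \sum_(n \in [set n | lam n <= X]) (complex.Re (r n) * cos (lam n * y) - complex.Im (r n) * sin (lam n * y)).

Definition wsum (R : realType) (lam : nat -> R) (a : nat -> R) (S T : R) : R :=
  \sum_(n \in [set n | S < lam n <= T]) a n.

Definition psum (R : realType) (lam : nat -> R) (a : nat -> R) (T : R) : R :=
  \sum_(n \in [set n | lam n <= T]) a n.

Definition ll (R : realType) (f g : R -> R) : Prop :=
  exists M T0 : R, forall T, T0 <= T -> `|f T| <= M * `|g T|.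

Definition condA (R : realType) (lam : nat -> R) (r : nat -> R[i]) : Prop :=
  exists beta gamma : R, 1 / 2 < beta /\ 0 <= gamma /\
    ll (fun T => wsum lam (fun n => cabs (r n)) T (T + 1))
       (fun T => (ln T) `^ gamma / T `^ beta).

Definition condB (R : realType) (lam : nat -> R) (r : nat -> R[i]) : Prop :=
  exists alpha beta gamma : R, 0 < alpha /\ 0 < beta /\ 0 <= gamma /\
    beta <= Num.min 1 alpha /\
    alpha ^+ 2 + alpha / 2 < beta ^+ 2 + beta /\
    exists M T0 : R, forall S T, T0 <= S -> S < T ->
      `|wsum lam (fun n => cabs (r n)) S T|
        <= M * `|(T - S) `^ alpha * (ln T) `^ gamma / S `^ beta|.

Definition condC (R : realType) (lam : nat -> R) (r : nat -> R[i]) : Prop :=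
  exists beta : R, 1 / 2 < beta /\
    (exists (M : R) (N : nat), forall n, (N <= n)%N ->
        cabs (r n) <= M * `|lam n `^ (- beta)|) /\
    ll (fun T => wsum lam (fun _ => 1) T (T + 1)) (@ln R).

Definition condD (R : realType) (lam : nat -> R) (r : nat -> R[i]) : Prop :=
  exists theta : R, 0 <= theta /\ theta < 3 - Num.sqrt 3 /\
    ll (fun T => wsum lam (fun _ => 1) T (T + 1)) (@ln R) /\
    ll (fun T => psum lam (fun n => lam n ^+ 2 * cabs (r n) ^+ 2) T)
       (fun T => T `^ theta).

Definition RBorel (R : realType) (l : nat) :=
  g_sigma_algebraType (open : set (set 'rV[R]_l)).

Definition dotv (R : realType) (l : nat) (xi t : 'rV[R]_l) : R :=
  \sum_(k < l) xi ord0 k * t ord0 k.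

Definition limiting_distribution (R : realType) (l : nat)
    (phi : R -> 'rV[R]_l) (mu : probability (RBorel R l) R) : Prop :=
  forall f : 'rV[R]_l -> R, continuous f -> (exists M : R, forall x, `|f x| <= M) ->
    (fun Y : R => ((Y^-1)%:E * \int[lebesgue_measure]_(y in `[0%R, Y]) (f (phi y))%:E)%E)
      @ +oo%R --> (\int[mu]_t (f t)%:E)%E.

(* Fourier transform hat mu(xi) = int e^{-i xi.t} dmu(t) = int cos - i int sin *)
Definition fourier_exists (R : realType) (l : nat) (mu : probability (RBorel R l) R)
    (xi : 'rV[R]_l) : Prop :=
  mu.-integrable setT (fun t => (cos (dotv xi t))%:E) /\
  mu.-integrable setT (fun t => (sin (dotv xi t))%:E).

Definition fourier (R : realType) (l : nat) (mu : probability (RBorel R l) R)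
    (xi : 'rV[R]_l) : R[i] :=
  fine (\int[mu]_t (cos (dotv xi t))%:E)%E -i* fine (\int[mu]_t (sin (dotv xi t))%:E)%E.

Definition J0 (R : realType) (z : R) : R[i] :=
  fine (\int[lebesgue_measure]_(t in `[0%R, 1%R]) (cos (z * cos (2 * pi * t)))%:E)%E
  -i* fine (\int[lebesgue_measure]_(t in `[0%R, 1%R]) (sin (z * cos (2 * pi * t)))%:E)%E.

Definition rcoef (R : realType) (lam : nat -> R) (r : nat -> R[i]) (x : R) : R[i] :=
  match pselect (exists n, lam n = x) with
  | left H => r (proj1_sig (cid H))
  | right _ => 0
  end.

Definition Q_lin_indep (R : realType) (Lam : nat -> R) : Prop :=
  forall (N : nat) (q : nat -> rat),
    \sum_(m < N) ratr (q m) * Lam m = 0 -> forall m, (m < N)%N -> q m = 0.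

(* Main.v *)
(**
Put [a_j = \sum_(j < lambda_n <= j + 1) |r_n|] for each component.  Each of the
conditions (A)-(D) implies [\sum_j a_j ^ 2 < oo], by dyadic summation.  Expanding the
square and grouping frequencies into unit blocks, the mean square over [[0, Y]] of
the part of the trigonometric sum with [X < lambda_n <= e^Y] is bounded by a
constant times [\sum_(j > X - 1) a_j ^ 2]: far blocks cost a harmonic sum over
[e^Y] terms, that is a factor [Y], which the normalization absorbs.  Hence [phi] is
a limit, in the Besicovitch quadratic seminorm, of trigonometric polynomials [P_X].

For [f] continuous, [f (P_X)] is almost periodic, so it has a mean value; for [f]
bounded and continuous the mean value of [f (phi)] exists by approximation, and is a
positive tight functional of [f], represented by a probability measure.

If the frequencies are linearly independent over [Q], every tone
[exp (- i a cos (lambda_m y + theta))] with [m >= M] is, by expansion into trigonometric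
polynomials, uncorrelated in mean with any function of the tones of index [< M], so
the Fourier transforms of the distributions of the [P_X] are partial products of
the [J0] factors; these converge to the Fourier transform of the limit.
*)

Require Import Defs.
From HB Require Import structures.
From mathcomp Require Import all_boot all_order all_algebra.
From mathcomp Require Import all_classical all_reals all_analysis.
From mathcomp Require Import complex.
From mathcomp Require Import measurable_realfun ring lra.
Import Order.TTheory GRing.Theory Num.Theory.
Import numFieldNormedType.Exports numFieldTopology.Exports.
Local Open Scope classical_set_scope.
Local Open Scope ring_scope.

Set Implicit Arguments.
Unset Strict Implicit.
Unset Printing Implicit Defensive.

(** * Weighted sums over frequencies and their unit blocks *)

(** Two features of the data shape the proof. The cutoff [expR Y] in the error term moves with [Y],
    so comparing [phi] with a fixed polynomial also costs the terms with frequency between [X] and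
    [expR Y], whose mean square must be small uniformly in [Y]. And [phi] is assumed measurable only
    on [[y0, +oo[]: it is replaced by a function vanishing before [y0], and that the means of
    [f (phi)] survive is a statement on integrals of possibly nonmeasurable functions.

    No equidistribution on a torus is invoked. Mean values come from total boundedness of
    translates, and linear independence acts through a decorrelation property strong enough to be
    carried along an induction on the number of frequencies. Tightness has a single source:
    closeness in mean square to one bounded polynomial bounds the second moment of [phi].
    Convergence of the infinite product is read off from the limiting measure, without any estimate
    on [J0]. *)

Section FrequencySums.
Context {R : realType}.
Variable lam : nat -> R.
Hypothesis lam_oo : lam n @[n --> \oo] --> +oo.
Implicit Types (a b : nat -> R) (S T U : R).

Lemma frequency_cut T : exists K : nat, forall n, (K <= n)%N -> T < lam n.
Proof. by have /cvgryPgt/(_ T)[K _ KP] := lam_oo; exists K => n /KP. Qed.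

(** A sum over a classical set is 0 by convention when its support is infinite; a bound on the
    indices satisfying [P] makes it a genuine finite sum over ordinals. *)
Lemma fsum_cut (P : pred nat) a (K : nat) : (forall n, (K <= n)%N -> ~~ P n) ->
  \sum_(n \in [set n | P n]) a n = \sum_(n < K | P n) a n.
Proof.
move=> KP; rewrite (fsbigE [seq n <- iota 0 K | P n]).
- rewrite big_filter_cond -[K in iota 0 K]subn0 big_mkord; apply: eq_bigl => n.
  by case: (boolP (P n)) => //= Pn; rewrite mem_set.
- by rewrite filter_uniq// iota_uniq.
- by move=> n /=; rewrite mem_filter => /andP[].
- move=> n /= Pn; rewrite mem_filter Pn/= mem_iota/= add0n -leqNgt => /KP.
  by rewrite Pn.
Qed.

Lemma wsumE a S T (K : nat) : (forall n, (K <= n)%N -> T < lam n) ->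
  wsum lam a S T = \sum_(n < K | S < lam n <= T) a n.
Proof.
move=> KT; apply: (@fsum_cut (fun n => S < lam n <= T)) => n /KT h.
by rewrite [_ <= T]leNgt h andbF.
Qed.

Lemma psumE a T (K : nat) : (forall n, (K <= n)%N -> T < lam n) ->
  psum lam a T = \sum_(n < K | lam n <= T) a n.
Proof.
by move=> KT; apply: (@fsum_cut (fun n => lam n <= T)) => n /KT; rewrite ltNge.
Qed.

Lemma wsum_ge0 a S T : (forall n, 0 <= a n) -> 0 <= wsum lam a S T.
Proof.
move=> a0; have [K KT] := frequency_cut T; rewrite (wsumE _ _ KT); exact: sumr_ge0.
Qed.

Lemma ler_wsum a b S T : (forall n, S < lam n -> lam n <= T -> a n <= b n) ->
  wsum lam a S T <= wsum lam b S T.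
Proof.
move=> ab; have [K KT] := frequency_cut T; rewrite !(wsumE _ _ KT).
by apply: ler_sum => n /andP[]; exact: ab.
Qed.

Lemma wsumZ (c : R) a S T : wsum lam (fun n => c * a n) S T = c * wsum lam a S T.
Proof. by have [K KT] := frequency_cut T; rewrite !(wsumE _ _ KT) mulr_sumr. Qed.

Lemma wsum_cat a S T U : S <= T -> T <= U ->
  wsum lam a S U = wsum lam a S T + wsum lam a T U.
Proof.
move=> ST TU; have [K KU] := frequency_cut U.
have KT n : (K <= n)%N -> T < lam n by move=> /KU; exact: le_lt_trans.
rewrite (wsumE _ _ KU) (wsumE a S KT) (wsumE a T KU).
rewrite (bigID (fun n : 'I_K => lam n <= T))/=; congr (_ + _); apply: eq_bigl => n.
  case: (leP (lam n) T) => h; last by rewrite !andbF.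
  by rewrite (le_trans h TU) !andbT.
rewrite -ltNge; case: (ltP T (lam n)) => h; last by rewrite !andbF.
by rewrite (le_lt_trans ST h) andbT.
Qed.

Lemma wsum_psum a S T : (forall n, 0 <= a n) -> wsum lam a S T <= psum lam a T.
Proof.
move=> a0; have [K KT] := frequency_cut T.
rewrite (wsumE _ _ KT) (psumE _ KT) [leRHS](bigID (fun n : 'I_K => S < lam n))/=.
rewrite (eq_bigl (fun n : 'I_K => (lam n <= T) && (S < lam n))).
  by rewrite lerDl sumr_ge0.
by move=> n; rewrite andbC.
Qed.

Lemma wsum_blocks a (m n : nat) : (m <= n)%N ->
  \sum_(m <= j < n) wsum lam a j%:R (j%:R + 1) = wsum lam a m%:R n%:R.
Proof.
move=> mn; rewrite -(subnKC mn); elim: (n - m)%N => [|k IH].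
  rewrite addn0 big_geq//; have [K KT] := frequency_cut m%:R.
  rewrite (wsumE _ _ KT) big_pred0// => i; apply/negP => /andP[h1 h2].
  by have := lt_le_trans h1 h2; rewrite ltxx.
rewrite addnS big_nat_recr ?leq_addr//= IH -[in RHS]natr1.
by rewrite -wsum_cat// ?ler_nat ?leq_addr// lerDl.
Qed.

(* Cauchy-Schwarz *)
Lemma wsum_sqr a S T : (forall n, 0 <= a n) ->
  wsum lam a S T ^+ 2 <= wsum lam (fun=> 1) S T * wsum lam (fun n => a n ^+ 2) S T.
Proof.
move=> a0; have [K KT] := frequency_cut T; rewrite !(wsumE _ _ KT) expr2.
have E (b c : nat -> R) : (\sum_(n < K | S < lam n <= T) b n) * (\sum_(n < K | S < lam n <= T) c n) =
    \sum_(n < K | S < lam n <= T) \sum_(m < K | S < lam m <= T) (b n * c m).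
  by rewrite mulr_suml; apply: eq_bigr => n _; rewrite mulr_sumr.
rewrite E [X in _ <= X](E (fun=> 1) (fun n => a n ^+ 2)); set s2 := (X in _ <= X).
(* Symmetrizing the double sum reduces the claim, term by term, to
   [a n * a m <= (a n ^+ 2 + a m ^+ 2) / 2]. *)
have s2E : s2 = \sum_(n < K | S < lam n <= T) \sum_(m < K | S < lam m <= T) (a n ^+ 2 + a m ^+ 2) / 2.
  have e1 : s2 = \sum_(n < K | S < lam n <= T) \sum_(m < K | S < lam m <= T) a m ^+ 2.
    by apply: eq_bigr => n _; apply: eq_bigr => m _; rewrite mul1r.
  have e2 : s2 = \sum_(n < K | S < lam n <= T) \sum_(m < K | S < lam m <= T) a n ^+ 2.
    by rewrite e1 exchange_big.
  apply: (@mulfI _ 2); first by rewrite pnatr_eq0.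
  rewrite mulr_natl mulr2n {1}e2 {1}e1 -big_split/= mulr_sumr; apply: eq_bigr => n _.
  by rewrite -big_split mulr_sumr; apply: eq_bigr => m _ /=; field.
rewrite s2E; apply: ler_sum => n _; apply: ler_sum => m _.
by have := sqr_ge0 (a n - a m : R); nra.
Qed.

End FrequencySums.

(** * Boundedness of series from their dyadic ranges *)

Section DyadicSums.
Context {R : realType}.

Lemma dyadic_bounded (f : nat -> R) (C q : R) (s0 : nat) :
  (forall j, 0 <= f j) -> 0 <= C -> 0 <= q < 1 ->
  (forall s, (s0 <= s)%N -> \sum_(2 ^ s <= j < 2 ^ s.+1) f j <= C * q ^+ s) ->
  exists B, forall N : nat, \sum_(0 <= j < N) f j <= B.
Proof.
move=> f0 C0 /andP[q0 q1] fs.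
have mono (m n : nat) : (m <= n)%N -> \sum_(0 <= j < m) f j <= \sum_(0 <= j < n) f j.
  by move=> mn; rewrite (big_cat_nat (leq0n m) mn)/= lerDl sumr_ge0.
pose A := \sum_(0 <= j < 2 ^ s0) f j.
have H (k : nat) : \sum_(0 <= j < 2 ^ (s0 + k)) f j <= A + C * \sum_(i < s0 + k) q ^+ i.
  elim: k => [|k IH].
    by rewrite addn0 lerDl mulr_ge0// sumr_ge0// => i _; rewrite exprn_ge0.
  rewrite addnS (big_cat_nat (n := (2 ^ (s0 + k))%N))//=; last by rewrite leq_exp2l.
  rewrite big_ord_recr/= mulrDr addrA lerD//; apply: fs; exact: leq_addr.
have q1' : 0 < 1 - q by rewrite subr_gt0.
have geo (k : nat) : \sum_(i < k) q ^+ i <= (1 - q)^-1.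
  rewrite -[leRHS]mul1r ler_pdivlMr// mulrC mulrBl mul1r.
  suff -> : \sum_(i < k) q ^+ i - q * (\sum_(i < k) q ^+ i) = 1 - q ^+ k.
    by rewrite gerBl exprn_ge0.
  elim: k => [|k IH]; first by rewrite big_ord0 mulr0 expr0 !subrr.
  by rewrite big_ord_recr/= mulrDr exprS; lra.
exists (A + C * (1 - q)^-1) => N.
apply: le_trans (mono N (2 ^ (s0 + N))%N _) _.
  by apply: leq_trans (ltnW (ltn_expl N (isT : (1 < 2)%N))) _; rewrite leq_exp2l// leq_addl.
by apply: le_trans (H N) _; rewrite lerD2l ler_wpM2l.
Qed.

(* A power of [s] is absorbed by half of the exponential decay. *)
Lemma dyadic_log_bounded (f : nat -> R) (M kappa eta : R) (s0 : nat) :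
  (forall j, 0 <= f j) -> 0 <= M -> 0 <= kappa -> 0 < eta ->
  (forall s, (s0 <= s)%N -> \sum_(2 ^ s <= j < 2 ^ s.+1) f j <=
     M * (s.+1%:R `^ kappa * expR (- (eta * s%:R)))) ->
  exists B, forall N : nat, \sum_(0 <= j < N) f j <= B.
Proof.
move=> f0 M0 k0 eta0 fs.
(* Chosen so that [d * kappa <= eta / 2]; the [+ 1] covers [kappa = 0]. The power is then bounded
   through [x <= d^-1 * expR (d * x)]. *)
pose d := eta / 2 / (kappa + 1).
have k1 : 0 < kappa + 1 by rewrite ltr_wpDl.
have d0 : 0 < d by rewrite !divr_gt0.
have kd : d * kappa <= eta / 2.
  rewrite /d mulrAC ler_pdivrMr// ler_pM2l ?divr_gt0//; lra.
pose D := d^-1 `^ kappa; have D0 : 0 <= D := powR_ge0 _ _.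
apply: (@dyadic_bounded f (M * (D * expR (eta / 2))) (expR (- (eta / 2))) s0) => //.
- by rewrite !mulr_ge0 ?expR_ge0.
- by rewrite expR_ge0 expR_lt1 oppr_lt0 divr_gt0.
move=> s /fs /le_trans; apply; rewrite -mulrA ler_wpM2l// -expRM_natr.
have H : s.+1%:R `^ kappa <= D * expR (eta / 2 * s.+1%:R).
  apply: (@le_trans _ _ ((d^-1 * expR (d * s.+1%:R)) `^ kappa)).
    apply: ge0_ler_powR => //; rewrite ?nnegrE ?mulr_ge0 ?expR_ge0 ?invr_ge0 ?(ltW d0)//.
    rewrite ler_pdivlMl//; apply: le_trans (expR_ge1Dx _).
    by rewrite mulrC lerDr.
  rewrite powRM ?expR_ge0 ?invr_ge0 ?(ltW d0)// ler_wpM2l// -expRM ler_expR.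
  by rewrite mulrAC ler_pM2r.
apply: le_trans (_ : D * expR (eta / 2 * s.+1%:R) * expR (- (eta * s%:R)) <= _).
  by rewrite ler_wpM2r// expR_ge0.
rewrite -!mulrA ler_wpM2l// -!expRD ler_expR -[s.+1%:R]natr1; lra.
Qed.

End DyadicSums.

(** * Square summability of the blocks under conditions (A)-(D) *)

Section BlockSums.
Context {R : realType}.

Lemma ln2_itv : 0 < ln (2 : R) <= 1.
Proof.
rewrite ln_gt0 ?ltr1n//= -[leRHS](@expRK R) ler_ln ?posrE ?expR_gt0//.
exact: expR_ge1Dx.
Qed.

Lemma powR_exp2n (s : nat) (x : R) : ((2 ^ s)%N%:R : R) `^ x = expR (x * ln 2 * s%:R).
Proof.
by rewrite /powR pnatr_eq0 expn_eq0/= natrX lnXn// mulr_natr mulrnAr.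
Qed.

Lemma ln_dyadic (s j : nat) (d : R) : (2 ^ s <= j)%N -> 0 <= d ->
  j%:R + d <= (2 ^ s.+1)%:R -> 0 <= ln (j%:R + d) <= s.+1%:R.
Proof.
move=> sj d0 js; have j1 : (1 <= j)%N by rewrite (leq_trans _ sj)// expn_gt0.
have jd1 : 1 <= j%:R + d by rewrite -[leLHS]addr0 lerD// ler1n.
rewrite ln_ge0//=; apply: (@le_trans _ _ (ln (2 ^ s.+1)%:R)).
  by rewrite ler_ln ?posrE// ?ltr0n ?expn_gt0// (lt_le_trans ltr01).
rewrite natrX lnXn// -[leLHS]mulr_natl ler_piMr//.
by have /andP[] := ln2_itv.
Qed.

Lemma exp2n_ge (T0 : R) : exists s0 : nat, forall s, (s0 <= s)%N -> T0 <= (2 ^ s)%N%:R.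
Proof.
exists (Num.truncn T0).+1 => s ss; apply: (ltW (lt_le_trans (truncnS_gt _) _)).
by rewrite ler_nat (leq_trans ss)// ltnW// ltn_expl.
Qed.

Variables (lam : nat -> R) (r : nat -> R[i]).
Hypothesis lam_oo : lam n @[n --> \oo] --> +oo.
Hypothesis lam_incr : forall m n, (m < n)%N -> lam m < lam n.

Let b n := cabs (r n).

Lemma cabs_ge0 (z : R[i]) : 0 <= cabs z.
Proof. by case: z => x y; rewrite /cabs/=; exact: sqrtr_ge0. Qed.

Definition block (j : nat) : R := wsum lam b j%:R (j%:R + 1).

Lemma block_ge0 j : 0 <= block j.
Proof. by apply: wsum_ge0 => // n; exact: cabs_ge0. Qed.

Definition block_square_summable :=
  exists B, forall N : nat, \sum_(0 <= j < N) block j ^+ 2 <= B.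

(* On a dyadic range the sum of squares is at most the largest block times the sum
   of the blocks. *)
Lemma block_square_summable_crit (M alpha beta gamma : R) (s0 : nat) :
  0 <= M -> 0 <= gamma -> alpha < 2 * beta ->
  (forall s j, (s0 <= s)%N -> (2 ^ s <= j < 2 ^ s.+1)%N ->
     block j <= M * (s.+1%:R `^ gamma * expR (- beta * ln 2 * s%:R))) ->
  (forall s, (s0 <= s)%N -> \sum_(2 ^ s <= j < 2 ^ s.+1) block j <=
     M * (s.+1%:R `^ gamma * expR ((alpha - beta) * ln 2 * s%:R))) ->
  block_square_summable.
Proof.
move=> M0 g0 ab H1 H2; have /andP[l20 _] := ln2_itv.
apply: (@dyadic_log_bounded _ _ (M * M) (gamma + gamma) ((2 * beta - alpha) * ln 2) s0) => //.
- by move=> j; exact: sqr_ge0.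
- exact: mulr_ge0.
- exact: addr_ge0.
- by rewrite mulr_gt0// subr_gt0.
move=> s ss.
apply: (@le_trans _ _ (\sum_(2 ^ s <= j < 2 ^ s.+1)
    M * (s.+1%:R `^ gamma * expR (- beta * ln 2 * s%:R)) * block j)).
  rewrite !big_nat; apply: ler_sum => j sj; rewrite expr2.
  by rewrite ler_wpM2r ?block_ge0// H1.
rewrite -mulr_sumr.
apply: le_trans (ler_wpM2l _ (H2 s ss)) _.
  by rewrite !mulr_ge0 ?powR_ge0 ?expR_ge0.
rewrite powRD; last by rewrite pnatr_eq0 implybT.
rewrite (_ : - ((2 * beta - alpha) * ln 2 * s%:R) =
  (- beta * ln 2 * s%:R) + (alpha - beta) * ln 2 * s%:R); last by ring.
by rewrite expRD le_eqVlt; apply/orP; left; apply/eqP; ring.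
Qed.

(** A dyadic range has [2 ^ s] blocks, so a bound on each block bounds their sum with [alpha = 1],
    and [alpha < 2 * beta] becomes [1 / 2 < beta]. *)
Lemma block_square_summable_crit1 (M beta gamma : R) (s0 : nat) :
  0 <= M -> 0 <= gamma -> 1 / 2 < beta ->
  (forall s j, (s0 <= s)%N -> (2 ^ s <= j < 2 ^ s.+1)%N ->
     block j <= M * (s.+1%:R `^ gamma * expR (- beta * ln 2 * s%:R))) ->
  block_square_summable.
Proof.
move=> M0 g0 b12 H1.
apply: (@block_square_summable_crit M 1 beta gamma s0) => //; first by lra.
move=> s ss.
apply: (@le_trans _ _ (\sum_(2 ^ s <= j < 2 ^ s.+1)
    M * (s.+1%:R `^ gamma * expR (- beta * ln 2 * s%:R)))).
  by rewrite !big_nat; apply: ler_sum => j; exact: H1.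
rewrite sumr_const_nat (_ : (2 ^ s.+1 - 2 ^ s)%N = (2 ^ s)%N); last by rewrite expnS mul2n -addnn addnK.
rewrite -[leLHS]mulr_natr -2!mulrA ler_wpM2l// ler_wpM2l ?powR_ge0//.
have -> : (2 ^ s)%N%:R = expR (1 * ln 2 * s%:R) :> R by rewrite -powR_exp2n powRr1.
by rewrite -expRD ler_expR; lra.
Qed.

Lemma condA_block : condA lam r -> block_square_summable.
Proof.
move=> [beta [gamma [b12 [g0 [M [T0 H]]]]]].
have [s0 s0P] := exp2n_ge T0.
apply: (@block_square_summable_crit1 `|M| beta gamma s0) => // s j ss /andP[sj js].
have Tj : T0 <= j%:R by rewrite (le_trans (s0P _ ss))// ler_nat.
apply: le_trans (ler_norm _) _; apply: le_trans (H _ Tj) _.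
apply: (@le_trans _ _ (`|M| * `|ln j%:R `^ gamma / j%:R `^ beta|)).
  by rewrite ler_wpM2r// ler_norm.
rewrite ler_wpM2l// ger0_norm ?divr_ge0 ?powR_ge0//.
have := @ln_dyadic s j 0 sj (lexx _); rewrite addr0 ler_nat => /(_ (ltnW js))/andP[lj0 ljs].
apply: ler_pM; rewrite ?invr_ge0 ?powR_ge0//.
  by apply: ge0_ler_powR; rewrite ?nnegrE.
rewrite mulNr mulNr expRN -powR_exp2n lef_pV2 ?posrE ?powR_gt0 ?ltr0n ?expn_gt0//.
  by apply: ge0_ler_powR; rewrite ?nnegrE ?ler_nat//; lra.
by rewrite (leq_trans _ sj)// expn_gt0.
Qed.

(** The hypothesis is used at two scales: windows of length 1 bound each block, and windows
    [T = 2 * S] bound the sum over a dyadic range, with the extra factor [2 ^ (alpha * s)]. *)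
Lemma condB_block : condB lam r -> block_square_summable.
Proof.
move=> [alpha [beta [gamma [a0 [b0 [g0 [_ [ab [M [T0 H]]]]]]]]]].
have [s0 s0P] := exp2n_ge T0.
(* If [2 * beta <= alpha], then [alpha ^+ 2 + alpha / 2] is at least [4 * beta ^+ 2 + beta], against
   the assumed inequality. *)
have ab2 : alpha < 2 * beta by rewrite ltNge; apply/negP => h; nra.
have MB S T s : T0 <= S -> S < T -> (2 ^ s)%:R <= S -> 0 <= ln T <= s.+1%:R ->
    wsum lam b S T <= `|M| * ((T - S) `^ alpha * (s.+1%:R `^ gamma * expR (- beta * ln 2 * s%:R))).
  move=> TS ST sS /andP[l0 ls].
  have S0 : 0 < S by rewrite (lt_le_trans _ sS)// ltr0n expn_gt0.
  apply: le_trans (ler_norm _) _; apply: le_trans (H _ _ TS ST) _.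
  apply: (@le_trans _ _ (`|M| * `|(T - S) `^ alpha * (ln T) `^ gamma / S `^ beta|)).
    by rewrite ler_wpM2r// ler_norm.
  rewrite ler_wpM2l// ger0_norm ?divr_ge0 ?mulr_ge0 ?powR_ge0//.
  rewrite -mulrA ler_wpM2l ?powR_ge0//; apply: ler_pM; rewrite ?invr_ge0 ?powR_ge0//.
    by apply: ge0_ler_powR; rewrite ?nnegrE.
  rewrite mulNr mulNr expRN -powR_exp2n lef_pV2 ?posrE ?powR_gt0 ?ltr0n ?expn_gt0//.
  by apply: ge0_ler_powR; rewrite ?nnegrE//; exact: ltW.
apply: (@block_square_summable_crit `|M| alpha beta gamma s0) => //.
- move=> s j ss /andP[sj js].
  have Tj : T0 <= j%:R by rewrite (le_trans (s0P _ ss))// ler_nat.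
  have /MB : T0 <= j%:R := Tj; move=> /(_ (j%:R + 1) s); rewrite ltrDl ltr01 ler_nat.
  move=> /(_ isT sj); rewrite (_ : j%:R + 1 - j%:R = 1) ?powR1 ?mul1r; last by rewrite addrAC subrr add0r.
  apply.
  by apply: ln_dyadic => //; rewrite natr1 ler_nat.
- move=> s ss.
  rewrite wsum_blocks//; last by rewrite leq_exp2l.
  have := MB (2 ^ s)%:R (2 ^ s.+1)%:R s (s0P _ ss); rewrite ltr_nat ltn_exp2l// lexx ltnSn.
  have := @ln_dyadic s (2 ^ s.+1) 0; rewrite addr0 leq_exp2l// leqnSn !lexx.
  move=> /(_ isT isT isT) -> /(_ isT isT isT) /le_trans; apply.
  rewrite ler_wpM2l// mulrCA ler_wpM2l ?powR_ge0//.
  rewrite expnS natrM mulr_natl mulr2n addrK powR_exp2n -expRD ler_expR; lra.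
Qed.

Lemma condC_block : condC lam r -> block_square_summable.
Proof.
move=> [beta [b12 [[M [N HM]] [M' [T0 H']]]]].
(* The bound on [r n] holds beyond an index [N], but blocks are ordered by frequency; monotonicity
   of [lam] turns [lam N < lam n] into [N <= n]. *)
have [s0 s0P] := exp2n_ge (Num.max T0 (lam N)).
apply: (@block_square_summable_crit1 (`|M| * `|M'|) beta 1 s0) => //.
move=> s j ss /andP[sj js].
have j0 : (0 : R) < j%:R by rewrite ltr0n (leq_trans _ sj)// expn_gt0.
have /andP[Tj Nj] : (T0 <= j%:R) && (lam N <= j%:R).
  by have := le_trans (s0P _ ss) (_ : _ <= j%:R); rewrite ler_nat ge_max => /(_ sj).
pose D := expR (- beta * ln 2 * s%:R).
apply: (@le_trans _ _ (wsum lam (fun n => `|M| * D * 1) j%:R (j%:R + 1))).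
  apply: ler_wsum => // n jn _.
  have Nn : (N <= n)%N.
    by rewrite leqNgt; apply/negP => /lam_incr /ltW /(lt_le_trans (le_lt_trans Nj jn)); rewrite ltxx.
  apply: le_trans (HM n Nn) _; rewrite mulr1 ger0_norm ?powR_ge0//.
  apply: le_trans (ler_wpM2r (powR_ge0 _ _) (ler_norm M)) _; rewrite ler_wpM2l//.
  rewrite powRN /D mulNr mulNr expRN -powR_exp2n lef_pV2 ?posrE ?powR_gt0 ?ltr0n ?expn_gt0//; last first.
    exact: lt_trans jn.
  apply: ge0_ler_powR; rewrite ?nnegrE; [lra|exact: ler0n| |].
    exact: ltW (lt_trans j0 jn).
  by rewrite (le_trans _ (ltW jn))// ler_nat.
rewrite wsumZ// powRr1// -/D -[leLHS]mulrA -[leRHS]mulrA ler_wpM2l// [leRHS]mulrA [leLHS]mulrC ler_wpM2r ?expR_ge0//.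
apply: le_trans (ler_norm _) _; apply: le_trans (H' _ Tj) _.
apply: le_trans (ler_wpM2r (normr_ge0 _) (ler_norm M')) _; rewrite ler_wpM2l//.
have := @ln_dyadic s j 0 sj (lexx _); rewrite addr0 ler_nat => /(_ (ltnW js))/andP[lj0 ljs].
by rewrite ger0_norm.
Qed.

(** By Cauchy-Schwarz a squared block is at most the number of its frequencies, of logarithmic size,
    times its sum of [|r n| ^ 2]; on the dyadic range [s] the latter is at most [2 ^ (- 2 s)] times
    the weighted sum, so the decay exponent is [2 - theta]. *)
Lemma condD_block : condD lam r -> block_square_summable.
Proof.
move=> [theta [t0 [t3 [[M [T0 H]] [M' [T0' H']]]]]].
have t2 : theta < 2.
  have : (1 : R) <= Num.sqrt 3 by rewrite -[leLHS]sqrtr1 ler_sqrt// ler1n.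
  by move: t3; lra.
have [s0 s0P] := exp2n_ge (Num.max T0 T0').
have /andP[l20 _] := ln2_itv.
(* The factor [expR (theta * ln 2)] is [2 ^ theta]: the weighted sum is evaluated at the right end
   [2 ^ s.+1] of the range. *)
apply: (@dyadic_log_bounded _ _ (`|M| * `|M'| * expR (theta * ln 2)) 1 ((2 - theta) * ln 2) s0) => //.
- by move=> j; exact: sqr_ge0.
- by rewrite mulr_gt0// subr_gt0.
move=> s ss; have := s0P _ ss; rewrite ge_max => /andP[Ts Ts'].
rewrite powRr1//.
pose q n := lam n ^+ 2 * b n ^+ 2.
have q0 n : 0 <= q n by rewrite mulr_ge0 ?sqr_ge0.
pose D : R := expR (- (2 * ln 2 * s%:R)).
have DE : D = ((2 ^ s)%:R ^+ 2)^-1.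
  by rewrite /D expRN -powR_mulrn// powR_exp2n.
apply: (@le_trans _ _ (\sum_(2 ^ s <= j < 2 ^ s.+1)
    `|M| * s.+1%:R * D * wsum lam q j%:R (j%:R + 1))).
  rewrite !big_nat; apply: ler_sum => j /andP[sj js].
  have j0 : (0 : R) < j%:R by rewrite ltr0n (leq_trans _ sj)// expn_gt0.
  apply: le_trans (wsum_sqr _ _ _ _) _ => //; first by move=> n; exact: cabs_ge0.
  rewrite -[leRHS]mulrA; apply: ler_pM.
  + exact: wsum_ge0.
  + by apply: wsum_ge0 => // n; exact: sqr_ge0.
  + have Tj : T0 <= j%:R by rewrite (le_trans Ts)// ler_nat.
    apply: le_trans (ler_norm _) _; apply: le_trans (H _ Tj) _.
    have := @ln_dyadic s j 0 sj (lexx _); rewrite addr0 ler_nat => /(_ (ltnW js))/andP[lj0 ljs].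
    by apply: le_trans (ler_wpM2r (normr_ge0 _) (ler_norm M)) _; rewrite ler_wpM2l// ger0_norm.
  + rewrite -wsumZ//; apply: ler_wsum => // n jn _; rewrite /q mulrA ler_peMl ?sqr_ge0//.
    rewrite DE -ler_pdivrMl ?invr_gt0 ?exprn_gt0 ?ltr0n ?expn_gt0// invrK mulr1.
    rewrite lerXn2r ?nnegrE//; first exact: ltW (lt_trans j0 jn).
    by rewrite (le_trans _ (ltW jn))// ler_nat.
rewrite -mulr_sumr wsum_blocks//; last by rewrite leq_exp2l.
have -> : `|M| * `|M'| * expR (theta * ln 2) * (s.+1%:R * expR (- ((2 - theta) * ln 2 * s%:R))) =
    `|M| * s.+1%:R * D * (`|M'| * (2 ^ s.+1)%:R `^ theta).
  rewrite powR_exp2n /D (_ : - ((2 - theta) * ln 2 * s%:R) = - (2 * ln 2 * s%:R) + theta * ln 2 * s%:R); last by ring.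
  rewrite (_ : theta * ln 2 * s.+1%:R = theta * ln 2 + theta * ln 2 * s%:R); last by rewrite -natr1; ring.
  by rewrite !expRD; ring.
rewrite ler_wpM2l ?mulr_ge0 ?expR_ge0//.
apply: le_trans (wsum_psum _ _ _ _) _ => //.
apply: le_trans (ler_norm _) _; apply: le_trans (H' _ _) _.
  by rewrite (le_trans Ts')// ler_nat leq_exp2l.
by rewrite ger0_norm ?powR_ge0// ler_wpM2r ?powR_ge0// ler_norm.
Qed.

Lemma conditions_block :
  condA lam r \/ condB lam r \/ condC lam r \/ condD lam r -> block_square_summable.
Proof.
by move=> [/condA_block|[/condB_block|[/condC_block|/condD_block]]].
Qed.

End BlockSums.

(** * Mean values on the half line *)

Section Means.
Context {R : realType}.
Notation mu := (@lebesgue_measure R).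
Implicit Types (g h : R -> R) (Y e m : R).

Definition bounded_measurable g :=
  measurable_fun [set: R] g /\ exists M : R, forall x, `|g x| <= M.

Definition avg g Y : R := Y^-1 * \int[mu]_(y in `[0, Y]) g y.

Definition has_mean g m := avg g Y @[Y --> +oo] --> m.

(** An eventual inequality between extended integrals: it serves squared errors, which are unbounded
    and not known in advance to be integrable. *)
Definition mean_le g e :=
  \forall Y \near +oo, (\int[mu]_(y in `[0%R, Y]) (g y)%:E <= (e * Y)%:E)%E.

Lemma lebesgue_itv0 Y : 0 <= Y -> mu `[0, Y] = Y%:E.
Proof.
move=> Y0; rewrite lebesgue_measure_itv/= lte_fin; case: ifPn => [_|].
  by rewrite -EFinB subr0.
by rewrite -leNgt => Y0'; congr (_%:E); apply/eqP; rewrite eq_le Y0 Y0'.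
Qed.

Lemma bounded_measurable_integrable g a b : bounded_measurable g ->
  mu.-integrable `[a, b] (EFin \o g).
Proof.
move=> [mg [M gM]]; apply: measurable_bounded_integrable => //.
- by apply: compact_finite_measure; exact: segment_compact.
- exact: measurable_funS mg.
- exists M; split; first exact: num_real.
  by move=> x Mx y _ /=; apply: le_trans (gM y) (ltW Mx).
Qed.

Lemma bounded_measurable_cst (a : R) : bounded_measurable (cst a).
Proof. by split => //; exists `|a|. Qed.

Lemma bounded_measurableD g h :
  bounded_measurable g -> bounded_measurable h ->
  bounded_measurable (fun y => g y + h y).
Proof.
move=> [mg [M gM]] [mh [N hN]]; split; first exact: measurable_funD.
by exists (M + N) => x; rewrite (le_trans (ler_normD _ _))// lerD.
Qed.

Lemma bounded_measurableM g h :
  bounded_measurable g -> bounded_measurable h ->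
  bounded_measurable (fun y => g y * h y).
Proof.
move=> [mg [M gM]] [mh [N hN]]; split; first exact: measurable_funM.
by exists (M * N) => x; rewrite normrM ler_pM.
Qed.

Lemma bounded_measurableZ (a : R) g :
  bounded_measurable g -> bounded_measurable (fun y => a * g y).
Proof. by move=> bg; apply: bounded_measurableM => //; exact: bounded_measurable_cst. Qed.

Lemma bounded_measurableB g h :
  bounded_measurable g -> bounded_measurable h ->
  bounded_measurable (fun y => g y - h y).
Proof.
move=> bg bh.
rewrite (_ : (fun _ => _) = (fun y => g y + -1 * h y)); last first.
  by apply/funext => y; rewrite mulN1r.
by apply: bounded_measurableD => //; exact: bounded_measurableZ.
Qed.

Lemma continuous_bounded_measurable g :
  continuous g -> (exists M : R, forall x, `|g x| <= M) -> bounded_measurable g.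
Proof. by move=> cg bg; split => //; exact: continuous_measurable_fun. Qed.

Lemma avg_cst (a : R) Y : 0 < Y -> avg (cst a) Y = a.
Proof.
move=> Y0; rewrite /avg Rintegral_cst///=; rewrite lebesgue_itv0 ?ltW//= mulrCA mulVf ?mulr1//.
by rewrite gt_eqF.
Qed.

Lemma avgD g h Y : bounded_measurable g -> bounded_measurable h ->
  avg (fun y => g y + h y) Y = avg g Y + avg h Y.
Proof.
move=> bg bh; rewrite /avg RintegralD ?mulrDr//; exact: bounded_measurable_integrable.
Qed.

Lemma avgZ (a : R) g Y : bounded_measurable g ->
  avg (fun y => a * g y) Y = a * avg g Y.
Proof.
move=> bg; rewrite /avg RintegralZl//; first by rewrite mulrCA.
exact: bounded_measurable_integrable.
Qed.

Lemma le_avg g h Y : bounded_measurable g -> bounded_measurable h -> 0 <= Y ->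
  (forall y, 0 <= y -> g y <= h y) -> avg g Y <= avg h Y.
Proof.
move=> bg bh Y0 gh; rewrite /avg ler_wpM2l ?invr_ge0//.
apply: le_Rintegral => //; [exact: bounded_measurable_integrable..|].
by move=> y /=; rewrite in_itv/= => /andP[y0 _]; exact: gh.
Qed.

Lemma avg_bound g M Y : bounded_measurable g -> 0 < Y ->
  (forall y, 0 <= y -> `|g y| <= M) -> `|avg g Y| <= M.
Proof.
move=> bg Y0 gM; have bc a := bounded_measurable_cst a.
have gM' y : 0 <= y -> - M <= g y <= M by move=> /gM; rewrite ler_norml.
rewrite ler_norml; apply/andP; split.
  rewrite -(avg_cst (- M) Y0); apply: le_avg (ltW Y0) _ => // y /gM'.
  by case/andP.
rewrite -[leRHS](avg_cst M Y0); apply: le_avg (ltW Y0) _ => // y /gM'.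
by case/andP.
Qed.

Lemma has_mean_cst (a : R) : has_mean (cst a) a.
Proof.
apply: cvg_near_cst; near=> Y; by rewrite avg_cst.
Unshelve. all: by end_near. Qed.

Lemma has_meanD g h m m' : bounded_measurable g -> bounded_measurable h ->
  has_mean g m -> has_mean h m' -> has_mean (fun y => g y + h y) (m + m').
Proof.
move=> bg bh mg mh; rewrite /has_mean.
by under eq_fun do rewrite avgD//; exact: cvgD.
Qed.

Lemma has_meanZ (a : R) g m : bounded_measurable g ->
  has_mean g m -> has_mean (fun y => a * g y) (a * m).
Proof.
move=> bg mg; rewrite /has_mean.
by under eq_fun do rewrite avgZ//; apply: cvgMl_tmp.
Qed.

Lemma has_mean_unique g m m' : has_mean g m -> has_mean g m' -> m = m'.
Proof. by move=> /cvg_lim h1 /cvg_lim h2; rewrite -h1// -h2. Qed.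

Lemma has_mean_dist g h m m' e : has_mean g m -> has_mean h m' ->
  (\forall Y \near +oo, `|avg g Y - avg h Y| <= e) -> `|m - m'| <= e.
Proof.
move=> mg mh H; have H2 : (fun Y => `|avg g Y - avg h Y|) Y @[Y --> +oo] --> `|m - m'|.
  by apply: cvg_norm; exact: cvgB.
rewrite -(cvg_lim _ H2)//; apply: limr_le; [exact: (cvgP _ H2)|exact: H].
Qed.

Lemma has_mean_near g h e : bounded_measurable g -> bounded_measurable h ->
  forall D, measurable_fun [set: R] D -> mean_le D e ->
  (forall y, 0 <= y -> `|g y - h y| <= D y) ->
  \forall Y \near +oo, `|avg g Y - avg h Y| <= e.
Proof.
move=> bg bh D mD De ghD; have bgh := bounded_measurableB bg bh.
near=> Y; have Y0 : 0 < Y by [].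
have -> : avg g Y - avg h Y = avg (fun y => g y - h y) Y.
  by rewrite /avg RintegralB ?mulrBr//; exact: bounded_measurable_integrable.
rewrite /avg normrM ger0_norm ?invr_ge0 ?(ltW Y0)// ler_pdivrMl// mulrC.
rewrite -lee_fin EFin_normr_Rintegral//; last exact: bounded_measurable_integrable.
have mgh : measurable_fun `[0, Y] (fun y => g y - h y).
  by apply: measurable_funS bgh.1.
apply: le_trans (le_abse_integral _ _ _) _ => //; first exact/measurable_EFinP.
have HDY : (\int[mu]_(y in `[0%R, Y]) (D y)%:E <= (e * Y)%:E)%E by near: Y.
apply: le_trans HDY.
apply: ge0_le_integral => //.
- by apply: measurableT_comp => //; exact/measurable_EFinP.
- by apply/measurable_EFinP; exact: measurable_funS mD.
- by move=> y /=; rewrite in_itv/= => /andP[y0 _]; rewrite lee_fin ghD.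
Unshelve. all: by end_near. Qed.

(** The candidate [m] may change with the tolerance; completeness of the reals supplies the
    limit. *)
Lemma cvg_pinfty_approx (f : R -> R) :
  (forall e, 0 < e -> exists m, \forall Y \near +oo, `|m - f Y| <= e) ->
  exists m, f Y @[Y --> +oo] --> m.
Proof.
move=> H; apply/cvg_ex; apply: cauchy_cvg; apply: cauchy_exP => e e0.
have [m Hm] := H (e / 2) (divr_gt0 e0 (ltr0Sn R 1)).
exists m; near=> Y; rewrite /ball/=.
apply: (@le_lt_trans _ _ (e / 2)); first by near: Y.
by rewrite gtr_pMr// invf_lt1// ltr1n.
Unshelve. all: by end_near. Qed.

Lemma has_mean_approx g :
  (forall e, 0 < e -> exists h m, has_mean h m /\
     \forall Y \near +oo, `|avg g Y - avg h Y| <= e) ->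
  exists m, has_mean g m.
Proof.
move=> H; apply: cvg_pinfty_approx => e e0.
have e20 : 0 < e / 2 by rewrite divr_gt0.
have [h [m [/cvgrPdist_le/(_ _ e20) hm gh]]] := H _ e20.
exists m; near=> Y.
rewrite -(subrK (avg h Y) m) -addrA (le_trans (ler_normD _ _))//.
rewrite (splitr e) lerD//; first by near: Y.
by rewrite distrC; near: Y.
Unshelve. all: by end_near. Qed.

End Means.

(** * Almost periodic functions have mean values *)

Section AlmostPeriodicMeans.
Context {R : realType}.
Notation mu := (@lebesgue_measure R).
Implicit Types (u F f : R -> R) (e : R).

Lemma Rintegral_FTC2 f F (a b : R) : a < b -> continuous f ->
  (forall x : R, a <= x -> is_derive x 1 F (f x)) ->
  \int[mu]_(y in `[a, b]) f y = F b - F a.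
Proof.
move=> ab cf dF.
have cF (x : R) : a <= x -> {for x, continuous F}.
  move=> ax; apply: differentiable_continuous; apply/derivable1_diffP.
  by have [] := dF _ ax.
rewrite /Rintegral (@continuous_FTC2 _ f F)//.
- exact: continuous_subspaceT.
- split.
  + by move=> x; rewrite in_itv/= => /andP[/ltW /dF[]].
  + exact/cvg_at_right_filter/cF.
  + exact/cvg_at_left_filter/cF/ltW.
- by move=> x; rewrite in_itv/= => /andP[/ltW /dF[_ <-] _]; rewrite derive1E.
Qed.

Lemma antiderivative u : continuous u -> exists F : R -> R,
  forall x : R, 0 <= x -> is_derive x 1 F (u x).
Proof.
(* Integrating from -1 makes 0 an interior point, so [F] has a two-sided derivative there as
   well. *)
move=> cu; exists (fun x => \int[mu]_(y in `[-1, x]) u y) => x x0.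
have [] := @continuous_FTC1_closed _ u (-1) x (x + 1).
- by rewrite ltrDl.
- apply: continuous_compact_integrable; first exact: segment_compact.
  exact: continuous_subspaceT.
- by rewrite (lt_le_trans _ x0)// oppr_lt0.
- exact: cu.
by move=> dF Fu; apply: DeriveDef => //; rewrite -derive1E.
Qed.

Lemma increment_bound F f a b M : 0 <= a -> a <= b ->
  (forall x : R, 0 <= x -> is_derive x 1 F (f x)) ->
  (forall x : R, 0 <= x -> `|f x| <= M) -> `|F b - F a| <= M * (b - a).
Proof.
move=> a0 ab dF fM.
have [||c cab ->] := @MVT_segment _ F f a b ab.
- move=> x; rewrite in_itv/= => /andP[ax _]; apply: dF.
  exact: le_trans (ltW ax).
- apply: derivable_within_continuous => x; rewrite in_itv/= => /andP[ax _].
  by have [] := dF x (le_trans a0 ax).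
rewrite normrM (ger0_norm (_ : 0 <= b - a)) ?subr_ge0// ler_wpM2r ?subr_ge0//.
by apply: fM; move: cab; rewrite in_itv/= => /andP[/(le_trans a0)].
Qed.

Lemma avg_antiderivative u F Y : continuous u ->
  (forall x : R, 0 <= x -> is_derive x 1 F (u x)) -> 0 < Y ->
  avg u Y = (F Y - F 0) / Y.
Proof.
by move=> cu dF Y0; rewrite /avg mulrC (Rintegral_FTC2 Y0 cu dF).
Qed.

(* Bochner's form of almost periodicity: the translates of [u] are totally
   bounded for the sup norm, witnessed by a finite colouring of the shifts. *)
Definition translation_totally_bounded u := forall e, 0 < e ->
  exists (C : finType) (chi : R -> C), forall t s : R, 0 <= t -> 0 <= s ->
    chi t = chi s -> forall y, 0 <= y -> `|u (y + t) - u (y + s)| <= e.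

(** All windows of a large length [L] have nearly the same integral. The window at [t] is compared
    with the one at a representative of the colour of [t], where the translates are uniformly close;
    the windows at that representative and at 0 differ by two end pieces of bounded length. Tiling
    [[0, Y]] by windows gives the mean. *)
Lemma translation_totally_bounded_mean u : continuous u ->
  (exists M, forall x, `|u x| <= M) -> translation_totally_bounded u ->
  exists m, has_mean u m.
Proof.
move=> cu [M uM] tu; apply: cvg_pinfty_approx => e e0.
have M0 : 0 <= M by apply: le_trans (uM 0).
have e4 : 0 < e / 4 by rewrite divr_gt0.
have [C [chi chiP]] := tu _ e4.
have [F dF] := antiderivative cu.
(* Colours taken by no nonnegative shift get the representative 0, for which the implication is
   vacuous. *)
have /choice[rep repP] : forall i : C, exists s : R, 0 <= s /\
    forall t : R, 0 <= t -> chi t = i -> chi s = i.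
  move=> i; have [[t [t0 ti]]|H] := pselect (exists t : R, 0 <= t /\ chi t = i).
    by exists t.
  by exists 0; split => // t t0 ti; exfalso; apply: H; exists t.
pose T := \sum_(i : C) rep i.
have T0 : 0 <= T by apply: sumr_ge0 => i _; have [] := repP i.
have repT i : rep i <= T.
  rewrite /T (bigD1 i)//= lerDl sumr_ge0// => j _; by have [] := repP j.
(* Long enough that two end pieces of length at most [T], costing [2 * M * T], amount to at most
   [e / 4 * L]. *)
pose L := 1 + 2 * M * T / (e / 4).
have L0 : 0 < L by rewrite ltr_wpDr// !mulr_ge0 ?invr_ge0// ltW.
have LT : 2 * M * T <= e / 4 * L.
  by rewrite /L mulrDr mulr1 mulrCA divff ?gt_eqF// mulr1 lerDr ltW.
pose J t := F (t + L) - F t.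
have J0 t : 0 <= t -> `|J t - J 0| <= e / 2 * L.
  move=> t0; pose s := rep (chi t).
  have [s0 /(_ t t0 erefl) chis] := repP (chi t).
  rewrite -(subrK (J s) (J t)) -addrA (le_trans (ler_normD _ _))//.
  rewrite (_ : e / 2 * L = e / 4 * L + e / 4 * L); last by field.
  apply: lerD.
    have := @increment_bound (fun x => F (x + t) - F (x + s))
      (fun x => u (x + t) - u (x + s)) 0 L (e / 4) (lexx _) (ltW L0).
    rewrite subr0 !add0r => H.
    rewrite (_ : J t - J s = F (L + t) - F (L + s) - (F t - F s)); last first.
      by rewrite /J (addrC t) (addrC s); ring.
    apply: H => x x0; last exact: chiP.
    have dS (w : R) : 0 <= w -> is_derive x 1 (F \o shift w) (u (x + w)).
      move=> w0; rewrite -[u _]mulr1; apply: is_derive1_comp; last exact: is_derive_shift.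
      by apply: dF; rewrite /= addr_ge0.
    exact: (is_deriveB (dS t t0) (dS s s0)).
  rewrite (_ : J s - J 0 = F (L + s) - F L - (F s - F 0)); last first.
    by rewrite /J (addrC s) add0r; ring.
  rewrite (le_trans (ler_normB _ _))//.
  apply: (@le_trans _ _ (M * s + M * s)).
    apply: lerD.
      rewrite (_ : M * s = M * (L + s - L)); last by ring.
      by apply: (increment_bound (ltW L0) _ dF) => //; rewrite lerDl.
    by rewrite -{2}(subr0 s); exact: (increment_bound (lexx _) s0 dF).
  apply: le_trans LT; rewrite (_ : _ + _ = 2 * M * s); last by ring.
  by rewrite ler_wpM2l ?mulr_ge0// repT.
have JB t : 0 <= t -> `|J t| <= M * L.
  move=> t0; rewrite (_ : M * L = M * (t + L - t)); last by ring.
  by apply: (increment_bound t0 _ dF) => //; rewrite lerDl ltW.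
have FkL k : `|F (k%:R * L) - F 0 - k%:R * J 0| <= k%:R * (e / 2 * L).
  elim: k => [|k IH]; first by rewrite !mul0r !subrr normr0.
  rewrite (_ : F _ - _ - _ = (F (k%:R * L) - F 0 - k%:R * J 0) + (J (k%:R * L) - J 0)).
    rewrite -natr1 mulrDl mul1r (le_trans (ler_normD _ _))// lerD// J0//.
    by rewrite mulr_ge0// ltW.
  by rewrite -natr1 mulrDl mul1r /J; ring.
exists (J 0 / L); near=> Y.
have Y0 : 0 < Y by near: Y; exact: nbhs_pinfty_gt.
rewrite (avg_antiderivative cu dF Y0).
pose k := Num.truncn (Y / L).
have /andP[kY Yk] : k%:R <= Y / L < k.+1%:R.
  by apply: truncn_itv; rewrite divr_ge0// ltW.
have kLY : k%:R * L <= Y by rewrite -ler_pdivlMr.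
have YkL : Y - k%:R * L <= L.
  by rewrite lerBlDl -{2}(mul1r L) -mulrDl natr1 -ler_pdivrMr// ltW.
have kL0 : 0 <= k%:R * L by rewrite mulr_ge0// ltW.
have nY a : `|a| * Y = `|a * Y| by rewrite normrM (gtr0_norm Y0).
rewrite -(ler_pM2r Y0) nY.
rewrite (_ : _ * Y = - (F Y - F (k%:R * L)) - (F (k%:R * L) - F 0 - k%:R * J 0) +
   (Y - k%:R * L) * (J 0 / L)); last by field; rewrite !gt_eqF.
rewrite (le_trans (ler_normD _ _))//.
(* The two terms [M * L] account for the incomplete last window: the true integral over it, and the
   share that the proposed mean assigns to it. *)
apply: (@le_trans _ _ (M * L + e / 2 * Y + M * L)).
  apply: lerD.
    rewrite (le_trans (ler_normB _ _))// normrN lerD//.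
      apply: le_trans (increment_bound kL0 kLY dF (fun x _ => uM x)) _.
      by rewrite ler_wpM2l.
    apply: (le_trans (FkL k)).
    by rewrite mulrCA ler_wpM2l// divr_ge0// ltW.
  rewrite normrM mulrC ler_pM//.
    rewrite normrM normfV (gtr0_norm L0) ler_pdivrMr//; exact: JB.
  by rewrite ger0_norm// subr_ge0.
rewrite (_ : e * Y = e / 2 * Y + e / 2 * Y); last by field.
rewrite addrAC lerD2r.
have : 4 * M * L / e <= Y by [].
rewrite ler_pdivrMr//; lra.
Unshelve. all: by end_near. Qed.

Lemma continuous_cos_affine (w s : R) : continuous (fun y : R => cos (w * y + s)).
Proof.
move=> y; apply: (@continuous_comp _ _ _ (fun y => w * y + s) (@cos R)).
  by apply: cvgD; [apply: cvgMl_tmp; exact: cvg_id|exact: cvg_cst].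
exact: continuous_cos.
Qed.

Lemma bounded_measurable_cos (w s : R) :
  bounded_measurable (fun y => cos (w * y + s)).
Proof.
apply: continuous_bounded_measurable; first exact: continuous_cos_affine.
by exists 1 => x; exact: cos_max.
Qed.

Lemma Rintegral_cos (w s Y : R) : w != 0 -> 0 < Y ->
  \int[mu]_(y in `[0, Y]) cos (w * y + s) = (sin (w * Y + s) - sin s) / w.
Proof.
move=> w0 Y0.
have dF (x : R) : 0 <= x -> is_derive x 1 (fun y => w^-1 * sin (w * y + s)) (cos (w * x + s)).
  move=> _; have dw : is_derive x 1 (shift s \o (w \*: id)) (1 * (w *: 1)).
    by apply: is_derive1_comp; exact: is_derive_shift.
  have := is_deriveZ w^-1 (is_derive1_comp (is_derive_sin _) dw).
  by rewrite mul1r scaler1 /GRing.scale/= mulrCA mulVf ?mulr1.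
rewrite (Rintegral_FTC2 Y0 (@continuous_cos_affine w s) dF).
by rewrite mulr0 add0r; field.
Qed.

Lemma has_mean_cos (w s : R) : w != 0 -> has_mean (fun y => cos (w * y + s)) 0.
Proof.
move=> w0; apply/cvgrPdist_le => e e0; near=> Y.
have Y0 : 0 < Y by [].
rewrite sub0r normrN /avg Rintegral_cos// mulrC normrM normfV (gtr0_norm Y0).
rewrite ler_pdivrMr// normrM normfV ler_pdivrMr ?normr_gt0//.
apply: (@le_trans _ _ 2).
  by rewrite (le_trans (ler_normB _ _))// (natrD _ 1 1) lerD// sin_max.
have : 2 / (e * `|w|) <= Y by [].
by rewrite ler_pdivrMr ?mulr_gt0 ?normr_gt0// mulrA (mulrC Y).
Unshelve. all: by end_near. Qed.

End AlmostPeriodicMeans.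

(** * Uniform continuity and measurability for row vectors *)

Section RowVectors.
Context {R : realType} {l : nat}.
Implicit Types (f : 'rV[R]_l -> R) (e : R) (u v : 'rV[R]_l).

Lemma row_norm_le v e : 0 <= e -> (`|v| <= e) = [forall k, `|v ord0 k| <= e].
Proof.
move=> e0; rewrite [X in X <= _]/Num.norm/= mx_normrE.
apply/idP/forallP => [H k|H].
  by apply: le_trans H; apply: le_bigmax (ord0, k).
apply/bigmax_leP; split => // -[i k] _ /=; rewrite (ord1 i); exact: H.
Qed.

(** Only [u] is confined to the ball. In the applications one of the two points compared is under
    control, and the other is merely close to it. *)
Lemma continuous_unif_on_ball f : continuous f -> forall B e, 0 < e ->
  exists2 d : R, 0 < d <= 1 & forall u v, `|u| <= B -> `|u - v| <= d -> `|f u - f v| <= e.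
Proof.
move=> cf B e e0.
have cK : compact [set u : 'rV[R]_l | `|u| <= B].
  apply: bounded_closed_compact.
    by exists B; split; [exact: num_real|move=> x /ltW Bx u /= uB; exact: le_trans Bx].
  apply: (@closed_comp _ _ (fun u : 'rV[R]_l => `|u|) [set x | x <= B]).
    by move=> x _; exact: norm_continuous.
  exact: closed_le.
have H : \forall d \near 0^'+, [set u : 'rV[R]_l | `|u| <= B] `<=`
     (fun u => forall v, `|u - v| <= d -> `|f u - f v| <= e).
  apply: ((iffLR (compact_near_coveringP _) cK) R (0^'+) (fun d u => forall v, `|u - v| <= d -> `|f u - f v| <= e)) => u _.
  have e20 : 0 < e / 2 by rewrite divr_gt0.
  have /cvgrPdist_le/(_ _ e20) := cf u.
  rewrite -nbhs_nbhs_norm => -[r/= r0 ur].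
  near=> w d => v /= wv.
  have wr : `|u - w| < r / 2.
    near: w; rewrite -nbhs_nbhs_norm; exists (r / 2) => //=.
    by rewrite divr_gt0.
  have dr : d < r / 2.
    by near: d; apply: nbhs_right_lt; rewrite divr_gt0.
  rewrite -(subrK (f u) (f w)) -addrA (le_trans (ler_normD _ _))//.
  rewrite (splitr e) lerD//.
    by rewrite distrC; apply: ur => /=; rewrite (lt_le_trans wr)// ler_pdivrMr// ler_pMr// ler1n.
  apply: ur => /=; rewrite -(subrK w u) -addrA (le_lt_trans (ler_normD _ _))//.
  by rewrite (splitr r) ltr_leD//; exact: le_trans wv (ltW dr).
near (0 : R)^'+ => d; exists d.
  by apply/andP; split => //; near: d; exact: nbhs_right_le.
by move=> u v uB uv; have := near H d _ u uB v uv; apply.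
Unshelve. all: by end_near. Qed.

Lemma continuous_row (p : 'I_l -> R -> R) : (forall k, continuous (p k)) ->
  continuous (fun y => \row_k p k y : 'rV[R]_l).
Proof.
move=> cp y; apply/cvgrPdist_le => e e0.
have H : \forall z \near y, forall k, `|p k y - p k z| <= e.
  apply: (@filter_forall _ _ (fun k => [set z | `|p k y - p k z| <= e]) (nbhs y)) => k.
  by move/cvgrPdist_le : (cp k y); exact.
near=> z; have hz : forall k, `|p k y - p k z| <= e by near: z.
by rewrite row_norm_le ?(ltW e0)//; apply/forallP => k; rewrite !mxE.
Unshelve. all: by end_near. Qed.

(** The norm is the sup norm, so a closed ball is a product of intervals and its preimage is a
    finite intersection of measurable sets. An open set is the union of the countably many balls
    [(c q, 1 / (n + 1))] with rational centre that it contains; balls that do not fit contribute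
    [set0]. *)
Lemma measurable_comp_row (phi : 'I_l -> R -> R) f :
  (forall k, measurable_fun [set: R] (phi k)) -> continuous f ->
  measurable_fun [set: R] (fun y => f (\row_k phi k y)).
Proof.
move=> mphi cf; apply: (measurability _ (RGenOpens.measurableE R)).
move=> _ [_ [a [b ->] <-]]; rewrite setTI.
set U := f @^-1` `]a, b[.
have oU : open U by apply: open_comp; [move=> x _; exact: cf|exact: interval_open].
pose c (q : {ffun 'I_l -> rat}) : 'rV[R]_l := \row_k ratr (q k).
pose D (p : {ffun 'I_l -> rat} * nat) : set R :=
  if `[< forall v, `|c p.1 - v| <= p.2.+1%:R^-1 -> U v >] then
    \bigcap_(k : 'I_l) [set y | `|ratr (p.1 k) - phi k y| <= p.2.+1%:R^-1]
  else set0.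
have mD p : measurable (D p).
  rewrite /D; case: ifPn => // _; apply: fin_bigcap_measurable => //= k _.
  rewrite (_ : [set _ | _] = phi k @^-1` `[ratr (p.1 k) - p.2.+1%:R^-1, ratr (p.1 k) + p.2.+1%:R^-1]).
    by rewrite -[X in measurable X]setTI; exact: mphi.
  by apply/seteqP; split => y /=; rewrite in_itv/= distrC ler_distl.
rewrite (_ : _ @^-1` _ = \bigcup_p D p); last first.
  apply/seteqP; split => [y /= Uy|y [p _]]; last first.
    rewrite /D; case: ifPn => // /asboolP pU Dy; apply: pU.
    rewrite row_norm_le//; apply/forallP => k; rewrite !mxE; exact: Dy.
  have /nbhs_normP[r/= r0 rU] : nbhs (\row_k phi k y) U by exact: open_nbhs_nbhs.
  have [n nr] : exists n : nat, n.+1%:R^-1 < r / 2.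
    exists (Num.truncn (r / 2)^-1); rewrite invf_plt ?posrE ?divr_gt0//.
    exact: truncnS_gt.
  have /choice[q qP] : forall k, exists q : rat, `|ratr q - phi k y| <= n.+1%:R^-1.
    move=> k; have : phi k y - n.+1%:R^-1 < phi k y + n.+1%:R^-1.
      by rewrite ltrD2l gt0_cp// invr_gt0.
    move=> /rat_in_itvoo[q]; rewrite in_itv/= => /andP[/ltW q1 /ltW q2].
    by exists q; rewrite ler_distl q1.
  exists ([ffun k => q k], n) => //; rewrite /D.
  have cy : `|c [ffun k => q k] - \row_k phi k y| <= n.+1%:R^-1.
    by rewrite row_norm_le//; apply/forallP => k; rewrite !mxE ffunE.
  case: asboolP => /= [_ k _ /=|[]].
    by rewrite ffunE.
  move=> v cv; apply: rU => /=.
  rewrite -(subrK (c [ffun k => q k]) (\row_k phi k y)) -addrA (le_lt_trans (ler_normD _ _))//.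
  by rewrite (splitr r) ltrD// ?(le_lt_trans cv)// distrC (le_lt_trans cy).
apply: countable_bigcupT_measurable => //; exact: countableP.
Qed.

End RowVectors.

(** * Closure properties of almost periodicity *)

Section TranslationTotallyBounded.
Context {R : realType}.
Implicit Types (u v : R -> R) (e : R).

Lemma ttbD u v : translation_totally_bounded u -> translation_totally_bounded v ->
  translation_totally_bounded (fun y => u y + v y).
Proof.
move=> tu tv e e0; have e20 : 0 < e / 2 by rewrite divr_gt0.
have [C [chi chiP]] := tu _ e20; have [C' [chi' chiP']] := tv _ e20.
exists (C * C')%type, (fun t => (chi t, chi' t)) => t s t0 s0 [h h'] y y0.
rewrite opprD addrACA (le_trans (ler_normD _ _))// (splitr e) lerD//.
  exact: chiP.
exact: chiP'.
Qed.

Lemma ttbZ (a : R) u : translation_totally_bounded u ->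
  translation_totally_bounded (fun y => a * u y).
Proof.
move=> tu e e0; have a0 : 0 < `|a| + 1 by rewrite ltr_wpDl.
have [C [chi chiP]] := tu _ (divr_gt0 e0 a0).
exists C, chi => t s t0 s0 ts y y0.
rewrite -mulrBr normrM -[leRHS](divfK (lt0r_neq0 a0)) mulrC ler_pM// ?lerDl//.
exact: chiP.
Qed.

Lemma ttb_cst (a : R) : translation_totally_bounded (cst a).
Proof.
by move=> e e0; exists unit, (fun=> tt) => t s *; rewrite subrr normr0 ltW.
Qed.

Lemma ttb_sum (I : Type) (r : seq I) (P : pred I) (u : I -> R -> R) :
  (forall i, translation_totally_bounded (u i)) ->
  translation_totally_bounded (fun y => \sum_(i <- r | P i) u i y).
Proof.
move=> tu; elim: r => [|i r IH].
  rewrite (_ : (fun _ => _) = cst 0); last by apply/funext => y; rewrite big_nil.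
  exact: ttb_cst.
rewrite (_ : (fun _ => _) = fun y => (P i)%:R * u i y + \sum_(j <- r | P j) u j y).
  by apply: ttbD IH; exact: ttbZ.
by apply/funext => y; rewrite big_cons; case: ifP => _; rewrite ?mul1r// mul0r add0r.
Qed.

(* Colour a shift [t] by the integer parts of [(cos (w t) + 1) / e] and
   [(sin (w t) + 1) / e]; the addition formula does the rest. *)
Lemma ttb_cos (w s : R) : translation_totally_bounded (fun y => cos (w * y + s)).
Proof.
move=> e e0; have [d d0 ed] : exists2 d, 0 < d & e = d + d.
  by exists (e / 2); [rewrite divr_gt0|exact: splitr].
pose N := Num.truncn (2 / d).
pose k (x : R) := @inord N (Num.truncn ((x + 1) / d)).
have kP (x x' : R) : `|x| <= 1 -> `|x'| <= 1 -> k x = k x' -> `|x - x'| <= d.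
  have trN (z : R) : `|z| <= 1 -> 0 <= (z + 1) / d /\ (Num.truncn ((z + 1) / d) < N.+1)%N.
    rewrite ler_norml => /andP[z1 z2]; split.
      by rewrite divr_ge0 ?(ltW d0)// -lerBlDr sub0r.
    rewrite ltnS; apply: le_truncn; rewrite ler_pM2r ?invr_gt0//.
    by rewrite (natrD _ 1 1) lerD2r.
  move=> /trN[x0 xN] /trN[x0' xN'] /(congr1 val)/=; rewrite !inordK// => kk.
  have := truncn_itv x0; have := truncn_itv x0'; rewrite kk.
  set n := Num.truncn _; rewrite !ler_pdivlMr// !ltr_pdivrMr// -natr1 (mulrDl _ 1 d) mul1r.
  move=> /andP[h1 h2] /andP[h3 h4].
  by rewrite ler_norml; apply/andP; split; lra.
exists ('I_N.+1 * 'I_N.+1)%type, (fun t => (k (cos (w * t)), k (sin (w * t)))).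
move=> t t' _ _ [/kP hc /kP hs] y _.
have E z : cos (w * (y + z) + s) = cos (w * y + s) * cos (w * z) - sin (w * y + s) * sin (w * z).
  by rewrite mulrDr addrAC cosD.
rewrite !E (_ : _ - _ = cos (w * y + s) * (cos (w * t) - cos (w * t')) -
  sin (w * y + s) * (sin (w * t) - sin (w * t'))); last by ring.
rewrite (le_trans (ler_normB _ _))// ed !normrM.
apply: lerD; rewrite -[leRHS]mul1r ler_pM// ?cos_max ?sin_max//.
- by apply: hc; exact: cos_max.
- by apply: hs; exact: sin_max.
Qed.

Lemma ttb_comp_row l (p : 'I_l -> R -> R) (f : 'rV[R]_l -> R) :
  (forall k, translation_totally_bounded (p k)) ->
  (exists B, forall k y, `|p k y| <= B) -> continuous f ->
  translation_totally_bounded (fun y => f (\row_k p k y)).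
Proof.
move=> tp [B pB] cf e e0.
(* For [l = 0] the bound [B] holds vacuously and may be negative, hence the absolute value. *)
have [d /andP[d0 _] dP] := continuous_unif_on_ball cf `|B| e0.
have /choice[c cP] : forall k, exists c : {C : finType & R -> C},
    forall t s : R, 0 <= t -> 0 <= s -> projT2 c t = projT2 c s ->
    forall y, 0 <= y -> `|p k (y + t) - p k (y + s)| <= d.
  by move=> k; have [C [chi chiP]] := tp k _ d0; exists (existT _ C chi).
exists {dffun forall k : 'I_l, projT1 (c k)}, (fun t => [ffun k => projT2 (c k) t]).
move=> t s t0 s0 ts y y0; apply: dP.
  by rewrite row_norm_le//; apply/forallP => k; rewrite mxE (le_trans (pB _ _))// ler_norm.
rewrite row_norm_le ?(ltW d0)//; apply/forallP => k; rewrite !mxE; apply: cP => //.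
by move/ffunP : ts => /(_ k); rewrite !ffunE.
Qed.

End TranslationTotallyBounded.

(** * Mean values of products of independent tones *)

Section Factorization.
Context {R : realType}.
Notation mu := (@lebesgue_measure R).
Implicit Types (g h : R -> R) (e : R).

Lemma has_mean_limit g m :
  (forall e, 0 < e -> exists h m', [/\ has_mean h m', `|m - m'| <= e &
     \forall Y \near +oo, `|avg g Y - avg h Y| <= e]) ->
  has_mean g m.
Proof.
move=> H; apply/cvgrPdist_le => e e0.
have e30 : 0 < e / 3 by rewrite divr_gt0.
have [h [m' [/cvgrPdist_le/(_ _ e30) hm mm gh]]] := H _ e30.
near=> Y.
have h1 : `|m' - avg h Y| <= e / 3 by near: Y.
have h2 : `|avg g Y - avg h Y| <= e / 3 by near: Y.
rewrite (_ : m - avg g Y = (m - m') + (m' - avg h Y) - (avg g Y - avg h Y)); last by ring.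
rewrite (le_trans (ler_normB _ _))// (_ : e = e / 3 + e / 3 + e / 3); last by field.
by rewrite lerD// (le_trans (ler_normD _ _))// lerD.
Unshelve. all: by end_near. Qed.

Lemma eq_has_mean g h m : g =1 h -> has_mean g m -> has_mean h m.
Proof. by move=> /funext ->. Qed.

(** The period is rescaled to [[0, 1]] so that the two parts of [J0] are period means by
    definition. *)
Definition period_mean g := \int[mu]_(t in `[0, 1]) g (2 * pi * t).

(* [h] need not be periodic: it is only required to be uncorrelated, in mean, with
   every harmonic of the frequency [w]. *)
Definition factors_means g := forall (w th : R) h m,
  bounded_measurable h -> has_mean h m ->
  (forall (n : nat) (s : R), (0 < n)%N ->
     has_mean (fun y => h y * cos (n%:R * w * y + s)) 0) ->
  has_mean (fun y => h y * g (w * y + th)) (m * period_mean g).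

(** The phase [s] makes sines available, and [n = 0] the constants. *)
Inductive trig_poly : (R -> R) -> Prop :=
| trig_poly_cos (n : nat) (s : R) : trig_poly (fun u => cos (n%:R * u + s))
| trig_polyD g h : trig_poly g -> trig_poly h -> trig_poly (fun u => g u + h u)
| trig_polyZ (a : R) g : trig_poly g -> trig_poly (fun u => a * g u).

Lemma trig_poly_bounded_measurable g : trig_poly g ->
  bounded_measurable g.
Proof.
elim=> [n s|g' h _ ? _ ?|a g' _ ?].
- exact: bounded_measurable_cos.
- exact: bounded_measurableD.
- exact: bounded_measurableZ.
Qed.

Lemma bounded_measurable_affine g (w s : R) : bounded_measurable g ->
  bounded_measurable (fun y => g (w * y + s)).
Proof.
move=> [mg [M gM]]; split; last by exists M.
apply: (measurableT_comp mg); apply: measurable_funD => //.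
Qed.

Lemma Rintegral_cst01 (a : R) : \int[mu]_(t in `[0, 1]) a = a.
Proof. by have := avg_cst a ltr01; rewrite /avg invr1 mul1r. Qed.

Lemma integrable_period g : bounded_measurable g ->
  mu.-integrable `[0, 1] (EFin \o (fun t => g (2 * pi * t))).
Proof.
move=> bg; apply: bounded_measurable_integrable.
rewrite (_ : (fun _ => _) = fun t => g (2 * pi * t + 0)).
  exact: bounded_measurable_affine.
by apply/funext => t; rewrite addr0.
Qed.

Lemma cos_nat_period (n : nat) (x : R) : cos (x + n%:R * (2 * pi)) = cos x /\
  sin (x + n%:R * (2 * pi)) = sin x.
Proof.
elim: n => [|n [IHc IHs]]; first by rewrite mul0r addr0.
rewrite -natr1 mulrDl mul1r addrA (mulr_natl pi 2).
by rewrite cosD2pi sinD2pi -(mulr_natl pi 2).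
Qed.

Lemma period_mean_cos (n : nat) (s : R) : (0 < n)%N ->
  period_mean (fun u => cos (n%:R * u + s)) = 0.
Proof.
move=> n0; rewrite /period_mean.
under eq_Rintegral do rewrite mulrA.
rewrite Rintegral_cos ?ltr01//; last first.
  by rewrite mulf_neq0 ?pnatr_eq0 -?lt0n// mulf_neq0// gt_eqF// pi_gt0.
by rewrite mulr1 (addrC _ s) (cos_nat_period n s).2 subrr mul0r.
Qed.

(** By linearity a single harmonic suffices: for [n > 0] both sides vanish, the left one by the
    assumption on [h]; for [n = 0] the harmonic is a constant. *)
Lemma trig_poly_factors_means g : trig_poly g -> factors_means g.
Proof.
elim=> {g} [n s|g g' tg IHg tg' IHg'|a g tg IHg] w th h m bh hm h0.
- case: (posnP n) => [->|n0].
    have -> : period_mean (fun u => cos (0 * u + s)) = cos s.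
      rewrite /period_mean; under eq_Rintegral do rewrite mul0r add0r.
      exact: Rintegral_cst01.
    rewrite mulrC.
    apply: (eq_has_mean _ (has_meanZ (a := cos s) bh hm)) => y.
    by rewrite mul0r add0r mulrC.
  rewrite period_mean_cos// mulr0.
  apply: (eq_has_mean _ (h0 n (n%:R * th + s) n0)) => y.
  by rewrite mulrDr -addrA mulrA.
- rewrite /period_mean RintegralD//; last 2 first.
  + exact: integrable_period (trig_poly_bounded_measurable tg).
  + exact: integrable_period (trig_poly_bounded_measurable tg').
  rewrite mulrDr; apply: (eq_has_mean (fun y => esym (mulrDr _ _ _))).
  apply: has_meanD; [| |exact: IHg|exact: IHg'].
  + apply: bounded_measurableM => //; apply: bounded_measurable_affine.
    exact: trig_poly_bounded_measurable.
  + apply: bounded_measurableM => //; apply: bounded_measurable_affine.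
    exact: trig_poly_bounded_measurable.
- rewrite /period_mean RintegralZl//; last first.
    exact: integrable_period (trig_poly_bounded_measurable tg).
  rewrite mulrCA; apply: (eq_has_mean (fun y => mulrCA _ _ _)).
  apply: has_meanZ; last exact: IHg.
  apply: bounded_measurableM => //; apply: bounded_measurable_affine.
  exact: trig_poly_bounded_measurable.
Qed.

Lemma trig_poly_cosM g : trig_poly g -> trig_poly (fun u => cos u * g u).
Proof.
elim=> {g} [n s|g g' tg IHg tg' IHg'|a g tg IHg].
(* The product formula produces the harmonics [n - 1] and [n + 1], so the constant harmonic is
   treated apart. *)
- case: n => [|n].
    have := trig_polyZ (cos s) (trig_poly_cos 1 0); congr trig_poly.
    by apply/funext => u; rewrite mul1r mul0r addr0 add0r mulrC.
  have := trig_polyZ 2^-1 (trig_polyD (trig_poly_cos n.+2 s) (trig_poly_cos n s)).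
  congr trig_poly; apply/funext => u.
  rewrite (_ : n.+2%:R * u + s = (n.+1%:R * u + s) + u); last by rewrite -natr1; ring.
  rewrite (_ : n%:R * u + s = (n.+1%:R * u + s) - u); last by rewrite -natr1; ring.
  by rewrite cosB cosD; field.
- by under eq_fun do rewrite mulrDr; exact: trig_polyD.
- by under eq_fun do rewrite mulrCA; exact: trig_polyZ.
Qed.

Lemma trig_poly_cosX (k : nat) : trig_poly (fun u => cos u ^+ k).
Proof.
elim: k => [|k IH].
  have := trig_poly_cos 0 0; congr trig_poly; apply/funext => u.
  by rewrite mul0r addr0 cos0 expr0.
by under eq_fun do rewrite exprS; exact: trig_poly_cosM.
Qed.

Lemma trig_poly_sum_cosX (c : nat -> R) (n : nat) :
  trig_poly (fun u => \sum_(k < n) c k * cos u ^+ k).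
Proof.
elim: n => [|n IH].
  have := trig_polyZ 0 (trig_poly_cos 0 0); congr trig_poly; apply/funext => u.
  by rewrite big_ord0 mul0r.
under eq_fun do rewrite big_ord_recr/=.
by apply: trig_polyD IH _; apply: trig_polyZ; exact: trig_poly_cosX.
Qed.

Lemma factors_means_limit g : bounded_measurable g ->
  (forall e, 0 < e -> exists2 g', trig_poly g' & forall u, `|g u - g' u| <= e) ->
  factors_means g.
Proof.
move=> bg H w th h m bh hm h0; apply: has_mean_limit => e e0.
have [_ [B hB]] := bh.
(* The uniform error of [g'] is multiplied by [|m|] in the limit value and by at most [|B|] in the
   averages; the [+ 1] keeps the divisor positive. *)
have K0 : 0 < `|m| + `|B| + 1 by rewrite ltr_wpDl// addr_ge0.
have [g' tg' gg'] := H _ (divr_gt0 e0 K0).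
have bg' := trig_poly_bounded_measurable tg'.
set d := e / _ in gg'; have d0 : 0 < d by rewrite divr_gt0.
have de : e = (`|m| + `|B| + 1) * d by rewrite /d mulrC divfK// gt_eqF.
exists (fun y => h y * g' (w * y + th)), (m * period_mean g'); split.
- exact: trig_poly_factors_means.
- rewrite -mulrBr normrM /period_mean -RintegralB//; [|exact: integrable_period..].
  rewrite de ler_pM//.
    by rewrite -addrA lerDl addr_ge0.
  apply: (le_trans (le_normr_Rintegral _ (integrable_period (bounded_measurableB bg bg')))) => //.
  rewrite (_ : d = \int[mu]_(t in `[0, 1]) d); last first.
    by rewrite Rintegral_cst01.
  apply: le_Rintegral => //.
    exact: integrable_norm (integrable_period (bounded_measurableB bg bg')).
  by apply: bounded_measurable_integrable; exact: bounded_measurable_cst.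
- near=> Y.
  rewrite -mulN1r -avgZ; last first.
    by apply: bounded_measurableM => //; exact: bounded_measurable_affine.
  rewrite -avgD; last 2 first.
  + by apply: bounded_measurableM => //; exact: bounded_measurable_affine.
  + apply: bounded_measurableZ; apply: bounded_measurableM => //.
    exact: bounded_measurable_affine.
  apply: avg_bound => //.
    apply: bounded_measurableD.
      by apply: bounded_measurableM => //; exact: bounded_measurable_affine.
    apply: bounded_measurableZ; apply: bounded_measurableM => //.
    exact: bounded_measurable_affine.
  move=> y _; rewrite mulN1r -mulrBr normrM de ler_pM//.
  rewrite (le_trans (hB y))// (le_trans (ler_norm _))// -addrA addrCA lerDl.
  by rewrite addr_ge0.
Unshelve. all: by end_near. Qed.

(** Since [|a * cos u| <= |a|], the exponential series at [|a|] majorizes the series of [f]; its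
    truncation index does not depend on [u], and the truncations are polynomials in [cos u]. *)
Lemma pseries_comp_cos_factors_means (c : nat -> R) (f : R -> R) (a : R) :
  (forall k, `|c k| <= k`!%:R^-1) ->
  (forall x, series (fun k => c k * x ^+ k) n @[n --> \oo] --> f x) ->
  bounded_measurable (fun u => f (a * cos u)) ->
  factors_means (fun u => f (a * cos u)).
Proof.
move=> c1 fE bf; apply: factors_means_limit bf _ => e e0.
have eE : series (exp_coeff `|a|) n @[n --> \oo] --> expR `|a|.
  by rewrite /expR; exact: is_cvg_series_exp_coeff.
have [K _ KP] : \forall n \near \oo, `|expR `|a| - series (exp_coeff `|a|) n| <= e.
  by move/cvgrPdist_le : eE; apply.
exists (fun u => \sum_(k < K) (c k * a ^+ k) * cos u ^+ k).
  exact: (trig_poly_sum_cosX (fun k => c k * a ^+ k)).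
move=> u; set x := a * cos u.
have -> : \sum_(k < K) c k * a ^+ k * cos u ^+ k = series (fun k => c k * x ^+ k) K.
  rewrite /series/= big_mkord; apply: eq_bigr => k _.
  by rewrite /x exprMn mulrA.
have xa : `|x| <= `|a| by rewrite normrM ler_piMr// cos_max.
have H (n : nat) : (K <= n)%N -> `|series (fun k => c k * x ^+ k) n -
    series (fun k => c k * x ^+ k) K| <= e.
  move=> Kn; rewrite sub_series_geq//.
  apply: (le_trans (ler_norm_sum _ _ _)).
  apply: (@le_trans _ _ (\sum_(K <= k < n) exp_coeff `|a| k)).
    apply: ler_sum => k _; rewrite /exp_coeff/= normrM normrX mulrC ler_pM//.
    by rewrite lerXn2r// nnegrE.
  rewrite -sub_series_geq//; apply: le_trans (KP K (leqnn _)).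
  rewrite (le_trans _ (ler_norm _))// lerD2r.
  apply: nondecreasing_cvgn_le eE _.
  apply/nondecreasing_seqP => k; rewrite /series/= big_nat_recr//= lerDl.
  by rewrite /exp_coeff/= divr_ge0.
rewrite -(cvg_lim _ (fE x))//.
have fx : `|series (fun k => c k * x ^+ k) n - series (fun k => c k * x ^+ k) K| @[n --> \oo] -->
   `|f x - series (fun k => c k * x ^+ k) K|.
  by apply: cvg_norm; apply: cvgB => //; exact: cvg_cst.
rewrite (cvg_lim _ (fE x))// -(cvg_lim _ fx)//.
apply: limr_le; first exact: (cvgP _ fx).
by exists K.
Qed.

End Factorization.

(** * Bessel factors from linearly independent frequencies *)

Section BesselProduct.
Context {R : realType}.
Notation mu := (@lebesgue_measure R).
Implicit Types (g h : R -> R) (e : R).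

Lemma bounded_measurable_comp_cos (f : R -> R) (a : R) : continuous f ->
  (forall x, `|f x| <= 1) -> bounded_measurable (fun u => f (a * cos u)).
Proof.
move=> cf f1; apply: continuous_bounded_measurable; last by exists 1.
move=> u; apply: (@continuous_comp _ _ _ (fun u => a * cos u) f); last exact: cf.
by apply: cvgMl_tmp; exact: continuous_cos.
Qed.

Lemma cos_comp_cos_factors_means (a : R) :
  factors_means (fun u => cos (a * cos u)).
Proof.
apply: (@pseries_comp_cos_factors_means _
  (fun n => (~~ odd n)%:R * (-1) ^+ n./2 * (n`!%:R)^-1)).
- move=> k; rewrite !normrM normfV !normr_nat normrX normrN1 expr1n mulr1.
  by rewrite ler_piMl// ?invr_ge0//; case: (~~ _).
- by move=> x; rewrite cosE /pseries; rewrite -cos_coeffE; exact: is_cvg_series_cos_coeff.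
- by apply: bounded_measurable_comp_cos; [exact: continuous_cos|exact: cos_max].
Qed.

Lemma sin_comp_cos_factors_means (a : R) :
  factors_means (fun u => sin (a * cos u)).
Proof.
apply: (@pseries_comp_cos_factors_means _
  (fun n => (odd n)%:R * (-1) ^+ n.-1./2 * (n`!%:R)^-1)).
- move=> k; rewrite !normrM normfV !normr_nat normrX normrN1 expr1n mulr1.
  by rewrite ler_piMl// ?invr_ge0//; case: odd.
- by move=> x; rewrite sinE /pseries; rewrite -sin_coeffE; exact: is_cvg_series_sin_coeff.
- by apply: bounded_measurable_comp_cos; [exact: continuous_sin|exact: sin_max].
Qed.

Lemma J0E (a : R) : J0 a = (period_mean (fun u => cos (a * cos u)) -i*
   period_mean (fun u => sin (a * cos u)))%C.
Proof. by []. Qed.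

Section Product.
Variables (Lam : nat -> R) (a th : nat -> R).
Hypothesis Lam_free : Q_lin_indep Lam.

Definition tone_sum (M : nat) (y : R) := \sum_(m < M) a m * cos (Lam m * y + th m).

(** Stronger than [w != 0], and stable under what multiplication by harmonics of the next tone does
    to a frequency, namely adding integer multiples of [Lam M]. *)
Definition off_span (M : nat) (w : R) :=
  forall q : nat -> rat, w != \sum_(m < M) ratr (q m) * Lam m.

Lemma off_span_step M w (k : int) : off_span M.+1 w -> off_span M (w + k%:~R * Lam M).
Proof.
move=> ow q; apply/eqP => wq.
have /eqP := ow (fun m => if m == M then - k%:~R else q m); apply.
rewrite big_ord_recr/= eqxx (eq_bigr (fun m : 'I_M => ratr (q m) * Lam m)).
  by rewrite -wq rmorphN rmorph_int mulNr addrK.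
by move=> i _; rewrite ltn_eqF.
Qed.

(** This is where linear independence enters; the rest of the factorization only manipulates
    [off_span]. *)
Lemma off_span_Lam M (k : int) : k != 0 -> off_span M (k%:~R * Lam M).
Proof.
move=> k0 q; apply/eqP => kq.
have := @Lam_free M.+1 (fun m => if m == M then - k%:~R else q m).
rewrite big_ord_recr/= eqxx (eq_bigr (fun m : 'I_M => ratr (q m) * Lam m)); last first.
  by move=> i _; rewrite ltn_eqF.
rewrite -kq rmorphN rmorph_int mulNr addrN => /(_ erefl M (ltnSn M)).
by rewrite eqxx => /eqP; rewrite oppr_eq0 intr_eq0 (negbTE k0).
Qed.

Lemma tone_sum_continuous M : continuous (tone_sum M).
Proof.
elim: M => [|M IH] y.
  rewrite (_ : tone_sum 0 = cst 0); first exact: cvg_cst.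
  by apply/funext => x; rewrite /tone_sum big_ord0.
rewrite (_ : tone_sum M.+1 = fun y => tone_sum M y + a M * cos (Lam M * y + th M)).
  by apply: cvgD; [exact: IH|apply: cvgMl_tmp; exact: continuous_cos_affine].
by apply/funext => x; rewrite /tone_sum big_ord_recr.
Qed.

Lemma tone_sum_bounded_measurable (f : R -> R) M : continuous f ->
  (forall x, `|f x| <= 1) -> bounded_measurable (fun y => f (tone_sum M y)).
Proof.
move=> cf f1; apply: continuous_bounded_measurable; last by exists 1.
by move=> y; apply: continuous_comp; [exact: tone_sum_continuous|exact: cf].
Qed.

Let bm_cosS M := tone_sum_bounded_measurable M (@continuous_cos R) (@cos_max R).
Let bm_sinS M := tone_sum_bounded_measurable M (@continuous_sin R) (@sin_max R).
Let pc m := period_mean (fun u => cos (a m * cos u)).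
Let ps m := period_mean (fun u => sin (a m * cos u)).

(** [factors_means] is applied to [h y * cos (w * y + s)], whose mean is 0. Its product with the
    harmonic [n] of [Lam M] splits into the frequencies [w + n * Lam M] and [w - n * Lam M], both
    off the span of the first [M] frequencies. *)
Lemma off_span_factors (g : R -> R) M (h : R -> R) (w s : R) :
  bounded_measurable h -> factors_means g -> bounded_measurable g ->
  (forall w s, off_span M w -> has_mean (fun y => h y * cos (w * y + s)) 0) ->
  off_span M.+1 w ->
  has_mean (fun y => h y * g (Lam M * y + th M) * cos (w * y + s)) 0.
Proof.
move=> bh fg bg H ow.
have ow' (k : int) := off_span_step k ow.
have b1 := bounded_measurableM bh (bounded_measurable_cos w s).
have m1 : has_mean (fun y => h y * cos (w * y + s)) 0.
  by apply: H; move: (ow' 0); rewrite mul0r addr0.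
have := fg (Lam M) (th M) _ 0 b1 m1; rewrite mul0r => K.
apply: (eq_has_mean _ (K _)) => [y|n s' n0]; first by rewrite mulrAC.
have H1 := H _ (s + s') (ow' n%:Z); have H2 := H _ (s - s') (ow' (- n%:Z)).
have bb w' s'' := bounded_measurableM bh (bounded_measurable_cos w' s'').
have := has_meanZ (a := 2^-1) (bounded_measurableD (bb _ _) (bb _ _)) (has_meanD (bb _ _) (bb _ _) H1 H2).
rewrite addr0 mulr0; apply: eq_has_mean => y; rewrite rmorphN/= -pmulrn.
set x := w * y + s; set z := n%:R * Lam M * y + s'.
rewrite (_ : (w + n%:R * Lam M) * y + (s + s') = x + z); last by rewrite /x /z; ring.
rewrite (_ : (w + - n%:R * Lam M) * y + (s - s') = x - z); last by rewrite /x /z; ring.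
by rewrite cosD cosB; field.
Qed.

(** The two means together say that [exp (- i * tone_sum M y)] has mean the partial product, hence
    the minus sign on the sine. The last two clauses are the decorrelation that lets the next tone
    be factored out; the addition formulas mix cosine and sine, so all four go through the induction
    together. *)
Lemma tone_sum_mean M :
  [/\ has_mean (fun y => cos (tone_sum M y)) (complex.Re (\prod_(m < M) J0 (a m))),
      has_mean (fun y => sin (tone_sum M y)) (- complex.Im (\prod_(m < M) J0 (a m))),
      forall w s, off_span M w -> has_mean (fun y => cos (tone_sum M y) * cos (w * y + s)) 0 &
      forall w s, off_span M w -> has_mean (fun y => sin (tone_sum M y) * cos (w * y + s)) 0].
Proof.
elim: M => [|M [IHc IHs Hc Hs]].
  have S0 y : tone_sum 0 y = 0 by rewrite /tone_sum big_ord0.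
  rewrite big_ord0/= oppr0; split.
  - by apply: (eq_has_mean _ (@has_mean_cst R 1)) => y; rewrite S0 cos0.
  - by apply: (eq_has_mean _ (@has_mean_cst R 0)) => y; rewrite S0 sin0.
  - move=> w s ow; apply: (eq_has_mean _ (@has_mean_cos _ w s _)) => [y|].
      by rewrite S0 cos0 mul1r.
    (* Off the span of no frequencies means nonzero, so the cosine has mean 0. *)
    by have := ow (fun=> 0); rewrite big_ord0.
  - move=> w s ow; apply: (eq_has_mean _ (@has_mean_cst R 0)) => y.
    by rewrite S0 sin0 mul0r.
have bg (f : R -> R) : continuous f -> (forall x, `|f x| <= 1) ->
    bounded_measurable (fun u => f (a M * cos u)) by exact: bounded_measurable_comp_cos.
have bgc := bg _ (@continuous_cos R) (@cos_max R).
have bgs := bg _ (@continuous_sin R) (@sin_max R).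
have fgc := @cos_comp_cos_factors_means (a M).
have fgs := @sin_comp_cos_factors_means (a M).
have Hn (h : R -> R) : (forall w s, off_span M w -> has_mean (fun y => h y * cos (w * y + s)) 0) ->
    forall (n : nat) (s : R), (0 < n)%N -> has_mean (fun y => h y * cos (n%:R * Lam M * y + s)) 0.
  move=> H n s n0; apply: H; have := @off_span_Lam M n%:Z; apply.
  by case: n n0.
have bgcA := bounded_measurable_affine (Lam M) (th M) bgc.
have bgsA := bounded_measurable_affine (Lam M) (th M) bgs.
have cc := fgc (Lam M) (th M) _ _ (bm_cosS M) IHc (Hn _ Hc).
have cs := fgs (Lam M) (th M) _ _ (bm_cosS M) IHc (Hn _ Hc).
have sc := fgc (Lam M) (th M) _ _ (bm_sinS M) IHs (Hn _ Hs).
have ss := fgs (Lam M) (th M) _ _ (bm_sinS M) IHs (Hn _ Hs).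
have bcc := bounded_measurableM (bm_cosS M) bgcA.
have bcs := bounded_measurableM (bm_cosS M) bgsA.
have bsc := bounded_measurableM (bm_sinS M) bgcA.
have bss := bounded_measurableM (bm_sinS M) bgsA.
have SS y : tone_sum M.+1 y = tone_sum M y + a M * cos (Lam M * y + th M).
  by rewrite /tone_sum big_ord_recr.
rewrite !big_ord_recr/= J0E -/(pc M) -/(ps M).
case: (\prod_(m < M) _) cc cs sc ss {IHc IHs} => mr mi /= cc cs sc ss.
split.
- have := has_meanD bcc (bounded_measurableZ (-1) bss) cc (has_meanZ (a := -1) bss ss).
  rewrite (_ : _ + _ = mr * pc M - mi * - ps M); last by rewrite /pc /ps; ring.
  by apply: eq_has_mean => y; rewrite SS (cosD (tone_sum M y)) mulN1r.
- have := has_meanD bsc bcs sc cs.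
  rewrite (_ : _ + _ = - (mr * - ps M + mi * pc M)); last by rewrite /pc /ps; ring.
  by apply: eq_has_mean => y; rewrite SS (sinD (tone_sum M y)).
- move=> w s ow.
  have h1 := off_span_factors s (bm_cosS M) fgc bgc Hc ow.
  have h2 := off_span_factors s (bm_sinS M) fgs bgs Hs ow.
  have b1 := bounded_measurableM bcc (bounded_measurable_cos w s).
  have b2 := bounded_measurableM bss (bounded_measurable_cos w s).
  have := has_meanD b1 (bounded_measurableZ (-1) b2) h1 (has_meanZ (a := -1) b2 h2).
  by rewrite mulr0 addr0; apply: eq_has_mean => y; rewrite SS (cosD (tone_sum M y)); ring.
- move=> w s ow.
  have h1 := off_span_factors s (bm_sinS M) fgc bgc Hs ow.
  have h2 := off_span_factors s (bm_cosS M) fgs bgs Hc ow.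
  have b1 := bounded_measurableM bsc (bounded_measurable_cos w s).
  have b2 := bounded_measurableM bcs (bounded_measurable_cos w s).
  have := has_meanD b1 b2 h1 h2.
  by rewrite addr0; apply: eq_has_mean => y; rewrite SS (sinD (tone_sum M y)); ring.
Qed.

End Product.
End BesselProduct.

(** * Riesz representation of tight functionals *)

Section BoundedContinuous.
Context {R : realType} {l : nat}.
Implicit Types f g : 'rV[R]_l -> R.

Definition bounded_continuous f := continuous f /\ exists M : R, forall x, `|f x| <= M.

Lemma bounded_continuous_cst (a : R) : bounded_continuous (fun=> a).
Proof. by split; [exact: cst_continuous|exists `|a|]. Qed.

Lemma bounded_continuousD f g : bounded_continuous f -> bounded_continuous g ->
  bounded_continuous (fun x => f x + g x).
Proof.
move=> [cf [M fM]] [cg [N gN]]; split; first by move=> x; exact: (continuousD (cf x) (cg x)).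
by exists (M + N) => x; rewrite (le_trans (ler_normD _ _))// lerD.
Qed.

Lemma bounded_continuousZ (a : R) f : bounded_continuous f ->
  bounded_continuous (fun x => a * f x).
Proof.
move=> [cf [M fM]]; split.
  by move=> x; exact: (continuousM (@cst_continuous _ _ a x) (cf x)).
by exists (`|a| * M) => x; rewrite normrM; apply: ler_wpM2l (fM x).
Qed.

Lemma bounded_continuousB f g : bounded_continuous f -> bounded_continuous g ->
  bounded_continuous (fun x => f x - g x).
Proof.
move=> bf bg; rewrite (_ : (fun _ => _) = fun x => f x + -1 * g x).
  by apply: bounded_continuousD => //; exact: bounded_continuousZ.
by apply/funext => x; rewrite mulN1r.
Qed.

Lemma bounded_continuous_min f g : bounded_continuous f -> bounded_continuous g ->
  bounded_continuous (fun x => Num.min (f x) (g x)).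
Proof.
move=> [cf [M fM]] [cg [N gN]]; split.
  by move=> x; apply: (@continuous_min R _ f g); [exact: cf|exact: cg].
exists (Num.max M N) => x; case: (leP (f x) (g x)) => _; rewrite le_max.
  by rewrite fM.
by rewrite gN orbT.
Qed.

Lemma bounded_continuous_sum (n : nat) (f : nat -> 'rV[R]_l -> R) :
  (forall i, bounded_continuous (f i)) ->
  bounded_continuous (fun x => \sum_(i < n) f i x).
Proof.
move=> bf; elim: n => [|n IH].
  rewrite (_ : (fun _ => _) = fun=> 0); first exact: bounded_continuous_cst.
  by apply/funext => x; rewrite big_ord0.
rewrite (_ : (fun _ => _) = fun x => \sum_(i < n) f i x + f n x).
  exact: bounded_continuousD.
by apply/funext => x; rewrite big_ord_recr.
Qed.

(* [g x] is the distance from [x] to the complement of [U], capped at [1]. *)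
Lemma open_cozero (U : set 'rV[R]_l) : open U -> exists g,
  [/\ continuous g, forall x, 0 <= g x <= 1, forall x, U x -> 0 < g x &
      forall x, ~ U x -> g x = 0].
Proof.
move=> oU.
pose S x := [set r : R | 0 <= r <= 1 /\ forall y, `|x - y| < r -> U y].
have S0 x : S x 0 by split; rewrite ?lexx ?ler01// => y; rewrite normr_lt0.
have hS x : has_sup (S x) by split; [exists 0|exists 1 => r [/andP[]]].
pose g x := sup (S x).
have g0 x : 0 <= g x by apply: ub_le_sup; [case: (hS x)|].
have g1 x : g x <= 1 by apply: ge_sup; [exists 0|move=> r [/andP[]]].
have lip x y : g x - g y <= `|x - y|.
  rewrite lerBlDr; apply: ge_sup; first by exists 0.
  move=> r [/andP[r0 r1] rU].
  have [|ry] := leP (r - `|x - y|) 0.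
    by rewrite subr_le0 => h; rewrite (le_trans h)// lerDl.
  rewrite -lerBlDl; apply: ub_le_sup; first by case: (hS y).
  split; first by rewrite (ltW ry) (le_trans _ r1)// gerBl.
  move=> z zr; apply: rU; rewrite -(subrK y x) -addrA (le_lt_trans (ler_normD _ _))//.
  by rewrite -ltrBrDl.
exists g; split.
- move=> x; apply/(@cvgrPdist_le _ _ _ (nbhs x)) => e e0; near=> y.
  rewrite ler_norml; apply/andP; split.
    rewrite lerNl opprB.
    apply: le_trans (lip y x) _; rewrite distrC; near: y.
    by rewrite -nbhs_nbhs_norm; exists e => //= z /ltW.
  apply: le_trans (lip x y) _; near: y.
  by rewrite -nbhs_nbhs_norm; exists e => //= z /ltW.
- by move=> x; rewrite g0 g1.
- move=> x Ux; have /nbhs_normP[r/= r0 rU] : nbhs x U by exact: open_nbhs_nbhs.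
  apply: (@lt_le_trans _ _ (Num.min r 1)); first by rewrite lt_min r0 ltr01.
  apply: ub_le_sup; first by case: (hS x).
  split; first by rewrite le_min (ltW r0) ler01/= ge_min lexx orbT.
  by move=> y; rewrite lt_min => /andP[xy _]; apply: rU.
- move=> x Ux; apply/eqP; rewrite eq_le g0 andbT; apply: ge_sup; first by exists 0.
  move=> r [_ rU]; rewrite leNgt; apply/negP => r0; apply: Ux; apply: rU.
  by rewrite subrr normr0.
Unshelve. all: by end_near. Qed.

End BoundedContinuous.

Lemma continuous_measurable_RBorel (R : realType) (l : nat) (f : 'rV[R]_l -> R) :
  continuous f -> measurable_fun [set: RBorel R l] f.
Proof.
move=> cf; apply: (measurability _ (RGenOpens.measurableE R)).
move=> _ [_ [a [b ->] <-]]; rewrite setTI; apply: sub_sigma_algebra.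
by apply: open_comp; [move=> x _; exact: cf|exact: interval_open].
Qed.

Lemma bounded_continuous_integrable (R : realType) (l : nat)
    (Q : probability (RBorel R l) R) (f : 'rV[R]_l -> R) :
  bounded_continuous f -> Q.-integrable setT (EFin \o f).
Proof.
move=> [cf [M fM]]; apply: measurable_bounded_integrable => //.
- exact: le_lt_trans (probability_le1 Q measurableT) (ltry 1).
- exact: continuous_measurable_RBorel.
- exists M; split; first exact: num_real.
  by move=> x Mx y _ /=; apply: le_trans (fM y) (ltW Mx).
Qed.

(** * Construction of the representing measure *)

Section Riesz.
Context {R : realType} {l : nat}.
Local Notation V := 'rV[R]_l.
Implicit Types (f g : V -> R) (U W : set V) (A : set V).

Variable L : (V -> R) -> R.
Hypothesis LD : forall f g, bounded_continuous f -> bounded_continuous g ->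
  L (fun x => f x + g x) = L f + L g.
Hypothesis LZ : forall a f, bounded_continuous f -> L (fun x => a * f x) = a * L f.
Hypothesis le_L : forall f g, bounded_continuous f -> bounded_continuous g ->
  (forall x, f x <= g x) -> L f <= L g.
Hypothesis L1 : L (fun=> 1) = 1.
(** Tightness without a measure: [B] depends on [e] and [C] only. In [2 * e] one share pays for the
    ball and the other for the region outside it. *)
Hypothesis L_tight : forall (e C : R), 0 < e -> exists B : R, forall f,
  bounded_continuous f -> (forall x, `|x| <= B -> f x <= e) ->
  (forall x, f x <= C) -> L f <= 2 * e.

Let bc0 : bounded_continuous (fun _ : V => 0 : R) := bounded_continuous_cst 0.
Let bc1 : bounded_continuous (fun _ : V => 1 : R) := bounded_continuous_cst 1.

Let L0 : L (fun=> 0) = 0.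
Proof.
rewrite -[RHS](mul0r (L (fun=> 1))) -LZ//; congr L.
by apply/funext => x; rewrite mul0r.
Qed.

Let LB f g : bounded_continuous f -> bounded_continuous g ->
  L (fun x => f x - g x) = L f - L g.
Proof.
move=> bf bg; rewrite -mulN1r -LZ// -LD//; last exact: bounded_continuousZ.
by congr L; apply/funext => x; rewrite mulN1r.
Qed.

Let L_sum (n : nat) (f : nat -> V -> R) : (forall i, bounded_continuous (f i)) ->
  L (fun x => \sum_(i < n) f i x) = \sum_(i < n) L (f i).
Proof.
move=> bf; elim: n => [|n IH].
  by rewrite big_ord0 -L0; congr L; apply/funext => x; rewrite big_ord0.
rewrite big_ord_recr/= -IH -LD//; last exact: bounded_continuous_sum.
by congr L; apply/funext => x; rewrite big_ord_recr.
Qed.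

(* Dini on a large ball, tightness outside. *)
Let L_continuous_below (f_ : nat -> V -> R) f (e : R) : 0 < e ->
  (forall n, bounded_continuous (f_ n)) -> bounded_continuous f ->
  (forall n m x, (n <= m)%N -> f_ n x <= f_ m x) ->
  (forall x, exists n, f_ n x = f x) -> (forall n x, 0 <= f_ n x) ->
  exists n, L f <= L (f_ n) + e.
Proof.
move=> e0 bf_ bf mf_ f_f f_0; have e20 : 0 < e / 2 by rewrite divr_gt0.
have [cf [M fM]] := bf.
have [B HB] := L_tight M e20.
have cK : compact [set x : V | `|x| <= B].
  apply: bounded_closed_compact.
    by exists B; split; [exact: num_real|move=> x /ltW Bx u /= uB; exact: le_trans Bx].
  apply: (@closed_comp _ _ (fun u : V => `|u|) [set x | x <= B]).
    by move=> x _; exact: norm_continuous.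
  exact: closed_le.
have H : \forall n \near \oo, [set x : V | `|x| <= B] `<=`
    (fun x => f x - f_ n x <= e / 2).
  apply: ((iffLR (compact_near_coveringP _) cK) nat \oo (fun n x => f x - f_ n x <= e / 2)) => x _.
  have [n0 n0E] := f_f x.
  have [cg _] := bounded_continuousB bf (bf_ n0).
  have /cvgrPdist_le/(_ _ e20) := cg x.
  rewrite n0E subrr => Hx.
  near=> w n => /=.
  apply: (@le_trans _ _ (f w - f_ n0 w)).
    by rewrite lerD2l lerN2 mf_//; near: n; exact: nbhs_infty_ge.
  have : `|0 - (f w - f_ n0 w)| <= e / 2 by near: w.
  by rewrite sub0r normrN; exact: ler_normlW.
have [n _ Hn] := H; exists n; rewrite -lerBlDl -LB//.
rewrite (_ : e = 2 * (e / 2)); last by field.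
apply: HB; first exact: bounded_continuousB.
  by move=> x; exact: (Hn n (leqnn n)).
by move=> x; rewrite lerBlDr (le_trans (ler_norm _))// (le_trans (fM x))// lerDl.
Unshelve. all: by end_near. Qed.

(** The functions vanish off [U] instead of having compact support in it; tightness takes over the
    role of compact support in the Dini argument. *)
Let below U f := [/\ bounded_continuous f, forall x, 0 <= f x <= 1 &
  forall x, ~ U x -> f x = 0].

Definition open_mass U : \bar R := ereal_sup [set (L f)%:E | f in [set f | below U f]].

Definition riesz_outer A : \bar R :=
  ereal_inf [set open_mass U | U in [set U | open U /\ A `<=` U]].

Let below0 U : below U (fun=> 0).
Proof. by split => // x; rewrite lexx ler01. Qed.

Let open_mass_ge0 U : (0 <= open_mass U)%E.
Proof. by apply: ereal_sup_ubound; exists (fun=> 0); [exact: below0|rewrite L0]. Qed.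

Let open_mass_le1 U : (open_mass U <= 1)%E.
Proof.
apply: ge_ereal_sup => _ [f [bf f01 _] <-]; rewrite lee_fin -L1; apply: le_L => // x.
by case/andP: (f01 x).
Qed.

Let open_mass_fin U : open_mass U \is a fin_num.
Proof. by rewrite ge0_fin_numE// (le_lt_trans (open_mass_le1 U))// ltry. Qed.

Let le_open_mass U W : U `<=` W -> (open_mass U <= open_mass W)%E.
Proof.
move=> UW; apply: ge_ereal_sup => _ [f [bf f01 f0] <-]; apply: ereal_sup_ubound.
by exists f => //; split => // x /(contra_not (@UW x)); exact: f0.
Qed.

Let riesz_outer_open U : open U -> riesz_outer U = open_mass U.
Proof.
move=> oU; apply/eqP; rewrite eq_le; apply/andP; split.
  by apply: ereal_inf_lbound; exists U => //; split.
by apply: le_ereal_inf_tmp => _ [W [oW UW] <-]; exact: le_open_mass.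
Qed.

Let riesz_outer_ge0 A : (0 <= riesz_outer A)%E.
Proof. by apply: le_ereal_inf_tmp => _ [U _ <-]; exact: open_mass_ge0. Qed.

Let riesz_outer0 : riesz_outer set0 = 0%E.
Proof.
rewrite riesz_outer_open; last exact: open0.
apply/eqP; rewrite eq_le open_mass_ge0 andbT; apply: ge_ereal_sup => _ [f [_ _ f0] <-].
by rewrite (_ : f = fun=> 0) ?L0//; apply/funext => x; exact: f0.
Qed.

Let le_riesz_outer : {homo riesz_outer : A B / A `<=` B >-> (A <= B)%E}.
Proof.
move=> A B AB; apply: le_ereal_inf_tmp => _ [U [oU BU] <-].
by apply: ereal_inf_lbound; exists U => //; split => //; exact: subset_trans BU.
Qed.

(** Given [f] below the union, [h k n] rises with [k] to the indicator of [U n], so [F k] rises to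
    [f] and equals it at each point from some [k] on. Then [L f] is within [e] of [L (F k)], which
    is at most a finite sum of [L (h k n)]. *)
Let open_mass_bigcup (U : nat -> set V) : (forall n, open (U n)) ->
  (open_mass (\bigcup_n U n) <= \sum_(n <oo) open_mass (U n))%E.
Proof.
move=> oU; apply: ge_ereal_sup => _ [f [bf f01 f0] <-].
apply/lee_addgt0Pr => e e0.
have /choice[g gP] n := open_cozero (oU n).
pose h k n x := Num.min 1 (k%:R * g n x).
have hb k n : below (U n) (h k n).
  have [cg g01 gU g0] := gP n; split.
  - apply: bounded_continuous_min; first exact: bc1.
    apply: bounded_continuousZ; split => //; exists 1 => x.
    by rewrite ger0_norm; case/andP: (g01 x).
  - move=> x; have /andP[gx _] := g01 x.
    by rewrite /h le_min ler01 mulr_ge0//= ge_min lexx.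
  - by move=> x /g0; rewrite /h => ->; rewrite mulr0; apply/min_idPr.
have h_ge0 k n x : 0 <= h k n x by have [_ /(_ x)/andP[]] := hb k n.
have bh k n : bounded_continuous (h k n) by have [] := hb k n.
pose F k x := Num.min (f x) (\sum_(n < k) h k n x).
have bS k : bounded_continuous (fun x => \sum_(n < k) h k n x).
  exact: (bounded_continuous_sum k (bh k)).
have [||||k Lk] := @L_continuous_below F f e e0 _ bf.
- by move=> k; apply: bounded_continuous_min.
- move=> k m x km; rewrite /F le_min ge_min lexx/= ge_min; apply/orP; right.
  rewrite -(subnKC km) big_split_ord/= -[leLHS]addr0 lerD//; last exact: sumr_ge0.
  apply: ler_sum => n _; rewrite /h le_min ge_min lexx/= ge_min; apply/orP; right.
  have [_ /(_ x)/andP[gx _] _ _] := gP n.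
  by rewrite ler_wpM2r// ler_nat leq_addr.
- move=> x; have [[n _ Ux]|nU] := pselect ((\bigcup_n U n) x); last first.
    by exists 0%N; rewrite /F f0// big_ord0; apply/min_idPl.
  have [_ _ /(_ x Ux) gx _] := gP n.
  (* One index serves two purposes: it exceeds [n], so that [h k n] occurs in the sum, and it
     exceeds [(g n x)^-1], so that [h k n x = 1]. *)
  exists (n.+1 + Num.truncn (g n x)^-1).+1%N; rewrite /F; apply/min_idPl.
  apply: (@le_trans _ _ 1); first by case/andP: (f01 x).
  set k := _.+1.
  have nk : (n < k)%N by rewrite /k ltnS (leq_trans (leqnSn n))// leq_addr.
  rewrite (bigD1 (Ordinal nk))//= -[leLHS]addr0 lerD//; last exact: sumr_ge0.
  rewrite /h le_min lexx/= -ler_pdivrMr// div1r.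
  apply: le_trans (ltW (truncnS_gt _)) _.
  by rewrite ler_nat /k ltnS leq_addl.
- by move=> k x; rewrite /F le_min sumr_ge0// andbT; case/andP: (f01 x).
apply: le_trans (_ : ((L (F k) + e)%:E <= _)%E); first by rewrite lee_fin.
rewrite EFinD; apply: leeD => //.
apply: (@le_trans _ _ (\sum_(n < k) L (h k n))%:E).
  rewrite lee_fin -L_sum//; apply: le_L => //; first exact: bounded_continuous_min.
  by move=> x; rewrite /F ge_min lexx orbT.
rewrite -sumEFin; apply: (@le_trans _ _ (\sum_(0 <= n < k) open_mass (U n))%E).
  rewrite big_mkord; apply: lee_sum => n _; apply: ereal_sup_ubound.
  by exists (h k n) => //; exact: hb.
by apply: nneseries_lim_ge.
Qed.

Let riesz_outer_le1 A : (riesz_outer A <= 1)%E.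
Proof.
apply: le_trans (_ : (riesz_outer setT <= 1)%E); first exact: le_riesz_outer.
by rewrite riesz_outer_open//; exact: openT.
Qed.

Let riesz_outer_fin A : riesz_outer A \is a fin_num.
Proof. by rewrite ge0_fin_numE// (le_lt_trans (riesz_outer_le1 A))// ltry. Qed.

Let riesz_outer_sigma_subadditive : sigma_subadditive riesz_outer.
Proof.
move=> A; apply/lee_addgt0Pr => e e0.
rewrite (le_trans _ (epsilon_trick _ _ (ltW e0)))//.
have /choice[U UP] n : exists U, [/\ open U, A n `<=` U &
    (open_mass U <= riesz_outer (A n) + (e / (2 ^ n.+1)%:R)%:E)%E].
  have en : 0 < e / (2 ^ n.+1)%:R by rewrite divr_gt0// ltr0n expn_gt0.
  have [_ [U [oU AU] <-] /ltW] := lb_ereal_inf_adherent en (riesz_outer_fin (A n)).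
  by exists U.
apply: (@le_trans _ _ (riesz_outer (\bigcup_n U n))).
  apply: le_riesz_outer => x [n _ Ax]; exists n => //.
  by have [_ + _] := UP n; exact.
rewrite riesz_outer_open; last by apply: bigcup_open => n _; have [] := UP n.
apply: (@le_trans _ _ (\sum_(n <oo) open_mass (U n))%E).
  by apply: open_mass_bigcup => n; have [] := UP n.
by apply: lee_nneseries => // n _; have [] := UP n.
Qed.

HB.instance Definition _ := isOuterMeasure.Build R V riesz_outer
  riesz_outer0 riesz_outer_ge0 le_riesz_outer riesz_outer_sigma_subadditive.

(* If [f] lives in [W `&` U] and [g] in [W `&` [f < e]], an open set containing
   [W `\` U], then [(f + g) / (1 + e)] lives in [W]. *)
Let open_caratheodory U : open U -> riesz_outer.-caratheodory U.
Proof.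
move=> oU; apply: le_caratheodory_measurable => X.
apply: le_ereal_inf_tmp => _ [W [oW XW] <-].
apply: (@le_trans _ _ (riesz_outer (W `&` U) + riesz_outer (W `&` ~` U))%E).
  by apply: leeD; apply: le_riesz_outer; exact: setSI.
rewrite (@riesz_outer_open (W `&` U)); last exact: openI.
rewrite -leeBrDr//; apply: ge_ereal_sup => _ [f [bf f01 f0] <-].
rewrite leeBrDr//.
apply/lee_addgt0Pr => e e0.
pose W' := W `&` f @^-1` [set r | r < e].
have oW' : open W'.
  by apply: openI => //; apply: open_comp; [move=> x _; exact: bf.1|exact: open_lt].
apply: (@le_trans _ _ ((L f)%:E + open_mass W')%E).
  rewrite leeD2l// -riesz_outer_open//; apply: le_riesz_outer => x [Wx Ux]; split => //=.
  by rewrite f0// => -[].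
rewrite -leeBrDl//; apply: ge_ereal_sup => _ [g [bg g01 g0] <-].
rewrite leeBrDl// -EFinD -LD//.
pose h x := (1 + e)^-1 * (f x + g x).
have bfg := bounded_continuousD bf bg.
have e1 : 0 < 1 + e by rewrite addr_gt0.
have hW : ((L h)%:E <= open_mass W)%E.
  apply: ereal_sup_ubound; exists h => //; split.
  - exact: bounded_continuousZ.
  - move=> x; have /andP[fx0 fx1] := f01 x; have /andP[gx0 gx1] := g01 x.
    rewrite /h mulr_ge0 ?invr_ge0 ?(ltW e1) ?addr_ge0//= ler_pdivrMl// mulr1.
    have [fe|ef] := ltP (f x) e; first by rewrite addrC lerD// ltW.
    rewrite (g0 x) ?addr0; first by rewrite (le_trans fx1)// lerDl ltW.
    by move=> -[_ /=]; rewrite ltNge ef.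
  - by move=> x Wx; rewrite /h f0 ?g0 ?addr0 ?mulr0// => -[].
(* The normalization costs [e * L h], at most [e] because [open_mass W <= 1]. *)
have -> : L (fun x => f x + g x) = L h + e * L h.
  rewrite -[X in X + _]mul1r -mulrDl /h LZ// mulVKf// gt_eqF//.
rewrite EFinD; apply: leeD => //.
by rewrite lee_fin ger_pMr// -lee_fin (le_trans hW).
Qed.

Definition riesz_measure : set (RBorel R l) -> \bar R := riesz_outer.

Let Borel_caratheodory (A : set (RBorel R l)) : measurable A -> riesz_outer.-caratheodory A.
Proof.
move: A; apply: smallest_sub; last exact: open_caratheodory.
split.
- exact: caratheodory_measurable_set0.
- by move=> A mA; rewrite setTD; exact: caratheodory_measurable_setC.
- by move=> A mA; exact: caratheodory_measurable_bigcup.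
Qed.

Let riesz_measure_sigma_additive : semi_sigma_additive riesz_measure.
Proof.
move=> F mF tF mUF.
apply: (@caratheodory_measure_sigma_additive _ _ riesz_outer) => //.
- by move=> i; exact: (Borel_caratheodory (mF i)).
- exact: (Borel_caratheodory mUF).
Qed.

HB.instance Definition _ := isMeasure.Build _ _ _ riesz_measure
  riesz_outer0 riesz_outer_ge0 riesz_measure_sigma_additive.

Let riesz_measure_setT : riesz_measure setT = 1%E.
Proof.
apply/eqP; rewrite eq_le riesz_outer_le1/= /riesz_measure riesz_outer_open; last exact: openT.
apply: ereal_sup_ubound; exists (fun=> 1); last by rewrite L1.
by split => // [x|x /(_ I)//]; rewrite ler01 lexx.
Qed.

HB.instance Definition _ := Measure_isProbability.Build _ _ _ riesz_measure
  riesz_measure_setT.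

Let P : probability (RBorel R l) R := riesz_measure.

Let Rintegral_Pcst (a : R) : \int[P]_x a = a.
Proof.
rewrite Rintegral_cst// -[RHS]mulr1; congr (_ * _).
exact: (congr1 fine riesz_measure_setT).
Qed.

(* Layer cake: [f] is cut into [n.+1] slices of height [d], slice [j] living in [U j]. *)
Let le_L_integral01 f : bounded_continuous f -> (forall x, 0 <= f x <= 1) ->
  L f <= \int[P]_x f x.
Proof.
move=> bf f01; apply/ler_addgt0Pr => e e0.
pose n := Num.truncn e^-1.
have ne : n.+1%:R^-1 < e by rewrite invf_plt ?posrE//; exact: truncnS_gt.
pose d : R := n.+1%:R^-1; have d0 : 0 < d by rewrite invr_gt0.
pose m (j : nat) x := Num.min (f x) (j%:R * d).
have bm j : bounded_continuous (m j).
  by apply: bounded_continuous_min => //; exact: bounded_continuous_cst.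
pose s (j : nat) x := m j.+1 x - m j x.
have bs j : bounded_continuous (s j) by exact: bounded_continuousB.
pose U (j : nat) : set V := [set x | j%:R * d < f x].
have oU j : open (U j).
  by apply: (@open_comp _ _ f [set r | j%:R * d < r]); [move=> x _; exact: bf.1|exact: open_gt].
have mU j : measurable (U j : set (RBorel R l)) by exact: sub_sigma_algebra.
have mD j : j%:R * d <= j.+1%:R * d by rewrite ler_pM2r// ler_nat.
have s0 j x : 0 <= s j x.
  by rewrite subr_ge0 /m le_min ge_min lexx/= ge_min mD orbT.
have sE x : f x = \sum_(j < n.+1) s j x.
  rewrite -(big_mkord xpredT (fun j => s j x)) telescope_sumr// /m mul0r divff//.
  have /andP[fx0 fx1] := f01 x.
  by rewrite (min_idPl fx1) (min_idPr fx0) subr0.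
have sd j x : s j x <= d.
  rewrite /s /m lerBlDr; have [h|h] := leP (f x) (j%:R * d).
    rewrite ge_min; apply/orP; left; rewrite lerDr ltW//.
  by rewrite ge_min -natr1 mulrDl mul1r addrC lexx orbT.
have sU j : L (s j) <= d * fine (P (U j)).
  rewrite -ler_pdivrMl//.
  have bj : bounded_continuous (fun x => d^-1 * s j x) by exact: bounded_continuousZ.
  rewrite -LZ// -lee_fin fineK ?fin_num_measure//.
  rewrite [X in (_ <= X)%E](riesz_outer_open (oU j)); apply: ereal_sup_ubound.
  exists (fun x => d^-1 * s j x) => //; split => //.
    by move=> x; rewrite mulr_ge0 ?invr_ge0 ?(ltW d0)//= ler_pdivrMl// mulr1.
  move=> x /negP; rewrite -leNgt => fj; rewrite /s /m (min_idPl fj).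
  by rewrite (min_idPl (le_trans fj (mD j))) subrr mulr0.
rewrite (_ : L f = \sum_(j < n.+1) L (s j)); last first.
  by rewrite -L_sum//; congr L; apply/funext.
apply: le_trans (ler_sum _ (fun (j : 'I_n.+1) _ => sU j)) _.
have iU j : P.-integrable setT (EFin \o (fun x => d * \1_(U j) x)).
  apply: measurable_bounded_integrable => //.
  - exact: le_lt_trans (riesz_outer_le1 setT) (ltry 1).
  - by apply: measurable_funM => //; exact: measurable_indic.
  - exists d; split; first exact: num_real.
    move=> r dr x _ /=; rewrite normrM gtr0_norm// (le_trans _ (ltW dr))//.
    by rewrite ler_piMr ?(ltW d0)// indicE; case: (_ \in _); rewrite ?normr1 ?normr0.
have E (k : nat) : P.-integrable setT (EFin \o (fun x => \sum_(j < k) d * \1_(U j) x)) /\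
    \sum_(j < k) d * fine (P (U j)) = \int[P]_x (\sum_(j < k) d * \1_(U j) x).
  elim: k => [|k [ik IH]].
    rewrite big_ord0; under eq_fun do rewrite big_ord0.
    split; first by rewrite (_ : _ \o _ = cst 0%E)//; exact: integrable0.
    by rewrite Rintegral_Pcst.
  have Ek : (fun x => \sum_(j < k.+1) d * \1_(U j) x) =
      (fun x => \sum_(j < k) d * \1_(U j) x + d * \1_(U k) x).
    by apply/funext => x; rewrite big_ord_recr.
  rewrite Ek; split.
    exact: (integrableD measurableT ik (iU k)).
  rewrite big_ord_recr/= IH RintegralD//; congr (_ + _).
  rewrite /Rintegral; under eq_integral do rewrite EFinM.
  rewrite integralZl//; last first.
    by apply: integrable_indic => //; rewrite setIT ltey_eq fin_num_measure.
  by rewrite integral_indic// setIT fineM// fin_num_measure.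
have [iS ->] := E n.+1.
have be : bounded_continuous (fun _ : V => e) by exact: bounded_continuous_cst.
have -> : e = \int[P]_x e by rewrite Rintegral_Pcst.
rewrite -RintegralD//; [|exact: bounded_continuous_integrable..].
apply: le_Rintegral => //.
  by apply: bounded_continuous_integrable; exact: bounded_continuousD.
(* The indicators are shifted by one slice: above level [j.+1 * d] the slice [j] is full, of height
   [d]. The unmatched bottom indicator costs at most [d < e]. *)
move=> x _; rewrite big_ord_recl addrC; apply: lerD; last first.
  apply: le_trans (ltW ne); rewrite indicE.
  by case: (_ \in _); rewrite ?mulr1// mulr0 ltW.
apply: le_trans (_ : \sum_(j < n) s j x <= _); last first.
  by rewrite [leRHS]sE big_ord_recr/= lerDl.
apply: ler_sum => j _; rewrite indicE.
case: (boolP (_ \in _)) => [|_]; last by rewrite mulr0.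
rewrite inE /U/= /bump/= add1n => jf.
have jf' : j%:R * d < f x by apply: le_lt_trans jf.
by rewrite mulr1 /s /m (min_idPr (ltW jf)) (min_idPr (ltW jf')) -natr1 mulrDl mul1r addrAC subrr add0r.
Qed.

Lemma riesz_representation : exists Q : probability (RBorel R l) R,
  forall f, bounded_continuous f -> \int[Q]_x f x = L f.
Proof.
exists P => f.
(* The one-sided inequality for [g] and for [1 - g] gives equality. *)
have H01 g : bounded_continuous g -> (forall x, 0 <= g x <= 1) -> \int[P]_x g x = L g.
  move=> bg g01; apply/eqP; rewrite eq_le le_L_integral01// andbT.
  have b1g := bounded_continuousB bc1 bg.
  have := le_L_integral01 b1g; rewrite LB// L1 RintegralB//; last 2 first.
  - exact: (bounded_continuous_integrable P bc1).
  - exact: bounded_continuous_integrable.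
  rewrite Rintegral_Pcst lerD2l lerN2; apply.
  by move=> x; have /andP[g0 g1] := g01 x; rewrite subr_ge0 g1 gerBl.
move=> bf; have [cf [M fM]] := bf.
have M0 : 0 <= M by apply: le_trans (fM 0).
(* An affine change of values brings [f] into [[0, 1]]; [M + 1] instead of [M] keeps the scale
   positive when [f] is 0. *)
pose K := 2 * (M + 1); have K0 : 0 < K by rewrite mulr_gt0// ltr_wpDl.
pose g x := K^-1 * (f x + (M + 1)).
have bc : bounded_continuous (fun _ : V => M + 1) by exact: bounded_continuous_cst.
have bfc := bounded_continuousD bf bc.
have bg : bounded_continuous g by exact: bounded_continuousZ.
have := H01 g bg; rewrite /g LZ// RintegralZl//; last exact: (bounded_continuous_integrable P).
move=> H; have {}H : \int[P]_x (f x + (M + 1)) = L (fun x => f x + (M + 1)).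
  apply: (mulfI (lt0r_neq0 (_ : 0 < K^-1))); first by rewrite invr_gt0.
  apply: H => x; have := fM x; rewrite ler_norml => /andP[h1 h2].
  rewrite mulr_ge0 ?invr_ge0 ?(ltW K0)//=; last by rewrite addrA -lerBlDl; lra.
  by rewrite ler_pdivrMl// mulr1 /K; lra.
move: H; rewrite RintegralD//; last 2 first.
- exact: (bounded_continuous_integrable P).
- exact: (bounded_continuous_integrable P bc).
rewrite LD// Rintegral_Pcst.
have -> : L (fun=> M + 1) = M + 1.
  rewrite -[RHS]mulr1 -L1 -LZ//; congr L; apply/funext => x; by rewrite mulr1.
by move/addIr.
Qed.

End Riesz.

(** * The large sieve estimate *)

Section LargeSieve.
Context {R : realType}.
Notation mu := (@lebesgue_measure R).

Lemma harmonic_ln (n : nat) : \sum_(0 <= e < n.+1) e.+1%:R^-1 <= 1 + ln n.+1%:R :> R.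
Proof.
elim: n => [|n IH]; first by rewrite big_nat1 invr1 ln1 addr0.
rewrite big_nat_recr//= -lerBrDr; apply: le_trans IH _.
rewrite -addrA lerD2l lerBrDr -lerBrDl -ln_div ?posrE//.
rewrite -[leLHS]opprK -lerN2 opprK -lnV ?posrE ?divr_gt0// invf_div.
have -> : n.+1%:R / n.+2%:R = 1 + (- n.+2%:R^-1) :> R.
  by rewrite -[X in X / _](addrK 1) natr1 mulrBl divff ?pnatr_eq0// mul1r.
by apply: le_ln1Dx; rewrite ltrN2 invf_lt1// ltr1n.
Qed.

Definition distn_nat (i j : nat) := ((i - j) + (j - i))%N.

Lemma distn_natC i j : distn_nat i j = distn_nat j i.
Proof. exact: addnC. Qed.

(** A given distance from [i] is attained at most twice, once on each side. *)
Lemma sum_dist_le (g : nat -> R) (i J : nat) : (forall d, 0 <= g d) -> (i < J)%N ->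
  \sum_(j < J) g (distn_nat i j) <= 2 * \sum_(d < J) g d.
Proof.
move=> g0 iJ.
rewrite -(big_mkord xpredT g) -(big_mkord xpredT (fun j => g (distn_nat i j))).
have mono (n : nat) : (n <= J)%N -> \sum_(0 <= j < n) g j <= \sum_(0 <= j < J) g j.
  by move=> nJ; rewrite (big_cat_nat (leq0n n) nJ)/= lerDl sumr_ge0.
rewrite mulr_natl mulr2n (big_cat_nat (leq0n i) (ltnW iJ))/=; apply: lerD.
  apply: le_trans (mono i.+1 iJ); rewrite big_nat_recl//= big_nat_rev/= add0n.
  rewrite -[leLHS]add0r lerD// !big_nat le_eqVlt; apply/orP; left; apply/eqP.
  apply: eq_bigr => j /andP[_ ji]; congr g; rewrite /distn_nat subKn//.
  by rewrite (eqP (leq_subr j.+1 i)) addn0.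
apply: le_trans (mono (J - i)%N (leq_subr _ _)).
rewrite -[X in \sum_(X <= _ < _) _]add0n big_addn le_eqVlt; apply/orP; left; apply/eqP.
apply: eq_bigr => j _; congr g; rewrite /distn_nat addnK.
by rewrite (eqP (leq_addl j i)) add0n.
Qed.

Lemma Rintegral_sum (I : Type) (s : seq I) (P : pred I) (g : I -> R -> R) (Y : R) :
  (forall i, bounded_measurable (g i)) ->
  bounded_measurable (fun y => \sum_(i <- s | P i) g i y) /\
  \int[mu]_(y in `[0, Y]) (\sum_(i <- s | P i) g i y) =
    \sum_(i <- s | P i) \int[mu]_(y in `[0, Y]) g i y.
Proof.
move=> bg; elim: s => [|i s [bs IH]].
  under eq_fun do rewrite big_nil; rewrite big_nil.
  by split; [exact: bounded_measurable_cst|rewrite Rintegral_cst// mul0r].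
have -> : (fun y => \sum_(j <- i :: s | P j) g j y) =
    (fun y => (P i)%:R * g i y + \sum_(j <- s | P j) g j y).
  by apply/funext => y; rewrite big_cons; case: ifP => _; rewrite ?mul1r// mul0r add0r.
have bi := bounded_measurableZ (P i)%:R (bg i).
split; first exact: bounded_measurableD.
rewrite RintegralD//; [|exact: bounded_measurable_integrable..].
rewrite RintegralZl//; last exact: bounded_measurable_integrable.
by rewrite IH big_cons; case: ifP => _; rewrite ?mul1r// mul0r add0r.
Qed.

Lemma Rintegral_cos_bound (w s Y : R) : 0 < Y ->
  `|\int[mu]_(y in `[0, Y]) cos (w * y + s)| <= Y /\
  (w != 0 -> `|\int[mu]_(y in `[0, Y]) cos (w * y + s)| <= 2 / `|w|).
Proof.
move=> Y0; split => [|w0].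
  have := @avg_bound _ _ 1 Y (bounded_measurable_cos w s) Y0 (fun y _ => cos_max _).
  by rewrite /avg normrM normfV (gtr0_norm Y0) ler_pdivrMl// mulr1.
rewrite Rintegral_cos// normrM normfV ler_pM2r ?invr_gt0 ?normr_gt0//.
by rewrite (le_trans (ler_normB _ _))// (natrD _ 1 1) lerD// sin_max.
Qed.

Section Sieve.
Variables (lam p q : nat -> R) (K : nat) (P : pred nat) (Y : R).
Hypothesis Y1 : 1 <= Y.
Let Y0 : 0 < Y := lt_le_trans ltr01 Y1.
Let b n := Num.sqrt (p n ^+ 2 + q n ^+ 2).
Let b0 n : 0 <= b n := sqrtr_ge0 _.

Let pb n : `|p n| <= b n.
Proof. by rewrite -sqrtr_sqr ler_sqrt ?addr_ge0 ?sqr_ge0// lerDl sqr_ge0. Qed.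

Let qb n : `|q n| <= b n.
Proof. by rewrite -sqrtr_sqr ler_sqrt ?addr_ge0 ?sqr_ge0// lerDr sqr_ge0. Qed.

Let S y := \sum_(n < K | P n) (p n * cos (lam n * y) - q n * sin (lam n * y)).
Let D y := \sum_(n < K | P n) (p n * sin (lam n * y) + q n * cos (lam n * y)).

(** The real part of [(p m + i q m) * conj (p n + i q n) * exp (i (lam m - lam n) y)], with the sine
    written as a shifted cosine so that one integral bound serves both summands. *)
Let term (m n : nat) y :=
  (p m * p n + q m * q n) * cos ((lam m - lam n) * y + 0) +
  (q m * p n - p m * q n) * cos ((lam m - lam n) * y + pi / 2).

Let bterm m n : bounded_measurable (term m n).
Proof.
apply: bounded_measurableD; apply: bounded_measurableZ; exact: bounded_measurable_cos.
Qed.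

Let S_bounded : bounded_measurable S.
Proof.
have H n : bounded_measurable (fun y => p n * cos (lam n * y) - q n * sin (lam n * y)).
  rewrite (_ : (fun _ => _) = fun y => p n * cos (lam n * y + 0) + q n * cos (lam n * y + pi / 2)).
    by apply: bounded_measurableD; apply: bounded_measurableZ; exact: bounded_measurable_cos.
  by apply/funext => y; rewrite cosDpihalf addr0 mulrN.
exact: (Rintegral_sum (index_enum 'I_K) (fun n : 'I_K => P n) 0
   (fun n : 'I_K => H n)).1.
Qed.

(* [D] completes [S] to the modulus of [\sum_n (p n + i q n) e^(i lam n y)]. *)
Let S_sqr y : S y ^+ 2 <= \sum_(m < K | P m) \sum_(n < K | P n) term m n y.
Proof.
apply: (@le_trans _ _ (S y ^+ 2 + D y ^+ 2)); first by rewrite lerDl sqr_ge0.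
rewrite le_eqVlt; apply/orP; left; apply/eqP.
rewrite !expr2 /S /D !mulr_suml -big_split; apply: eq_bigr => m _ /=.
rewrite !mulr_sumr -big_split; apply: eq_bigr => n _ /=.
rewrite /term cosDpihalf addr0 (_ : (lam m - lam n) * y = lam m * y - lam n * y); last exact: mulrBl.
by rewrite cosB sinB; ring.
Qed.

(** The kernel is left abstract so that it can later be taken as a function of the distance between
    blocks, which is what Schur's test requires. *)
Variable kap : nat -> nat -> R.
Hypothesis kapY : forall m n, Y <= kap m n \/ (lam m != lam n /\ 2 / `|lam m - lam n| <= kap m n).

Lemma sieve_pairs : \int[mu]_(y in `[0, Y]) (S y ^+ 2) <=
  4 * \sum_(m < K | P m) \sum_(n < K | P n) (b m * b n * kap m n).
Proof.
have [bin intE] := Rintegral_sum (index_enum 'I_K) (fun n : 'I_K => P n) Y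
  (fun m : 'I_K => (Rintegral_sum (index_enum 'I_K) (fun n : 'I_K => P n) 0
     (fun n : 'I_K => bterm m n)).1).
apply: (@le_trans _ _ (\int[mu]_(y in `[0, Y])
    \sum_(m < K | P m) \sum_(n < K | P n) term m n y)).
  apply: le_Rintegral => //; try exact: bounded_measurable_integrable.
  rewrite (_ : _ \o _ = EFin \o (fun y => S y * S y)).
    exact: bounded_measurable_integrable (bounded_measurableM S_bounded S_bounded).
  by apply/funext => y /=; rewrite expr2.
rewrite intE mulr_sumr; apply: ler_sum => m _.
have [_ ->] := Rintegral_sum (index_enum 'I_K) (fun n : 'I_K => P n) Y (fun n : 'I_K => bterm m n).
rewrite mulr_sumr; apply: ler_sum => n _; rewrite /term.
have bc (s : R) := bounded_measurable_cos (lam m - lam n) s.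
rewrite RintegralD//; [|exact: (bounded_measurable_integrable _ _ (bounded_measurableZ _ (bc _)))..].
rewrite !RintegralZl//; [|exact: (bounded_measurable_integrable _ _ (bc _))..].
have ck (s : R) : `|\int[mu]_(y in `[0, Y]) cos ((lam m - lam n) * y + s)| <= kap m n.
  have [h1 h2] := Rintegral_cos_bound (lam m - lam n) s Y0.
  have [/(le_trans h1)//|[mn]] := kapY m n.
  by apply: le_trans; apply: h2; rewrite subr_eq0.
have k0 : 0 <= kap m n := le_trans (normr_ge0 _) (ck 0).
have bb (x y : R) : `|x| <= 2 * (b m * b n) -> `|y| <= kap m n -> x * y <= 2 * (b m * b n) * kap m n.
  by move=> hx hy; rewrite (le_trans (ler_norm _))// normrM ler_pM.
(* The factor 4 counts two cosine integrals, each with a coefficient at most [2 * (b m * b n)]. *)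
rewrite (_ : 4 * _ = 2 * (b m * b n) * kap m n + 2 * (b m * b n) * kap m n); last by ring.
apply: lerD; apply: bb => //; rewrite mulr_natl mulr2n.
  by rewrite (le_trans (ler_normD _ _))// lerD// normrM ler_pM.
by rewrite (le_trans (ler_normB _ _))// lerD// normrM ler_pM.
Qed.

End Sieve.
End LargeSieve.

(** * Mean square of the tail of a trigonometric sum *)

Section TailEstimate.
Context {R : realType}.
Notation mu := (@lebesgue_measure R).

Lemma bounded_sums_tail (f : nat -> R) : (forall j, 0 <= f j) ->
  (exists B, forall N : nat, \sum_(0 <= j < N) f j <= B) ->
  forall e, 0 < e -> exists k : nat, forall N : nat, \sum_(k <= j < N) f j <= e.
Proof.
move=> f0 [B fB] e e0.
pose S := [set \sum_(0 <= j < N) f j | N in [set: nat]].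
have hS : has_sup S.
  by split; [exists (\sum_(0 <= j < 0) f j); exists 0%N|exists B => _ [N _ <-]].
have [_ [k _ <-] Hk] := sup_adherent e0 hS.
exists k => N; have [kN|/ltnW Nk] := leqP k N; last by rewrite big_geq// ltW.
have : \sum_(0 <= j < N) f j <= sup S by apply: ub_le_sup; [case: hS|exists N].
by rewrite (big_cat_nat (leq0n k) kN)/=; lra.
Qed.

Lemma block_index (x : R) : 0 < x -> exists j : nat, j%:R < x <= j%:R + 1.
Proof.
move=> x0; have /andP[h1 h2] := truncn_itv (ltW x0).
(* Blocks are closed on the right, whereas truncation is closed on the left: an integer [x] belongs
   to the block of index [x - 1]. *)
have [xj|xj] := eqVneq (Num.truncn x)%:R x.
  have : (0 < Num.truncn x)%N by rewrite -(ltr0n R) xj.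
  by case E : (Num.truncn x) => [//|j] _; exists j; rewrite -xj E -natr1 ltrDl ltr01 lexx.
by exists (Num.truncn x); rewrite lt_neqAle xj h1/= natr1 ltW.
Qed.

(* Schur's test: [W i * W j <= (W i ^+ 2 + W j ^+ 2) / 2] and the kernel is symmetric. *)
Lemma schur_sym (W : nat -> R) (g : nat -> R) (J : nat) (C : R) :
  (forall d, 0 <= g d) -> 2 * (\sum_(d < J) g d) <= C ->
  \sum_(i < J) \sum_(j < J) W i * W j * g (distn_nat i j) <= C * \sum_(i < J) W i ^+ 2.
Proof.
move=> g0 gC.
apply: (@le_trans _ _ (\sum_(i < J) \sum_(j < J) (W i ^+ 2 * g (distn_nat i j)))).
  have E : \sum_(i < J) \sum_(j < J) (W i ^+ 2 * g (distn_nat i j)) =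
      \sum_(i < J) \sum_(j < J) ((W i ^+ 2 + W j ^+ 2) / 2 * g (distn_nat i j)).
    apply: (@mulfI _ 2); first by rewrite pnatr_eq0.
    rewrite mulr_natl mulr2n {2}exchange_big/= -big_split/= mulr_sumr; apply: eq_bigr => i _.
    rewrite -big_split mulr_sumr; apply: eq_bigr => j _ /=.
    by rewrite (distn_natC j i); field.
  rewrite E; apply: ler_sum => i _; apply: ler_sum => j _; rewrite ler_wpM2r//.
  by have := sqr_ge0 (W i - W j : R); nra.
rewrite mulr_sumr; apply: ler_sum => i _; rewrite -mulr_sumr mulrC ler_wpM2r ?sqr_ge0//.
by apply: le_trans gC; apply: sum_dist_le.
Qed.

Variables (lam : nat -> R) (r : nat -> R[i]).
Hypothesis lam_gt0 : forall n, 0 < lam n.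
Hypothesis lam_oo : lam n @[n --> \oo] --> +oo.
Hypothesis summable : block_square_summable lam r.

Let b n := cabs (r n).
Let b0 n : 0 <= b n := cabs_ge0 (r n).

Lemma trigsumE (X y : R) (K : nat) : (forall n, (K <= n)%N -> X < lam n) ->
  trigsum lam r X y = \sum_(n < K | lam n <= X)
    (complex.Re (r n) * cos (lam n * y) - complex.Im (r n) * sin (lam n * y)).
Proof.
move=> KX; apply: (@fsum_cut _ (fun n => lam n <= X)) => n /KX.
by rewrite ltNge.
Qed.

Lemma trigsumB (X Z y : R) (K : nat) : X <= Z -> (forall n, (K <= n)%N -> Z < lam n) ->
  trigsum lam r Z y - trigsum lam r X y = \sum_(n < K | X < lam n <= Z)
    (complex.Re (r n) * cos (lam n * y) - complex.Im (r n) * sin (lam n * y)).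
Proof.
move=> XZ KZ; have KX n : (K <= n)%N -> X < lam n by move=> /KZ; exact: le_lt_trans.
rewrite (trigsumE _ KZ) (trigsumE _ KX) (bigID (fun n : 'I_K => lam n <= X))/=.
rewrite (eq_bigl (fun n : 'I_K => lam n <= X)); last first.
  by move=> n; case: (leP (lam n) X) => h; rewrite ?andbF// (le_trans h XZ).
rewrite addrC addrK; apply: eq_bigl => n; rewrite -ltNge; exact: andbC.
Qed.

(* A pair of frequencies in blocks at distance [d >= 2] contributes at most
   [2 / (d - 1)], and there are about [expR Y] blocks: the harmonic sum loses a
   factor of order [Y] only, which is the normalization. *)
Lemma trigsum_tail (e : R) : 0 < e -> exists X1, forall X Y, X1 <= X -> 1 <= Y ->
  X <= expR Y ->
  \int[mu]_(y in `[0, Y]) ((trigsum lam r (expR Y) y - trigsum lam r X y) ^+ 2) <= e * Y.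
Proof.
(* 48 is the 4 of [sieve_pairs] times the 12 of the kernel sum [gsum] below. *)
move=> e0; have e48 : 0 < e / 48 by rewrite divr_gt0.
have [k kP] := bounded_sums_tail (fun j => sqr_ge0 (block lam r j)) summable e48.
exists k%:R => X Y kX Y1 XY; have Y0 : 0 < Y := lt_le_trans ltr01 Y1.
have [K KY] := frequency_cut lam_oo (expR Y).
have /choice[idx idxP] n := block_index (lam_gt0 n).
have [N NE] : exists N, Num.truncn (expR Y) = N.+1.
  have : 1 <= expR Y by rewrite -expR0 ler_expR ltW.
  by rewrite -truncn_gt0; case: (Num.truncn _) => // N _; exists N.
have /andP[NY YN] : N.+1%:R <= expR Y < N.+2%:R by rewrite -NE truncn_itv// expR_ge0.
pose P n := X < lam n <= expR Y.
(* Frequencies in equal or adjacent blocks can be arbitrarily close, so only the trivial bound [Y]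
   is available; at distance [d >= 2] they are more than [d - 1] apart. *)
pose g d : R := if (d <= 1)%N then Y else 2 / d.-1%:R.
have g0 d : 0 <= g d by rewrite /g; case: ifP => _; rewrite ?(ltW Y0)// divr_ge0.
pose kap m n := g (distn_nat (idx m) (idx n)).
have kapY m n : Y <= kap m n \/ (lam m != lam n /\ 2 / `|lam m - lam n| <= kap m n).
  rewrite /kap /g; case: leqP => d1; first by left.
  right; set d := distn_nat _ _ in d1 *.
  have d1' : (0 : R) < d.-1%:R by rewrite ltr0n; case: d d1 => [|[]].
  have H : d.-1%:R < `|lam m - lam n|.
    have /andP[m1 m2] := idxP m; have /andP[n1 n2] := idxP n.
    have [ij|/ltnW ji] := leqP (idx m) (idx n).
      rewrite distrC; apply: lt_le_trans (ler_norm _).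
      have dE : d = (idx n - idx m)%N by rewrite /d /distn_nat (eqP ij).
      have : d.-1%:R + 1 + (idx m)%:R = (idx n)%:R :> R.
        by rewrite natr1 prednK 1?ltnW// -natrD dE subnK.
      by move=> H; lra.
    apply: lt_le_trans (ler_norm _).
    have dE : d = (idx m - idx n)%N by rewrite /d /distn_nat (eqP ji) addn0.
    have : d.-1%:R + 1 + (idx n)%:R = (idx m)%:R :> R.
      by rewrite natr1 prednK 1?ltnW// -natrD dE subnK.
    by move=> H; lra.
  split; first by rewrite -subr_eq0 -normr_gt0 (lt_trans d1').
  by rewrite ler_pM2l// lef_pV2 ?posrE// ?ltW// (lt_trans d1').
under eq_Rintegral do rewrite (trigsumB _ XY KY).
apply: le_trans (sieve_pairs (fun n => complex.Re (r n)) (fun n => complex.Im (r n)) K P Y1 kapY) _.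
have bE n : Num.sqrt (complex.Re (r n) ^+ 2 + complex.Im (r n) ^+ 2) = b n.
  by rewrite /b /cabs; case: (r n).
rewrite (eq_bigr (fun m : 'I_K => \sum_(n < K | P n) b m * b n * kap m n)); last first.
  by move=> m _; apply: eq_bigr => n _; rewrite !bE.
(* Large enough for every block met below [expR Y < N.+2], and such that removing the distances 0
   and 1 leaves exactly the harmonic sum with [N.+1] terms. *)
pose J := N.+3.
have idxJ n : P n -> (idx n < J)%N.
  move=> /andP[_ nY]; have /andP[n1 _] := idxP n.
  by apply: (@ltn_trans N.+2) => //; rewrite -(ltr_nat R) (lt_trans n1)// (le_lt_trans nY).
pose W (i : nat) := \sum_(n < K | P n && (idx n == i)) b n.
have W0 i : 0 <= W i by exact: sumr_ge0.
have part (h : nat -> R) : \sum_(n < K | P n) b n * h (idx n) = \sum_(j < J) W j * h j.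
  rewrite (partition_big (fun n : 'I_K => inord (idx n) : 'I_J) xpredT)//=.
  apply: eq_bigr => j _; rewrite mulr_suml; apply: eq_big => n.
    case: (boolP (P n)) => //= Pn; rewrite -val_eqE/= inordK//; exact: idxJ.
  by move=> /andP[Pn /eqP <-]; rewrite inordK//; exact: idxJ.
have -> : \sum_(m < K | P m) \sum_(n < K | P n) (b m * b n * kap m n) =
    \sum_(i < J) \sum_(j < J) W i * W j * g (distn_nat i j).
  transitivity (\sum_(m < K | P m) b m * \sum_(j < J) W j * g (distn_nat (idx m) j)).
    apply: eq_bigr => m _; rewrite -(part (fun j => g (distn_nat (idx m) j))) mulr_sumr.
    by apply: eq_bigr => n _; rewrite mulrA.
  rewrite (part (fun i => \sum_(j < J) W j * g (distn_nat i j))).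
  by apply: eq_bigr => i _; rewrite mulr_sumr; apply: eq_bigr => j _; rewrite mulrA.
(* Distances 0 and 1 give [2 * Y], the others at most [2 * (1 + ln N.+1) <= 2 + 2 * Y]; then
   [2 * (4 * Y + 2) <= 12 * Y] since [1 <= Y]. *)
have gsum : 2 * (\sum_(d < J) g d) <= 12 * Y.
  rewrite 2!big_ord_recl/= /g/= /bump/=.
  have := @harmonic_ln R N; rewrite big_mkord => hN.
  have lY : ln N.+1%:R <= Y by rewrite -[leRHS]expRK ler_ln ?posrE ?expR_gt0.
  rewrite (eq_bigr (fun d : 'I_N.+1 => 2 * d.+1%:R^-1)) -?mulr_sumr//.
  by move: hN lY; set H := \sum_(i < N.+1) _; lra.
apply: le_trans (ler_wpM2l _ (schur_sym W g0 gsum)) _ => //.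
have Wblock i : W i <= block lam r i.
  have [K' K'i] := frequency_cut lam_oo (i%:R + 1).
  rewrite /block (@wsumE _ lam _ _ _ (maxn K K')); last first.
    by move=> n; rewrite geq_max => /andP[_ /K'i].
  rewrite /W (big_ord_widen_cond (maxn K K') (fun n => P n && (idx n == i)) b (leq_maxl _ _)).
  rewrite big_mkcond [leRHS]big_mkcond; apply: ler_sum => n _.
  case: ifPn => [/andP[/andP[Pn /eqP ni] _]|_]; last by case: ifP => // _; exact: b0.
  by rewrite -ni idxP.
(* As [X >= k], no frequency beyond [X] lies in a block of index below [k]; the square sum of [W] is
   thus bounded by the small tail. *)
have Wk i : (i < k)%N -> W i = 0.
  move=> ik; apply: big1 => n /andP[/andP[Xn _] /eqP ni].
  have /andP[_] := idxP n; rewrite ni => /(lt_le_trans Xn).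
  by rewrite natr1 => /(le_lt_trans kX); rewrite ltr_nat ltnNge ik.
have WJ : \sum_(i < J) W i ^+ 2 <= e / 48.
  apply: le_trans (kP J).
  rewrite -(big_mkord xpredT (fun i => W i ^+ 2)).
  have [kJ|/ltnW Jk] := leqP k J; last first.
    rewrite [leRHS]big_geq// big_nat big1// => i /andP[_ iJ].
    by rewrite Wk ?expr0n// (leq_trans iJ).
  rewrite (big_cat_nat (leq0n k) kJ)/= big_nat big1 => [|i /andP[_ ik]]; last first.
    by rewrite Wk ?expr0n.
  rewrite add0r; apply: ler_sum => i _.
  by rewrite lerXn2r ?nnegrE ?block_ge0.
rewrite mulrA (_ : e * Y = 4 * (12 * Y) * (e / 48)); last by field.
by rewrite ler_wpM2l// !mulr_ge0// ltW.
Qed.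

End TailEstimate.

(** * Upper bounds for integrals of nonnegative functions *)

Section IntegralBounds.
Context {R : realType}.
Notation mu := (@lebesgue_measure R).
Implicit Types (f g : R -> R) (Y a b k : R).

Definition integral_le f Y a := (\int[mu]_(y in `[0%R, Y]) (f y)%:E <= a%:E)%E.

Definition nonneg_measurable f := measurable_fun [set: R] f /\ forall y, 0 <= f y.

Lemma nonneg_measurableD f g : nonneg_measurable f -> nonneg_measurable g ->
  nonneg_measurable (fun y => f y + g y).
Proof.
by move=> [mf f0] [mg g0]; split; [exact: measurable_funD|move=> y; rewrite addr_ge0].
Qed.

Lemma nonneg_measurableZ k f : 0 <= k -> nonneg_measurable f ->
  nonneg_measurable (fun y => k * f y).
Proof.
by move=> k0 [mf f0]; split; [exact: measurable_funM|move=> y; rewrite mulr_ge0].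
Qed.

Lemma nonneg_measurable_cst k : 0 <= k -> nonneg_measurable (fun=> k).
Proof. by move=> k0; split. Qed.

Lemma nonneg_measurable_sqr f : measurable_fun [set: R] f ->
  nonneg_measurable (fun y => f y ^+ 2).
Proof. by move=> mf; split; [exact: measurable_funX|move=> y; exact: sqr_ge0]. Qed.

Let mE f Y : measurable_fun [set: R] f -> measurable_fun `[0, Y] (EFin \o f).
Proof. by move=> mf; apply/measurable_EFinP; exact: measurable_funS mf. Qed.

Lemma integral_leD f g Y a b : nonneg_measurable f -> nonneg_measurable g ->
  integral_le f Y a -> integral_le g Y b -> integral_le (fun y => f y + g y) Y (a + b).
Proof.
move=> [mf f0] [mg g0] fa gb; rewrite /integral_le.
under eq_integral do rewrite EFinD.
rewrite ge0_integralD//; first by rewrite EFinD; exact: leeD.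
- by move=> y _; rewrite lee_fin.
- exact: mE.
- by move=> y _; rewrite lee_fin.
- exact: mE.
Qed.

Lemma integral_leZ k f Y a : 0 <= k -> nonneg_measurable f ->
  integral_le f Y a -> integral_le (fun y => k * f y) Y (k * a).
Proof.
move=> k0 [mf f0] fa; rewrite /integral_le; under eq_integral do rewrite EFinM.
rewrite ge0_integralZl_EFin//.
- by rewrite EFinM lee_wpmul2l// lee_fin.
- by move=> y _; rewrite lee_fin.
- exact: mE.
Qed.

Lemma le_integral_le f g Y a : nonneg_measurable f -> nonneg_measurable g ->
  (forall y, 0 <= y <= Y -> f y <= g y) -> integral_le g Y a -> integral_le f Y a.
Proof.
move=> [mf f0] [mg g0] fg; apply: le_trans; apply: ge0_le_integral => //.
- by move=> y _; rewrite lee_fin.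
- exact: mE.
- exact: mE.
Qed.

Lemma integral_le_cst k Y : 0 <= Y -> integral_le (fun=> k) Y (k * Y).
Proof.
move=> Y0; rewrite /integral_le (@integral_cst _ _ _ mu `[0, Y]%classic _ k%:E)//=.
by rewrite lebesgue_itv0.
Qed.

Lemma integral_le_Rintegral f Y a : bounded_measurable f ->
  \int[mu]_(y in `[0, Y]) f y <= a -> integral_le f Y a.
Proof.
move=> bf; rewrite /integral_le -lee_fin /Rintegral fineK//.
apply: integrable_fin_num => //; exact: bounded_measurable_integrable.
Qed.

Lemma le_integral_le_bound f Y a b : a <= b -> integral_le f Y a -> integral_le f Y b.
Proof. by move=> ab /le_trans; apply; rewrite lee_fin. Qed.

End IntegralBounds.

(** * Mean-square approximation by trigonometric polynomials *)

Section QuadraticApproximation.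
Context {R : realType}.
Notation mu := (@lebesgue_measure R).

(** Measurability of [phi] is given only from [y0] on; zeroing it before produces a measurable
    function on the whole line. *)
Definition cut (y0 : R) (phi : R -> R) (y : R) : R := if y0 <= y then phi y else 0.

Lemma patch_itv_infty (T : Type) (d f : R -> T) (y0 y : R) :
  patch d `[y0, +oo[ f y = if y0 <= y then f y else d y.
Proof.
rewrite /patch; case: ifPn => h.
  by move: h; rewrite inE/= in_itv/= andbT => ->.
by move: h; rewrite notin_setE/= in_itv/= andbT => /negP/negbTE ->.
Qed.

Lemma measurable_cut (y0 : R) (phi : R -> R) : measurable_fun `[y0, +oo[ phi ->
  measurable_fun [set: R] (cut y0 phi).
Proof.
move=> mphi; rewrite (_ : cut y0 phi = phi \_ `[y0, +oo[).
  by apply/(measurable_restrictT _ _).1.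
by apply/funext => y; rewrite patch_itv_infty.
Qed.

Variables (phi : R -> R) (lam : nat -> R) (r : nat -> R[i]) (c y0 X0 : R) (E : R -> R -> R).
Hypothesis lam_gt0 : forall n, 0 < lam n.
Hypothesis lam_oo : lam n @[n --> \oo] --> +oo.
Hypothesis summable : block_square_summable lam r.
Hypothesis y0_ge0 : 0 <= y0.
Hypothesis mphi : measurable_fun `[y0, +oo[ phi.
Hypothesis phiE : forall y X, y0 <= y -> X0 <= X ->
  phi y = c + trigsum lam r X y + E y X.
Hypothesis E_small : (fun Y : R => ((Y^-1)%:E *
  \int[mu]_(y in `[y0, Y]) ((E y (expR Y)) ^+ 2)%:E)%E) @ +oo%R --> 0%E.

Lemma trigsum_bounded_measurable (X : R) : bounded_measurable (trigsum lam r X).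
Proof.
have [K KX] := frequency_cut lam_oo X.
pose g n y := complex.Re (r n) * cos (lam n * y + 0) + complex.Im (r n) * cos (lam n * y + pi / 2).
have bg (n : 'I_K) : bounded_measurable (g n).
  by apply: bounded_measurableD; apply: bounded_measurableZ; exact: bounded_measurable_cos.
have := (Rintegral_sum (index_enum 'I_K) (fun n : 'I_K => lam n <= X) 0 bg).1.
congr bounded_measurable; apply/funext => y; rewrite (trigsumE r _ KX).
by apply: eq_bigr => n _; rewrite /g cosDpihalf addr0 mulrN.
Qed.

(** Beyond [y0] the deviation is [T y], the terms between [X] and [expR Y], plus the error at cutoff
    [expR Y]; each has mean square at most [e / 8], doubled by the square of a sum. Before [y0] it
    is at most [B], and [B ^+ 2 * y0] becomes negligible against [Y]. *)
Lemma quadratic_approximation (e : R) : 0 < e -> exists X1, forall X, X1 <= X ->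
  mean_le (fun y => (cut y0 phi y - (c + trigsum lam r X y)) ^+ 2) e.
Proof.
move=> e0; have e8 : 0 < e / 8 by rewrite divr_gt0.
have [X1 X1P] := trigsum_tail lam_gt0 lam_oo summable e8.
exists X1 => X XX1.
have bP : bounded_measurable (fun y => c + trigsum lam r X y).
  by apply: bounded_measurableD; [exact: bounded_measurable_cst|exact: trigsum_bounded_measurable].
have [mP [B PB]] := bP; have B0 : 0 <= B by apply: le_trans (PB 0).
have mcut := measurable_cut mphi.
near=> Y.
have Y0 : 0 < Y by [].
have Y1 : 1 <= Y by near: Y; apply: nbhs_pinfty_ge; exact: num_real.
have yY : y0 <= Y by near: Y; apply: nbhs_pinfty_ge; exact: num_real.
have expY (Z : R) : ln (Num.max Z 1) <= Y -> Z <= expR Y.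
  rewrite -ler_expR lnK ?posrE ?lt_max ?ltr01 ?orbT//.
  by apply: le_trans; rewrite le_max lexx.
have XY : X <= expR Y by apply: expY; near: Y; apply: nbhs_pinfty_ge; exact: num_real.
have X0Y : X0 <= expR Y by apply: expY; near: Y; apply: nbhs_pinfty_ge; exact: num_real.
pose T y := trigsum lam r (expR Y) y - trigsum lam r X y.
have bT : bounded_measurable T.
  by apply: bounded_measurableB; exact: trigsum_bounded_measurable.
(* A measurable stand-in for the error [E y (expR Y)], whose own measurability is not given; the two
   agree for [y >= y0]. *)
pose E' := cut y0 (fun y => cut y0 phi y - (c + trigsum lam r (expR Y) y)).
have mE' : measurable_fun [set: R] E'.
  apply: measurable_cut; apply: measurable_funS (_ : measurable_fun setT _) => //.
  apply: measurable_funB => //; apply: measurable_funD => //.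
  exact: (trigsum_bounded_measurable _).1.
pose I := \1_(`[0, y0] : set R) : R -> R.
have nI : nonneg_measurable I.
  by split; [exact: measurable_indic|move=> y; rewrite /I indicE].
have iT : integral_le (fun y => T y ^+ 2) Y (e / 8 * Y).
  apply: integral_le_Rintegral; last exact: X1P.
  rewrite (_ : (fun _ => _) = fun y => T y * T y); first exact: bounded_measurableM.
  by apply/funext => y; rewrite expr2.
have iI : integral_le I Y y0.
  rewrite /integral_le integral_indic// setIidl; last first.
    by move=> y /=; rewrite !in_itv/= => /andP[-> /le_trans]; apply.
  by rewrite /= lebesgue_itv0.
have iE : integral_le (fun y => E' y ^+ 2) Y (e / 8 * Y).
  have EY : (((Y^-1)%:E * \int[mu]_(y in `[y0, Y]) ((E y (expR Y)) ^+ 2)%:E) < (e / 8)%:E)%E.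
    near: Y; apply: (E_small (t := [set x | (x < (e / 8)%:E)%E])).
    by apply: open_ereal_lt'; rewrite lte_fin.
  move: EY => /ltW; rewrite -(@lee_pmul2l _ Y%:E)// ?lte_fin// muleA -EFinM divff ?gt_eqF// mul1e.
  rewrite -EFinM mulrC /integral_le; apply: le_trans.
  rewrite (_ : `[y0, Y]%classic = `[0, Y] `&` `[y0, +oo[); last first.
    apply/seteqP; split => y /=; rewrite !in_itv/= ?andbT.
      by move=> /andP[h1 ->]; rewrite (le_trans _ h1).
    by move=> [/andP[_ ->] ->].
  have EE' y : ((fun y => (E y (expR Y) ^+ 2)%:E) \_ `[y0, +oo[) y = (E' y ^+ 2)%:E.
    rewrite patch_itv_infty /E' /cut; case: ifPn => h; last by rewrite expr0n.
    by rewrite (phiE h X0Y) addrAC subrr add0r.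
  rewrite integral_mkcondr; apply: ge0_le_integral => //.
  - by move=> y _; rewrite lee_fin sqr_ge0.
  - by apply/measurable_EFinP; apply: measurable_funS (measurable_funX 2 mE').
  - apply: (measurable_funS (E := setT)) => //.
    rewrite (_ : _ \_ _ = fun y => (E' y ^+ 2)%:E).
      by apply/measurable_EFinP; exact: measurable_funX.
    by apply/funext => y; exact: EE'.
  - by move=> y _; rewrite EE'.
have nT := nonneg_measurable_sqr bT.1.
have nE := nonneg_measurable_sqr mE'.
have BY : B ^+ 2 * y0 <= e / 8 * Y.
  by rewrite -ler_pdivrMl//; near: Y; apply: nbhs_pinfty_ge; exact: num_real.
have nBI := nonneg_measurableZ (sqr_ge0 B) nI.
have n2T := nonneg_measurableZ (ler0n R 2) nT.
have n2E := nonneg_measurableZ (ler0n R 2) nE.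
have key : integral_le (fun y => B ^+ 2 * I y + (2 * T y ^+ 2 + 2 * E' y ^+ 2)) Y
    (B ^+ 2 * y0 + (2 * (e / 8 * Y) + 2 * (e / 8 * Y))).
  apply: integral_leD => //; first exact: nonneg_measurableD.
    by apply: integral_leZ => //; exact: sqr_ge0.
  by apply: integral_leD => //; apply: integral_leZ.
apply: (@le_integral_le_bound _ _ _ (B ^+ 2 * y0 + (2 * (e / 8 * Y) + 2 * (e / 8 * Y)))).
  by have := mulr_gt0 e0 Y0; lra.
apply: le_integral_le key.
- by apply: nonneg_measurable_sqr; exact: measurable_funB.
- by do 2 apply: nonneg_measurableD => //.
move=> y /andP[y_ge0 _]; rewrite /E' /cut.
case: (leP y0 y) => yy.
  have T0 : 0 <= B ^+ 2 * I y by case: nBI.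
  have := sqr_ge0 (T y - (phi y - (c + trigsum lam r (expR Y) y))).
  move: T0; rewrite /T; set a := trigsum _ _ _ _; set b := trigsum _ _ _ _ ; nra.
rewrite sub0r sqrrN expr0n mulr0 addr0 /I indicE mem_set/=; last first.
  by rewrite in_itv/= y_ge0 ltW.
rewrite mulr1 (@le_trans _ _ (B ^+ 2))//; last by rewrite lerDl mulr_ge0 ?sqr_ge0.
by rewrite -real_normK ?num_real// lerXn2r ?nnegrE.
Unshelve. all: by end_near. Qed.

End QuadraticApproximation.

(** * Existence of the limiting distribution *)

Section MeanLe.
Context {R : realType}.
Implicit Types (f g : R -> R) (e : R).

Lemma mean_leD f g (a b : R) : nonneg_measurable f -> nonneg_measurable g ->
  mean_le f a -> mean_le g b -> mean_le (fun y => f y + g y) (a + b).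
Proof.
move=> nf ng fa gb; rewrite /mean_le; near=> Y.
rewrite mulrDl; apply: integral_leD => //; near: Y; [exact: fa|exact: gb].
Unshelve. all: by end_near. Qed.

Lemma mean_leZ f (k a : R) : 0 <= k -> nonneg_measurable f ->
  mean_le f a -> mean_le (fun y => k * f y) (k * a).
Proof.
move=> k0 nf fa; rewrite /mean_le; near=> Y.
rewrite -mulrA; apply: integral_leZ => //; near: Y; exact: fa.
Unshelve. all: by end_near. Qed.

Lemma mean_le_cst (k : R) : mean_le (fun=> k) k.
Proof.
rewrite /mean_le; near=> Y; apply: integral_le_cst; near: Y.
by apply: nbhs_pinfty_ge; exact: num_real.
Unshelve. all: by end_near. Qed.

Lemma le_mean_le f g (a b : R) : nonneg_measurable f -> nonneg_measurable g ->
  (forall y, 0 <= y -> f y <= g y) -> a <= b -> mean_le g a -> mean_le f b.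
Proof.
move=> nf ng fg ab ga; rewrite /mean_le; near=> Y.
apply: (@le_integral_le_bound _ _ _ (a * Y)).
  rewrite ler_wpM2r//; near: Y; apply: nbhs_pinfty_ge; exact: num_real.
apply: (le_integral_le nf ng) => [y /andP[y0 _]|]; first exact: fg.
by near: Y; exact: ga.
Unshelve. all: by end_near. Qed.

Lemma nonneg_measurable_sum (n : nat) (f : 'I_n -> R -> R) :
  (forall k, nonneg_measurable (f k)) -> nonneg_measurable (fun y => \sum_k f k y).
Proof.
move=> nf; split; last by move=> y; apply: sumr_ge0 => k _; have [_] := nf k.
by apply: measurable_sum => k; have [] := nf k.
Qed.

Lemma mean_le_sum (n : nat) (f : 'I_n -> R -> R) (a : R) :
  (forall k, nonneg_measurable (f k)) -> (forall k, mean_le (f k) a) ->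
  mean_le (fun y => \sum_k f k y) (n%:R * a).
Proof.
elim: n f => [|n IH] f nf fa.
  rewrite mul0r (_ : (fun _ => _) = fun=> 0); first exact: mean_le_cst.
  by apply/funext => y; rewrite big_ord0.
rewrite -natr1 mulrDl mul1r.
rewrite (_ : (fun _ => _) = fun y => \sum_(k < n) f (widen_ord (leqnSn n) k) y + f ord_max y).
  apply: mean_leD => //; first exact: nonneg_measurable_sum.
  exact: IH.
by apply/funext => y; rewrite big_ord_recr.
Qed.

(** [g] may be very negative, while the comparison of averages bounds absolute values; hence the
    passage to the positive part. *)
Lemma avg_le_mean_le g f e : bounded_measurable g -> nonneg_measurable f ->
  (forall y, 0 <= y -> g y <= f y) -> mean_le f e ->
  \forall Y \near +oo, avg g Y <= e.
Proof.
move=> bg [mf f0] gf fe; have [mg [M gM]] := bg.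
pose g' y := Num.max (g y) 0.
have bg' : bounded_measurable g'.
  split; first exact: measurable_maxr.
  exists M => y; rewrite /g'; case: (leP (g y) 0) => _; last exact: gM.
  by rewrite normr0; apply: le_trans (gM y).
have := has_mean_near bg' (bounded_measurable_cst 0) mf fe.
have H y : 0 <= y -> `|g' y - cst 0 y| <= f y.
  move=> y0; rewrite subr0 ger0_norm /g' ?le_max ?lexx ?orbT//.
  by rewrite ge_max f0 gf.
move=> /(_ H) {}H; near=> Y.
have Y0 : 0 < Y by [].
have : `|avg g' Y - avg (cst 0) Y| <= e by near: Y.
rewrite avg_cst// subr0 => /(le_trans (ler_norm _)); apply: le_trans.
by apply: (le_avg bg bg' (ltW Y0)) => y _; rewrite /g' le_max lexx.
Unshelve. all: by end_near. Qed.

End MeanLe.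

Section LimitingDistribution.
Context {R : realType} {l : nat}.
Variables (Phi : 'I_l -> R -> R) (P : R -> 'I_l -> R -> R).
Hypothesis mPhi : forall k, measurable_fun [set: R] (Phi k).
Hypothesis cP : forall X k, continuous (P X k).
Hypothesis bP : forall X, exists B, forall k y, `|P X k y| <= B.
Hypothesis tP : forall X k, translation_totally_bounded (P X k).
Hypothesis PhiP : forall k e, 0 < e -> exists X1, forall X, X1 <= X ->
  mean_le (fun y => (Phi k y - P X k y) ^+ 2) e.

Let Q X y := \sum_k (Phi k y - P X k y) ^+ 2.
Let V y := \sum_k Phi k y ^+ 2.

Let mP X k : measurable_fun [set: R] (P X k).
Proof. exact: continuous_measurable_fun. Qed.

Let nQ X : nonneg_measurable (Q X).
Proof.
by apply: nonneg_measurable_sum => k; apply: nonneg_measurable_sqr; exact: measurable_funB.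
Qed.

Let nV : nonneg_measurable V.
Proof. by apply: nonneg_measurable_sum => k; exact: nonneg_measurable_sqr. Qed.

Let Q_small e : 0 < e -> exists X1, forall X, X1 <= X -> mean_le (Q X) e.
Proof.
(* Dividing by [l.+1] instead of [l] keeps the share of each component positive when [l = 0]. *)
move=> e0; have el : 0 < e / l.+1%:R by rewrite divr_gt0.
have /choice[X1 X1P] k := PhiP k el.
exists (\sum_k `|X1 k|) => X hX.
have H : mean_le (Q X) (l%:R * (e / l.+1%:R)).
  apply: mean_le_sum => k.
    by apply: nonneg_measurable_sqr; exact: measurable_funB.
  apply: X1P; apply: le_trans hX; rewrite (bigD1 k)//=.
  by rewrite (le_trans (ler_norm _))// lerDl sumr_ge0.
apply: le_mean_le H => //.
by rewrite mulrCA ler_piMr ?(ltW e0)// ler_pdivrMr// mul1r ler_nat.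
Qed.

(** A single approximation, with error 1, suffices because [P X] is bounded; both the modulus
    estimate and the tightness below rest on this [W], through Chebyshev's inequality. *)
Let second_moment : exists2 W, 0 <= W & mean_le V W.
Proof.
have [X H] := Q_small ltr01; have {}H := H X (lexx _).
have [B PB] := bP X.
have C0 : 0 <= 2 * (l%:R * B ^+ 2).
  by rewrite mulr_ge0// mulr_ge0// sqr_ge0.
have nC := nonneg_measurable_cst C0.
have n2Q := nonneg_measurableZ (ler0n R 2) (nQ X).
exists (2 * 1 + 2 * (l%:R * B ^+ 2)); first by rewrite addr_ge0// mulr1.
have := mean_leD n2Q nC (mean_leZ (ler0n R 2) (nQ X) H) (mean_le_cst _).
apply: le_mean_le => //; first exact: nonneg_measurableD.
move=> y _; rewrite /V /Q.
have -> : 2 * (l%:R * B ^+ 2) = \sum_(k < l) 2 * B ^+ 2.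
  by rewrite sumr_const card_ord -[RHS]mulr_natl mulrCA.
rewrite mulr_sumr -big_split; apply: ler_sum => k _ /=.
have : P X k y ^+ 2 <= B ^+ 2.
  have B0 : 0 <= B by apply: le_trans (PB k y).
  by rewrite -real_normK ?num_real// lerXn2r ?nnegrE.
(* [2 * (Phi - P) ^+ 2 + 2 * P ^+ 2 - Phi ^+ 2] is the square of [Phi - 2 * P]. *)
have := sqr_ge0 (Phi k y - 2 * P X k y); nra.
Qed.

Let row_norm_sqr (v : 'rV[R]_l) : `|v| ^+ 2 <= \sum_k v ord0 k ^+ 2.
Proof.
set s := \sum_k _; have s0 : 0 <= s by apply: sumr_ge0 => k _; exact: sqr_ge0.
rewrite -[leRHS]sqr_sqrtr// lerXn2r ?nnegrE ?sqrtr_ge0//.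
rewrite row_norm_le ?sqrtr_ge0//; apply/forallP => k.
rewrite -sqrtr_sqr ler_sqrt// /s (bigD1 k)//= lerDl sumr_ge0// => j _; exact: sqr_ge0.
Qed.

(* Uniform continuity on a large ball; outside it, or for distant points, the
   trivial bound is absorbed by a quadratic term. *)
Let quadratic_modulus (f : 'rV[R]_l -> R) e : bounded_continuous f -> 0 < e ->
  exists A C, [/\ 0 <= A, 0 <= C, (exists2 W, mean_le V W & A * W <= e) &
    forall u v, `|f u - f v| <= e + (A * `|u| ^+ 2 + C * `|u - v| ^+ 2)].
Proof.
move=> [cf [M fM]] e0; have [W W0 VW] := second_moment.
have M0 : 0 <= M by apply: le_trans (fM 0).
(* The squared radius, chosen so that [2 * M / B2 * W <= e]. *)
pose B2 := 1 + 2 * M * W / e.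
have B20 : 0 < B2 by rewrite ltr_wpDr// !mulr_ge0 ?invr_ge0 ?(ltW e0).
pose B := Num.sqrt B2.
have B0 : 0 < B by rewrite sqrtr_gt0.
have BB : B ^+ 2 = B2 by rewrite sqr_sqrtr// ltW.
have [d /andP[d0 _] dP] := continuous_unif_on_ball cf B e0.
exists (2 * M / B2), (2 * M / d ^+ 2); split.
- by rewrite !mulr_ge0 ?invr_ge0 ?(ltW B20).
- by rewrite !mulr_ge0 ?invr_ge0 ?sqr_ge0.
- exists W => //; rewrite mulrAC ler_pdivrMr// /B2 mulrDr mulr1 mulrCA divff ?gt_eqF// mulr1.
  by rewrite lerDr ltW.
move=> u v; have f2M : `|f u - f v| <= 2 * M.
  by rewrite (le_trans (ler_normB _ _))// mulr_natl mulr2n lerD.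
have A0 : 0 <= 2 * M / B2 * `|u| ^+ 2.
  by rewrite !mulr_ge0 ?sqr_ge0 ?invr_ge0 ?(ltW B20).
have C0 : 0 <= 2 * M / d ^+ 2 * `|u - v| ^+ 2.
  by rewrite !mulr_ge0 ?sqr_ge0 ?invr_ge0 ?sqr_ge0.
have [uB|Bu] := leP `|u| B; last first.
  have : 2 * M <= 2 * M / B2 * `|u| ^+ 2.
    rewrite mulrAC ler_pdivlMr// ler_wpM2l ?mulr_ge0//.
    by rewrite -BB lerXn2r ?nnegrE ?(ltW B0)//; exact: ltW.
  lra.
have [uv|uv] := leP `|u - v| d.
  by have := dP u v uB uv; lra.
have : 2 * M <= 2 * M / d ^+ 2 * `|u - v| ^+ 2.
  rewrite mulrAC ler_pdivlMr ?exprn_gt0// ler_wpM2l ?mulr_ge0//.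
  by rewrite lerXn2r ?nnegrE ?(ltW d0)//; exact: ltW.
lra.
Qed.

Let vPhi y : 'rV[R]_l := \row_k Phi k y.
Let vP X y : 'rV[R]_l := \row_k P X k y.

Let bPhi f : bounded_continuous f -> bounded_measurable (fun y => f (vPhi y)).
Proof. by move=> [cf [M fM]]; split; [exact: measurable_comp_row|exists M]. Qed.

Let bvP X f : bounded_continuous f -> bounded_measurable (fun y => f (vP X y)).
Proof. by move=> [cf [M fM]]; split; [exact: measurable_comp_row|exists M]. Qed.

Lemma mean_approximation (f : 'rV[R]_l -> R) e : bounded_continuous f -> 0 < e ->
  exists X1, forall X, X1 <= X ->
    \forall Y \near +oo, `|avg (fun y => f (vPhi y)) Y - avg (fun y => f (vP X y)) Y| <= e.
Proof.
move=> bf e0; have e3 : 0 < e / 3 by rewrite divr_gt0.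
(* [A] and [C] are fixed by [f] and [e] alone, so [X] can be chosen afterwards, large enough to
   absorb the possibly huge [C]. *)
have [A [C [A0 C0 [W VW AW] H]]] := quadratic_modulus bf e3.
have C1 : 0 < C + 1 by rewrite ltr_wpDl.
have [X1 X1P] := Q_small (divr_gt0 e3 C1).
exists X1 => X /X1P QX.
have nAV := nonneg_measurableZ A0 nV.
have nCQ := nonneg_measurableZ C0 (nQ X).
have ne : nonneg_measurable (fun=> e / 3 : R) by apply: nonneg_measurable_cst; exact: ltW.
have nAC := nonneg_measurableD nAV nCQ.
have nD := nonneg_measurableD ne nAC.
apply: (has_mean_near (bPhi bf) (bvP X bf) nD.1).
  have := mean_leD ne nAC (mean_le_cst _)
    (mean_leD nAV nCQ (mean_leZ A0 nV VW) (mean_leZ C0 (nQ X) QX)).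
  apply: le_mean_le => //.
  have : C * (e / 3 / (C + 1)) <= e / 3.
    by rewrite mulrCA ler_piMr ?(ltW e3)// ler_pdivrMr// mul1r lerDl.
  lra.
move=> y _; apply: le_trans (H _ _) _; rewrite lerD2l; apply: lerD.
  rewrite ler_wpM2l// (le_trans (row_norm_sqr _))// /V le_eqVlt; apply/orP; left; apply/eqP.
  by apply: eq_bigr => k _; rewrite mxE.
rewrite ler_wpM2l// (le_trans (row_norm_sqr _))// /Q le_eqVlt; apply/orP; left; apply/eqP.
by apply: eq_bigr => k _; rewrite !mxE.
Qed.

Lemma has_mean_comp (f : 'rV[R]_l -> R) : bounded_continuous f ->
  exists m, has_mean (fun y => f (vPhi y)) m.
Proof.
move=> bf; apply: has_mean_approx => e e0.
have [X HX] := mean_approximation bf e0.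
have [cf [M fM]] := bf.
have [|||m hm] := @translation_totally_bounded_mean _ (fun y => f (vP X y)).
- move=> y; apply: (@continuous_comp _ _ _ (vP X) f); last exact: cf.
  by apply: continuous_row; exact: cP.
- by exists M.
- exact: ttb_comp_row.
by exists (fun y => f (vP X y)), m; split => //; exact: HX.
Qed.

Lemma limiting_measure_exists : exists mu : probability (RBorel R l) R,
  forall f, bounded_continuous f -> has_mean (fun y => f (vPhi y)) (\int[mu]_x f x).
Proof.
pose L (f : 'rV[R]_l -> R) : R := lim (avg (fun y => f (vPhi y)) Y @[Y --> +oo]).
have LP f : bounded_continuous f -> has_mean (fun y => f (vPhi y)) (L f).
  by move=> /has_mean_comp[m hm]; rewrite /L (cvg_lim _ hm).
have LE f m : bounded_continuous f -> has_mean (fun y => f (vPhi y)) m -> L f = m.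
  by move=> bf; apply: has_mean_unique; exact: LP.
have LD f g : bounded_continuous f -> bounded_continuous g ->
    L (fun x => f x + g x) = L f + L g.
  move=> bf bg; apply: LE; first exact: bounded_continuousD.
  by apply: has_meanD; [exact: bPhi|exact: bPhi|exact: LP|exact: LP].
have LZ a f : bounded_continuous f -> L (fun x => a * f x) = a * L f.
  move=> bf; apply: LE; first exact: bounded_continuousZ.
  by apply: has_meanZ; [exact: bPhi|exact: LP].
have leL f g : bounded_continuous f -> bounded_continuous g ->
    (forall x, f x <= g x) -> L f <= L g.
  move=> bf bg fg.
  rewrite -(cvg_lim _ (LP f bf))// -(cvg_lim _ (LP g bg))//.
  apply: ler_lim; [exact: (cvgP _ (LP f bf))|exact: (cvgP _ (LP g bg))|].
  near=> Y; apply: le_avg; [exact: bPhi|exact: bPhi| |by move=> y _; exact: fg].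
  by near: Y; apply: nbhs_pinfty_ge; exact: num_real.
have L1 : L (fun=> 1) = 1.
  by apply: LE; [exact: bounded_continuous_cst|exact: has_mean_cst].
have Ltight (e C : R) : 0 < e -> exists B : R, forall f,
    bounded_continuous f -> (forall x, `|x| <= B -> f x <= e) ->
    (forall x, f x <= C) -> L f <= 2 * e.
  move=> e0; have [W W0 VW] := second_moment.
  (* Chebyshev: outside the ball of squared radius [B2], the constant [|C|] is at most
     [|C| / B2 * V y], of mean at most [e]. *)
  pose B2 := 1 + `|C| * W / e.
  have B20 : 0 < B2 by rewrite ltr_wpDr// !mulr_ge0 ?invr_ge0 ?(ltW e0).
  exists (Num.sqrt B2) => f bf fe fC.
  have k0 : 0 <= `|C| / B2 by rewrite mulr_ge0 ?invr_ge0 ?(ltW B20).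
  have nkV := nonneg_measurableZ k0 nV.
  have be : bounded_continuous (fun _ : 'rV[R]_l => e) by exact: bounded_continuous_cst.
  have bfe := bounded_continuousB bf be.
  have : \forall Y \near +oo, avg (fun y => f (vPhi y) - e) Y <= e.
    apply: (@avg_le_mean_le _ _ (fun y => `|C| / B2 * V y) _ (bPhi bfe) nkV).
      move=> y _; have [xB|Bx] := leP `|vPhi y| (Num.sqrt B2).
        apply: le_trans (_ : 0 <= _); first by rewrite subr_le0 fe.
        by case: nkV.
      apply: (@le_trans _ _ `|C|).
        by rewrite lerBlDr (le_trans (fC _))// (le_trans (ler_norm _))// lerDl ltW.
      rewrite mulrAC ler_pdivlMr// ler_wpM2l//.
      rewrite (_ : V y = \sum_k vPhi y ord0 k ^+ 2); last first.
        by apply: eq_bigr => k _; rewrite mxE.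
      apply: le_trans (row_norm_sqr _); rewrite -[leLHS]sqr_sqrtr ?(ltW B20)//.
      by rewrite lerXn2r ?nnegrE ?sqrtr_ge0// ltW.
    apply: le_mean_le (mean_leZ k0 nV VW) => //.
    by rewrite mulrAC ler_pdivrMr// /B2 mulrDr mulr1 mulrCA divff ?gt_eqF// mulr1 lerDr ltW.
  move=> H.
  have Le : L (fun=> e) = e.
    by apply: LE; [exact: be|exact: has_mean_cst].
  have -> : 2 * e = e + e by rewrite mulr_natl mulr2n.
  have Ef : (fun x => (f x - e) + e) = f by apply/funext => x; rewrite subrK.
  rewrite -Ef LD// Le lerD2r.
  rewrite -(cvg_lim _ (LP _ bfe))//; apply: limr_le; last exact: H.
  exact: (cvgP _ (LP _ bfe)).
have [mu muP] := riesz_representation LD LZ leL L1 Ltight.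
by exists mu => f bf; rewrite muP//; exact: LP.
Unshelve. all: by end_near. Qed.

End LimitingDistribution.

(** * Insensitivity of means to an initial segment *)

Section InitialSegment.
Context {R : realType}.
Notation mu := (@lebesgue_measure R).

(* The integral of a nonnegative function is a supremum over the simple functions
   below it, hence monotone even for nonmeasurable integrands. *)
Lemma ge0_le_integral_nonmeasurable (D : set R) (f g : R -> \bar R) :
  (forall x, D x -> 0 <= f x)%E -> (forall x, D x -> f x <= g x)%E ->
  (\int[mu]_(x in D) f x <= \int[mu]_(x in D) g x)%E.
Proof.
move=> f0 fg; rewrite !ge0_integralE//; last first.
  by move=> x Dx; apply: le_trans (f0 x Dx) (fg x Dx).
apply: le_ereal_sup => _ [h /= hf <-]; exists h => // x.
apply: le_trans (hf x) _; exact: lee_restrict.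
Qed.

(** Without measurability of [h], its integral is squeezed between those of [h' - h' * I] and
    [h' + M * I], which are measurable and within [M * y1] of the integral of [h']. *)
Lemma integral_modification (h h' : R -> R) (M y1 Y : R) : 0 <= y1 -> y1 <= Y ->
  (forall y, 0 <= h y <= M) -> (forall y, 0 <= h' y <= M) ->
  measurable_fun [set: R] h' -> (forall y, y1 <= y -> h y = h' y) ->
  exists2 I : R, (\int[mu]_(y in `[0%R, Y]) (h y)%:E = I%:E)%E &
    `|I - \int[mu]_(y in `[0, Y]) h' y| <= M * y1.
Proof.
move=> y10 y1Y hM h'M mh' hh'.
have bI : bounded_measurable (\1_(`[0, y1] : set R) : R -> R).
  split; first exact: measurable_indic.
  by exists 1 => x; rewrite indicE; case: (_ \in _); rewrite ?normr1 ?normr0.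
pose I := \1_(`[0, y1] : set R) : R -> R.
have intI : \int[mu]_(y in `[0, Y]) I y = y1.
  rewrite /Rintegral integral_indic// setIidl; last first.
    by move=> y /=; rewrite !in_itv/= => /andP[-> /le_trans]; apply.
  by rewrite /= lebesgue_itv0.
have b' : bounded_measurable h'.
  by split => //; exists M => x; have /andP[h0 h1] := h'M x; rewrite ger0_norm.
have bMI := bounded_measurableZ M bI.
have II y : 0 <= I y <= 1 by rewrite /I indicE; case: (_ \in _); rewrite ?lexx ?ler01.
have I1 y : 0 <= y -> y < y1 -> I y = 1.
  by move=> y0 yy; rewrite /I indicE mem_set//= in_itv/= y0 ltW.
have fin (k : R -> R) : bounded_measurable k ->
    (\int[mu]_(y in `[0%R, Y]) (k y)%:E)%E = (\int[mu]_(y in `[0, Y]) k y)%:E.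
  move=> bk; rewrite /Rintegral fineK//; apply: integrable_fin_num => //.
  exact: bounded_measurable_integrable.
have up : (\int[mu]_(y in `[0%R, Y]) (h y)%:E <= (\int[mu]_(y in `[0, Y]) h' y + M * y1)%:E)%E.
  apply: (@le_trans _ _ (\int[mu]_(y in `[0%R, Y]) (h' y + M * I y)%:E)%E).
    apply: ge0_le_integral_nonmeasurable => y /=; rewrite in_itv/= => /andP[y0 _].
      by rewrite lee_fin; case/andP: (hM y).
    rewrite lee_fin; have /andP[h0 h1] := hM y; have /andP[h'0 h'1] := h'M y.
    have M0 : 0 <= M := le_trans h0 h1.
    have [yy|yy] := leP y1 y.
      by rewrite hh'// lerDl mulr_ge0//; case/andP: (II y).
    by rewrite I1// mulr1 (le_trans h1)// lerDr.
  rewrite (fin (fun y => h' y + M * I y)); last exact: bounded_measurableD.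
  rewrite lee_fin RintegralD//; [|exact: bounded_measurable_integrable..].
  by rewrite RintegralZl ?intI//; exact: bounded_measurable_integrable.
have low : ((\int[mu]_(y in `[0, Y]) h' y - M * y1)%:E <= \int[mu]_(y in `[0%R, Y]) (h y)%:E)%E.
  have bk : bounded_measurable (fun y => h' y - h' y * I y).
    by apply: bounded_measurableB => //; exact: bounded_measurableM.
  apply: (@le_trans _ _ (\int[mu]_(y in `[0%R, Y]) (h' y - h' y * I y)%:E)%E).
    rewrite fin// lee_fin -{1}intI -RintegralZl//; last exact: bounded_measurable_integrable.
    rewrite -RintegralB//; [|exact: bounded_measurable_integrable..].
    apply: le_Rintegral => //; [| |].
    - by apply: bounded_measurable_integrable; exact: bounded_measurableB.
    - exact: bounded_measurable_integrable.
    - move=> y _; have /andP[_ h'1] := h'M y; have /andP[i0 _] := II y.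
      by rewrite lerD2l lerN2 ler_wpM2r.
  apply: ge0_le_integral_nonmeasurable => y /=; rewrite in_itv/= => /andP[y0 _];
    rewrite lee_fin; have /andP[h'0 h'1] := h'M y; have /andP[i0 i1] := II y.
    by rewrite subr_ge0 ler_piMr.
  have /andP[h0 h1] := hM y.
  have [yy|yy] := leP y1 y; first by rewrite hh'// gerBl mulr_ge0.
  by rewrite I1// mulr1 subrr.
case: (\int[mu]_(y in `[0%R, Y]) (h y)%:E)%E up low => [i| |]//.
by rewrite !lee_fin => up low; exists i => //; rewrite ler_distl low up.
Qed.

(** The integral of a signed function is by definition the difference of those of its positive and
    negative parts, measurable or not. Each part changes by at most [M * y1], a quantity that
    division by [Y] kills. *)
Lemma cvg_mean_modification (g g' : R -> R) (M y1 m : R) : 0 <= y1 ->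
  (forall y, `|g y| <= M) -> (forall y, `|g' y| <= M) ->
  measurable_fun [set: R] g' -> (forall y, y1 <= y -> g y = g' y) ->
  has_mean g' m ->
  (fun Y : R => ((Y^-1)%:E * \int[mu]_(y in `[0%R, Y]) (g y)%:E)%E) @ +oo%R --> m%:E.
Proof.
move=> y10 gM g'M mg' gg' hm.
have pos (k : R -> R) : (forall y, `|k y| <= M) -> forall y, 0 <= Num.max (k y) 0 <= M.
  move=> kM y; rewrite le_max lexx orbT/= ge_max (le_trans (normr_ge0 _) (kM y)) andbT.
  exact: le_trans (ler_norm _) (kM y).
have neg (k : R -> R) : (forall y, `|k y| <= M) -> forall y, 0 <= Num.max (- k y) 0 <= M.
  by move=> kM; apply: (pos (fun y => - k y)) => y; rewrite normrN.
pose a Y := fine (\int[mu]_(y in `[0%R, Y]) (g y)%:E)%E.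
have H Y : y1 <= Y -> ((\int[mu]_(y in `[0%R, Y]) (g y)%:E)%E = (a Y)%:E) /\
    `|a Y - \int[mu]_(y in `[0, Y]) g' y| <= 2 * M * y1.
  move=> yY.
  have mp : measurable_fun [set: R] (fun y => Num.max (g' y) 0) by exact: measurable_maxr.
  have mn : measurable_fun [set: R] (fun y => Num.max (- g' y) 0).
    by apply: measurable_maxr => //; exact: measurable_funN.
  have [|Ip IpE Ip'] := integral_modification y10 yY (pos g gM) (pos g' g'M) mp.
    by move=> y /gg' ->.
  have [|In InE In'] := integral_modification y10 yY (neg g gM) (neg g' g'M) mn.
    by move=> y /gg' ->.
  have gE : (\int[mu]_(y in `[0%R, Y]) (g y)%:E)%E = (Ip - In)%:E.
    rewrite integralE EFinB -IpE -InE; congr (_ - _)%E; apply: eq_integral => y _.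
      by rewrite funeposE EFin_max.
    by rewrite funenegE -EFinN EFin_max.
  rewrite /a gE/=; split => //.
  have bp : bounded_measurable (fun y => Num.max (g' y) 0).
    by split => //; exists M => y; have /andP[h0 h1] := pos _ g'M y; rewrite ger0_norm.
  have bn : bounded_measurable (fun y => Num.max (- g' y) 0).
    by split => //; exists M => y; have /andP[h0 h1] := neg _ g'M y; rewrite ger0_norm.
  have -> : \int[mu]_(y in `[0, Y]) g' y = \int[mu]_(y in `[0, Y]) Num.max (g' y) 0 -
      \int[mu]_(y in `[0, Y]) Num.max (- g' y) 0.
    rewrite -RintegralB//; [|exact: bounded_measurable_integrable..].
    apply: eq_Rintegral => y _; rewrite !maxEle oppr_le0.
    by case: (leP (g' y) 0) => h; case: (leP 0 (g' y)) => h'; lra.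
  by move: Ip' In'; rewrite !ler_norml => /andP[u1 u2] /andP[v1 v2]; apply/andP; split; lra.
have near_a : \forall Y \near +oo, (Y^-1 * a Y)%:E =
    ((Y^-1)%:E * \int[mu]_(y in `[0%R, Y]) (g y)%:E)%E.
  near=> Y; have yY : y1 <= Y by near: Y; apply: nbhs_pinfty_ge; exact: num_real.
  by have [-> _] := H Y yY; rewrite EFinM.
apply: cvg_trans; first by apply: near_eq_cvg near_a.
apply: cvg_EFin; first by near=> Y.
apply/cvgrPdist_le => e e0; have e2 : 0 < e / 2 by rewrite divr_gt0.
near=> Y => /=.
have Y0 : 0 < Y by [].
have yY : y1 <= Y by near: Y; apply: nbhs_pinfty_ge; exact: num_real.
have [_ HY] := H Y yY.
have h1 : `|m - avg g' Y| <= e / 2.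
  by near: Y; move/cvgrPdist_le : hm; apply.
rewrite -(subrK (avg g' Y) m) -addrA (le_trans (ler_normD _ _))// (splitr e) lerD//.
rewrite /avg -mulrBr normrM normfV (gtr0_norm Y0) distrC ler_pdivrMl// (le_trans HY)//.
by rewrite -ler_pdivrMr//; near: Y; apply: nbhs_pinfty_ge; exact: num_real.
Unshelve. all: by end_near. Qed.

End InitialSegment.

(** * The Fourier transform *)

Lemma continuous_sum_real (R : realType) (T : topologicalType) (I : Type)
    (s : seq I) (P : pred I) (g : I -> T -> R) :
  (forall i, continuous (g i)) -> continuous (fun y => \sum_(i <- s | P i) g i y).
Proof.
move=> cg; elim: s => [|i s IH].
  rewrite (_ : (fun _ => _) = cst 0); first exact: cst_continuous.
  by apply/funext => y; rewrite big_nil.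
rewrite (_ : (fun _ => _) = fun y => (P i)%:R * g i y + \sum_(j <- s | P j) g j y).
  move=> y; apply: (@continuousD _ _ _ (fun y => (P i)%:R * g i y)); last exact: IH.
  exact: (continuousM (@cst_continuous _ _ _ y) (cg i y)).
by apply/funext => y; rewrite big_cons; case: ifP => _; rewrite ?mul1r// mul0r add0r.
Qed.

Section TrigonometricSums.
Context {R : realType}.
Variables (lam : nat -> R) (r : nat -> R[i]).
Hypothesis lam_oo : lam n @[n --> \oo] --> +oo.

Lemma trigsum_cos (X : R) : exists K : nat, trigsum lam r X =
  fun y => \sum_(n < K | lam n <= X) (complex.Re (r n) * cos (lam n * y + 0) +
    complex.Im (r n) * cos (lam n * y + pi / 2)).
Proof.
have [K KX] := frequency_cut lam_oo X; exists K; apply/funext => y.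
rewrite (trigsumE r _ KX); apply: eq_bigr => n _.
by rewrite cosDpihalf addr0 mulrN.
Qed.

Lemma trigsum_ttb (X : R) : translation_totally_bounded (trigsum lam r X).
Proof.
have [K ->] := trigsum_cos X; apply: ttb_sum => n.
by apply: ttbD; apply: ttbZ; exact: ttb_cos.
Qed.

Lemma trigsum_continuous (X : R) : continuous (trigsum lam r X).
Proof.
have [K ->] := trigsum_cos X; apply: continuous_sum_real => n y.
by apply: cvgD; apply: cvgMl_tmp; exact: continuous_cos_affine.
Qed.

End TrigonometricSums.

(** Cosine and sine merge into one tone of amplitude [cabs z]. The phase does not affect the means,
    which is why only absolute values enter the Bessel factors. *)
Lemma polar_form (R : realType) (z : R[i]) : exists th : R, forall x : R,
  complex.Re z * cos x - complex.Im z * sin x = cabs z * cos (x + th).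
Proof.
case: z => p q; rewrite /cabs/=; set b := Num.sqrt _.
have b2 : b ^+ 2 = p ^+ 2 + q ^+ 2 by rewrite sqr_sqrtr// addr_ge0 ?sqr_ge0.
have b0 : 0 <= b := sqrtr_ge0 _.
suff [th [-> ->]] : exists th : R, p = b * cos th /\ q = b * sin th.
  by exists th => x; rewrite cosD; ring.
have [bz|bn] := eqVneq b 0.
  have : p ^+ 2 + q ^+ 2 = 0 by rewrite -b2 bz expr0n.
  move/eqP; rewrite paddr_eq0 ?sqr_ge0// !sqrf_eq0 => /andP[/eqP -> /eqP ->].
  by exists 0; rewrite bz !mul0r.
have bp : 0 < b by rewrite lt_neqAle eq_sym bn.
have pq1 : (p / b) ^+ 2 + (q / b) ^+ 2 = 1.
  by rewrite !expr_div_n -mulrDl -b2 divff// expf_neq0.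
have p1 : -1 <= p / b <= 1.
  by rewrite -ler_norml -sqrtr_sqr -[leRHS]sqrtr1 ler_sqrt// -pq1 lerDl sqr_ge0.
pose s := Num.sqrt (1 - (p / b) ^+ 2).
have sE : s = `|q / b|.
  by rewrite /s -pq1 addrC addKr sqrtr_sqr.
(* [acos] determines the angle up to sign; the sign of [q] settles it. *)
have [q0|q0] := leP 0 q.
  exists (acos (p / b)); rewrite acosK ?in_itv//= sin_acos// -/s sE ger0_norm ?divr_ge0//.
  by split; rewrite mulrC divfK.
exists (- acos (p / b)); rewrite cosN sinN acosK ?in_itv//= sin_acos// -/s sE.
rewrite ltr0_norm ?opprK; last by rewrite pmulr_llt0 ?invr_gt0.
by split; rewrite mulrC divfK.
Qed.

Lemma dotv_continuous (R : realType) (l : nat) (xi : 'rV[R]_l) : continuous (dotv xi).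
Proof.
apply: (continuous_sum_real (g := fun k (t : 'rV[R]_l) => xi ord0 k * t ord0 k)) => k t.
exact: (continuousM (@cst_continuous _ _ _ t) (@coord_continuous _ _ _ ord0 k t)).
Qed.

Lemma increasing_seq_inj (R : realType) (u : nat -> R) :
  (forall m n, (m < n)%N -> u m < u n) -> injective u.
Proof. by move=> H m n mn; case: (ltngtP m n) => // /H; rewrite mn ltxx. Qed.

(** * The merged spectrum and the dot product with [xi] *)

Section FourierTransform.
Context {R : realType} {l : nat}.
Variables (lam : 'I_l -> nat -> R) (r : 'I_l -> nat -> R[i]) (c : 'I_l -> R).
Hypothesis lam_incr : forall k m n, (m < n)%N -> lam k m < lam k n.
Hypothesis lam_oo : forall k, lam k n @[n --> \oo] --> +oo.
Variable Lam : nat -> R.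
Hypothesis Lam_incr : forall m n, (m < n)%N -> Lam m < Lam n.
Hypothesis LamE : forall x, (exists m, Lam m = x) <-> (exists (k : 'I_l) n, lam k n = x).
Variable xi : 'rV[R]_l.

Let Lam_inj : injective Lam := increasing_seq_inj Lam_incr.
Let lam_inj k : injective (lam k) := increasing_seq_inj (@lam_incr k).

Lemma le_Lam m n : (Lam m <= Lam n) = (m <= n)%N.
Proof.
case: (leqP m n) => [|/Lam_incr]; last by rewrite leNgt => ->.
by rewrite leq_eqVlt => /predU1P[->|/Lam_incr/ltW ->]; rewrite ?lexx.
Qed.

(** [Lam 0] belongs to some spectrum [lam k], so a component exists, and [Lam] enumerates all of its
    unbounded frequencies. *)
Lemma Lam_oo (X : R) : exists M0 : nat, forall M, (M0 <= M)%N -> X <= Lam M.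
Proof.
have [k [n0 _]] := (LamE (Lam 0)).1 (ex_intro _ 0%N erefl).
have [K KX] := frequency_cut (lam_oo k) X.
have [m mE] := (LamE (lam k K)).2 (ex_intro _ k (ex_intro _ K erefl)).
exists m => M mM; apply: ltW; apply: lt_le_trans (KX K (leqnn _)) _.
by rewrite -mE le_Lam.
Qed.

Lemma rcoef_lam k n : rcoef (lam k) (r k) (lam k n) = r k n.
Proof.
rewrite /rcoef; case: pselect => [H|[]]; last by exists n.
by case: (cid H) => m/= /lam_inj ->.
Qed.

Lemma rcoef_out k x : (forall n, lam k n != x) -> rcoef (lam k) (r k) x = 0.
Proof.
move=> H; rewrite /rcoef; case: pselect => // nE; exfalso; move: nE => [n /eqP].
by rewrite (negbTE (H n)).
Qed.

Let rc k m := rcoef (lam k) (r k) (Lam m).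

(** Merged frequencies absent from [lam k] have coefficient 0 by the default value of [rcoef]; the
    others come from a single index by injectivity. The cutoff [Lam M] is inclusive, hence [M.+1]
    terms. *)
Lemma trigsum_Lam k (M : nat) y : trigsum (lam k) (r k) (Lam M) y =
  \sum_(m < M.+1) (complex.Re (rc k m) * cos (Lam m * y) - complex.Im (rc k m) * sin (Lam m * y)).
Proof.
have [K KM] := frequency_cut (lam_oo k) (Lam M).
rewrite (trigsumE (r k) _ KM).
have /choice[idx idxE] n : exists m, Lam m = lam k n.
  by apply/LamE; exists k, n.
have idxM n : lam k n <= Lam M -> (idx n < M.+1)%N.
  by rewrite -idxE le_Lam.
rewrite (partition_big (fun n : 'I_K => inord (idx n) : 'I_M.+1) xpredT)//=.
apply: eq_bigr => m _.
have [[n nm]|H] := pselect (exists n, lam k n = Lam m).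
  have nK : (n < K)%N.
    rewrite ltnNge; apply/negP => /KM; rewrite nm ltNge le_Lam.
    by rewrite -ltnS ltn_ord.
  rewrite (big_pred1 (Ordinal nK)) => [|i].
    by rewrite /= nm /rc -nm rcoef_lam.
  rewrite -val_eqE -[RHS]val_eqE/=; apply/andP/eqP => [[iM]|in_].
    rewrite inordK ?idxM// => /eqP im.
    have : lam k i = lam k n by rewrite nm -im idxE.
    exact: lam_inj.
  have iM : lam k i <= Lam M by rewrite in_ nm le_Lam -ltnS.
  split => //; rewrite inordK ?idxM//; apply/eqP; apply: Lam_inj.
  by rewrite idxE in_ nm.
rewrite big_pred0 => [|i].
  by rewrite /rc rcoef_out ?mul0r ?subr0// => n; apply/eqP => nm; apply: H; exists n.
apply/negP => /andP[iM /eqP im]; apply: H; exists i.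
by rewrite -idxE -im inordK// idxM.
Qed.

Let rho m : R[i] := \sum_(k < l) rc k m * ((xi ord0 k)%:C)%C.

Let Re_rho m : complex.Re (rho m) = \sum_(k < l) xi ord0 k * complex.Re (rc k m).
Proof.
rewrite /rho raddf_sum; apply: eq_bigr => k _.
by case: (rc k m) => p q /=; rewrite mulr0 subr0 mulrC.
Qed.

Let Im_rho m : complex.Im (rho m) = \sum_(k < l) xi ord0 k * complex.Im (rc k m).
Proof.
rewrite /rho raddf_sum; apply: eq_bigr => k _.
by case: (rc k m) => p q /=; rewrite mulr0 add0r mulrC.
Qed.

(** Phases are chosen frequency by frequency, so one sequence [th] serves every [M]. *)
Lemma dotv_trigsum : exists th : nat -> R, forall M y,
  dotv xi (\row_k (c k + trigsum (lam k) (r k) (Lam M) y)) =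
  \sum_(k < l) c k * xi ord0 k + tone_sum Lam (fun m => cabs (rho m)) th M.+1 y.
Proof.
have /choice[th thP] m := polar_form (rho m); exists th => M y.
rewrite /dotv; under eq_bigr do rewrite mxE mulrDr.
rewrite big_split/=; congr (_ + _); first by apply: eq_bigr => k _; rewrite mulrC.
rewrite /tone_sum; under [RHS]eq_bigr do rewrite -thP Re_rho Im_rho !mulr_suml -sumrB.
rewrite exchange_big/=; apply: eq_bigr => k _.
rewrite trigsum_Lam mulr_sumr; apply: eq_bigr => m _; ring.
Qed.

End FourierTransform.

(** The matrix with rows [(cos C, sin C)] and [(sin C, - cos C)] is its own inverse, so convergence
    of the transformed pair gives that of [A] and [B]. *)
Lemma fourier_mean_limit (R : realType) (A B : nat -> R) (C cs sn : R) :
  (fun M => cos C * A M + sin C * B M) @ \oo --> cs ->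
  (fun M => sin C * A M - cos C * B M) @ \oo --> sn ->
  A @ \oo --> cos C * cs + sin C * sn /\ B @ \oo --> sin C * cs - cos C * sn.
Proof.
move=> hc hs; have cs1 := cos2Dsin2 C.
have mulc (x a : R) (u : nat -> R) : u @ \oo --> a -> (fun M => x * u M) @ \oo --> x * a.
  exact: cvgMl_tmp.
split.
  rewrite (_ : A = fun M => cos C * (cos C * A M + sin C * B M) +
      sin C * (sin C * A M - cos C * B M)).
    by apply: cvgD; exact: mulc.
  by apply/funext => M; rewrite -[LHS]mul1r -cs1; ring.
rewrite (_ : B = fun M => sin C * (cos C * A M + sin C * B M) -
    cos C * (sin C * A M - cos C * B M)).
  by apply: cvgB; exact: mulc.
by apply/funext => M; rewrite -[LHS]mul1r -cs1; ring.
Qed.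

Unset Implicit Arguments.
Set Strict Implicit.

Theorem theorem1p9 (R : realType) (l : nat)
    (phi : 'I_l -> R -> R) (lam : 'I_l -> nat -> R) (r : 'I_l -> nat -> R[i])
    (c : 'I_l -> R) :
  (forall k : 'I_l,
     (forall n, 0 < lam k n) /\
     (forall m n, (m < n)%N -> lam k m < lam k n) /\
     lam k n @[n --> \oo] --> +oo /\
     exists y0 : R, 0 <= y0 /\
       lebesgue_measure.-integrable `[0, y0] (fun y => (phi k y ^+ 2)%:E) /\
       measurable_fun `[y0, +oo[ (phi k) /\
       exists (X0 : R) (E : R -> R -> R), 0 < X0 /\
         (forall y X, y0 <= y -> X0 <= X ->
            phi k y = c k + trigsum (lam k) (r k) X y + E y X) /\
         ((fun Y : R => ((Y^-1)%:E *
             \int[lebesgue_measure]_(y in `[y0, Y]) ((E y (expR Y)) ^+ 2)%:E)%E)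
            @ +oo%R --> 0%E) /\
         (condA (lam k) (r k) \/ condB (lam k) (r k) \/
          condC (lam k) (r k) \/ condD (lam k) (r k))) ->
  exists mu : probability (RBorel R l) R,
    limiting_distribution (fun y => \row_k phi k y) mu /\
    forall Lam : nat -> R,
      (forall m n, (m < n)%N -> Lam m < Lam n) ->
      (forall x, (exists m, Lam m = x) <-> (exists (k : 'I_l) n, lam k n = x)) ->
      Q_lin_indep Lam ->
      forall xi : 'rV[R]_l,
        fourier_exists mu xi /\
        exists L : R[i],
          (fun M => complex.Re (\prod_(m < M)
              J0 (cabs (\sum_(k < l) rcoef (lam k) (r k) (Lam m) * ((xi ord0 k)%:C)%C))))
            @ \oo --> complex.Re L /\
          (fun M => complex.Im (\prod_(m < M)
              J0 (cabs (\sum_(k < l) rcoef (lam k) (r k) (Lam m) * ((xi ord0 k)%:C)%C))))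
            @ \oo --> complex.Im L /\
          fourier mu xi =
            (cos (\sum_(k < l) c k * xi ord0 k) -i* sin (\sum_(k < l) c k * xi ord0 k))%C * L.
Proof.
move=> H.
have /choice[y0 y0P] : forall k, exists y0 : R, [/\ 0 <= y0, measurable_fun `[y0, +oo[ (phi k) &
    forall e, 0 < e -> exists X1, forall X, X1 <= X ->
      mean_le (fun y => (cut y0 (phi k) y - (c k + trigsum (lam k) (r k) X y)) ^+ 2) e].
  move=> k; have [l0 [li [loo [y0 [y00 [_ [mphi [X0 [E [_ [phiE [Esm cond]]]]]]]]]]]] := H k.
  exists y0; split => // e e0.
  have sm := conditions_block loo li cond.
  exact: (quadratic_approximation l0 loo sm y00 mphi phiE Esm e0).
have loo k : lam k n @[n --> \oo] --> +oo by have [_ [_ []]] := H k.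
have li k : forall m n, (m < n)%N -> lam k m < lam k n by have [_ []] := H k.
pose Phi k := cut (y0 k) (phi k).
pose P X k y := c k + trigsum (lam k) (r k) X y.
have mPhi k : measurable_fun [set: R] (Phi k).
  by have [_ mphi _] := y0P k; exact: measurable_cut.
have cP X k : continuous (P X k).
  by move=> y; apply: cvgD; [exact: cvg_cst|exact: trigsum_continuous].
have bP X : exists B, forall k y, `|P X k y| <= B.
  have /choice[B BP] k : exists B, forall y, `|P X k y| <= B.
    have [_ [B hB]] := bounded_measurableD (bounded_measurable_cst (c k))
      (trigsum_bounded_measurable (r k) (loo k) X).
    by exists B.
  exists (\sum_k `|B k|) => k y; apply: le_trans (BP k y) _.
  by rewrite (le_trans (ler_norm _))// (bigD1 k)//= lerDl sumr_ge0.
have tP X k : translation_totally_bounded (P X k).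
  by apply: ttbD; [exact: ttb_cst|exact: trigsum_ttb].
have PhiP k e : 0 < e -> exists X1, forall X, X1 <= X ->
    mean_le (fun y => (Phi k y - P X k y) ^+ 2) e.
  by have [_ _] := y0P k; exact.
have [mu muP] := limiting_measure_exists mPhi cP bP tP PhiP.
exists mu; split.
  move=> f cf [M fM].
  have bf : bounded_continuous f by split => //; exists M.
  have -> : (\int[mu]_t (f t)%:E)%E = (\int[mu]_t f t)%:E.
    rewrite /Rintegral fineK//; apply: integrable_fin_num => //.
    exact: bounded_continuous_integrable.
  (* The sum of the [y0 k] is a common threshold for all components. *)
  have y1_ge k : y0 k <= \sum_j y0 j.
    by rewrite (bigD1 k)//= lerDl sumr_ge0// => j _; have [] := y0P j.
  apply: (@cvg_mean_modification _ _ (fun y => f (\row_k Phi k y)) M (\sum_k y0 k)) => //.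
  - by apply: sumr_ge0 => k _; have [] := y0P k.
  - exact: measurable_comp_row.
  - move=> y yy; congr f; apply/rowP => k; rewrite !mxE /Phi /cut.
    by rewrite (le_trans (y1_ge k) yy).
  - exact: muP.
move=> Lam Lam_incr LamE Lam_free xi.
have bcos : bounded_continuous (fun t => cos (dotv xi t)).
  split; last by exists 1 => x; exact: cos_max.
  by move=> t; apply: continuous_comp; [exact: dotv_continuous|exact: continuous_cos].
have bsin : bounded_continuous (fun t => sin (dotv xi t)).
  split; last by exists 1 => x; exact: sin_max.
  by move=> t; apply: continuous_comp; [exact: dotv_continuous|exact: continuous_sin].
split; first by split; exact: bounded_continuous_integrable.
set C := \sum_(k < l) c k * xi ord0 k.
pose rho m := \sum_(k < l) rcoef (lam k) (r k) (Lam m) * ((xi ord0 k)%:C)%C.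
pose Pi (M : nat) := \prod_(m < M) J0 (cabs (rho m)).
have [th thP] := dotv_trigsum r c li loo Lam_incr LamE xi.
pose S M y := tone_sum Lam (fun m => cabs (rho m)) th M y.
have means M := tone_sum_mean (fun m => cabs (rho m)) th Lam_free M.
have bS (f : R -> R) M : continuous f -> (forall x, `|f x| <= 1) -> bounded_measurable (fun y => f (S M y)).
  exact: tone_sum_bounded_measurable.
have bcS M := bS _ M (@continuous_cos R) (@cos_max R).
have bsS M := bS _ M (@continuous_sin R) (@sin_max R).
have mcos M : has_mean (fun y => cos (dotv xi (\row_k P (Lam M) k y)))
    (cos C * complex.Re (Pi M.+1) + sin C * complex.Im (Pi M.+1)).
  have [hc hs _ _] := means M.+1.
  have := has_meanD (bounded_measurableZ (cos C) (bcS M.+1)) (bounded_measurableZ (- sin C) (bsS M.+1))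
    (has_meanZ (bcS M.+1) hc) (has_meanZ (bsS M.+1) hs).
  (* The sine has mean minus the imaginary part of the product; this sign cancels the one in
     [cosD]. *)
  rewrite mulrNN; apply: eq_has_mean => y.
  by rewrite thP cosD mulNr.
have msin M : has_mean (fun y => sin (dotv xi (\row_k P (Lam M) k y)))
    (sin C * complex.Re (Pi M.+1) - cos C * complex.Im (Pi M.+1)).
  have [hc hs _ _] := means M.+1.
  have := has_meanD (bounded_measurableZ (sin C) (bcS M.+1)) (bounded_measurableZ (cos C) (bsS M.+1))
    (has_meanZ (bcS M.+1) hc) (has_meanZ (bsS M.+1) hs).
  by rewrite mulrN; apply: eq_has_mean => y; rewrite thP sinD.
(* Both means being limits, a uniform bound on the averages for large [Y] passes to [m M] and the
   integral; the infinite product converges as a consequence. *)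
have approx f (m : nat -> R) : bounded_continuous f ->
    (forall M, has_mean (fun y => f (\row_k P (Lam M) k y)) (m M)) ->
    m M @[M --> \oo] --> \int[mu]_t f t.
  move=> bf hm; apply/cvgrPdist_le => e e0.
  have [X1 HX] := mean_approximation mPhi cP bP PhiP bf e0.
  have [M0 HM] := Lam_oo loo Lam_incr LamE X1.
  exists M0 => // M /= /HM /HX; exact: has_mean_dist (muP f bf) (hm M).
have [hA hB] := fourier_mean_limit (approx _ _ bcos mcos) (approx _ _ bsin msin).
set cs := \int[mu]_t _ in hA hB; set sn := \int[mu]_t sin _ in hA hB.
(* This is [exp (i C)] times the Fourier transform [cs - i sn]. *)
exists ((cos C * cs + sin C * sn) +i* (sin C * cs - cos C * sn))%C => /=.
(* The polynomial cut at [Lam M] gave the product of [M.+1] factors, hence the shift. *)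
split; first by rewrite -cvg_shiftS.
split; first by rewrite -cvg_shiftS.
rewrite /fourier -[fine _]/cs -[fine (\int[mu]_t (sin _)%:E)%E]/sn.
have cs1 := cos2Dsin2 C.
by apply/eqP; rewrite eq_complex /=; apply/andP; split; apply/eqP;
  rewrite -[LHS]mul1r -cs1; ring.
Qed.
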